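(* Let $t\in\mathbb{C}$ be generic, and for each of the following diagram categories with parameter $t$ let $b_n$ be the number of indecomposable direct summands of $\bullet^{\otimes n}$ (counted with multiplicities), where $\bullet$ is the generating object. As $n\to\infty$: (1) for the partition category $\mathcal{P}\mathrm{a}_t$: $\sqrt[n]{b_n}\sim\frac{2}{e}\cdot\frac{n}{\log 2n}$; (2) for the rook-Brauer category $\mathcal{R}\mathrm{o}\mathcal{B}\mathrm{r}_t$: $\sqrt[n]{b_n}\sim\frac{\sqrt2}{\sqrt e}\cdot\sqrt n$; (3) for the Brauer category $\mathcal{B}\mathrm{r}_t$: $\sqrt[n]{b_n}\sim\frac{\sqrt2}{\sqrt e}\cdot\sqrt n$; (4) for the rook category $\mathcal{R}\mathrm{o}_t$: $\sqrt[n]{b_n}\sim\frac{1}{\sqrt e}\cdot\sqrt n$; (5) for the symmetric category $\mathcal{S}_t$: $\sqrt[n]{b_n}\sim\frac{1}{\sqrt e}\cdot\sqrt n$.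
   Context: $f(n)\sim g(n)$ means $f(n)/g(n)\to1$ as $n\to\infty$. The partition category $\mathcal{P}\mathrm{a}_t$ is the $\mathbb{C}$-linear strict symmetric monoidal category with objects $\bullet^{\otimes n}$, $n\in\mathbb{Z}_{\geq0}$, where $\mathrm{Hom}(\bullet^{\otimes m},\bullet^{\otimes n})$ has as basis the set partitions of the disjoint union of $m$ bottom points and $n$ top points (drawn as diagrams, blocks being connected components). Composition is vertical stacking of diagrams: form the connected components, restrict to the outer bottom and top points, and multiply by $t^{c}$, where $c$ is the number of components touching neither the outer bottom nor the outer top. The tensor product is horizontal juxtaposition. The other categories are the monoidal subcategories with the same objects, with Hom-spaces spanned by the following diagrams: rook-Brauer: all blocks have size $1$ or $2$; Brauer: all blocks have size $2$; rook: all blocks have size $1$ or $2$, and each block has at most one bottom point and at most one top point; symmetric: each block consists of exactly one bottom and one top point (permutations). Generic $t$ means that the category is semisimple, i.e. all endomorphism algebras of the objects $\bullet^{\otimes n}$ are semisimple. Direct summands are taken in the additive Karoubi envelope. *)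

(* Defs.v *)
From HB Require Import structures.
From mathcomp Require Import all_classical all_reals all_analysis.
From mathcomp Require Import all_boot all_order all_algebra complex.

Set Implicit Arguments.
Unset Strict Implicit.
Unset Printing Implicit Defensive.

Import Order.TTheory GRing.Theory Num.Theory numFieldNormedType.Exports.
Local Open Scope ring_scope.

(* A diagram from m to n is a set partition of 'I_m + 'I_n: [inl] for the
   bottom points, [inr] for the top points. *)
Definition blocks (m n : nat) := {set {set 'I_m + 'I_n}}.

(* The classes of diagrams considered are given by a condition on each block. *)
Definition block_cond := forall m n : nat, pred {set 'I_m + 'I_n}.

Section Blocks.
Variables m n : nat.
Implicit Type B : {set 'I_m + 'I_n}.

Definition bottoms B : {set 'I_m} := [set i | inl i \in B].
Definition tops B : {set 'I_n} := [set j | inr j \in B].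

Definition any_block : pred {set 'I_m + 'I_n} := fun B => true.
Definition rook_brauer_block : pred {set 'I_m + 'I_n} :=
  fun B => (#|B| == 1%N) || (#|B| == 2%N).
Definition brauer_block : pred {set 'I_m + 'I_n} := fun B => #|B| == 2%N.
Definition rook_block : pred {set 'I_m + 'I_n} := fun B =>
  ((#|B| == 1%N) || (#|B| == 2%N)) && (#|bottoms B| <= 1)%N && (#|tops B| <= 1)%N.
Definition permutation_block : pred {set 'I_m + 'I_n} :=
  fun B => (#|bottoms B| == 1%N) && (#|tops B| == 1%N).
End Blocks.

Section Stacking.
Variables l m n : nat.

(* The bottom, middle and top points of a stack of two diagrams. *)
Definition stack_pts : Type := ('I_l + 'I_m) + 'I_n.

Definition low (x : 'I_l + 'I_m) : stack_pts := inl x.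
Definition high (x : 'I_m + 'I_n) : stack_pts :=
  match x with inl j => inl (inr j) | inr k => inr k end.
Definition outer (x : 'I_l + 'I_n) : stack_pts :=
  match x with inl i => inl (inl i) | inr k => inr k end.

Variables (p : blocks l m) (q : blocks m n).

Definition stack_adj : rel stack_pts := fun x y =>
  [exists B in p, (x \in low @: B) && (y \in low @: B)]
  || [exists B in q, (x \in high @: B) && (y \in high @: B)].

Definition components : {set {set stack_pts}} :=
  equivalence_partition (connect stack_adj) [set: stack_pts].

(* q stacked on top of p, restricted to the outer points. *)
Definition stack : blocks l n :=
  [set outer @^-1: A | A : {set stack_pts} in components] :\ set0.

Definition floating : nat := #|[set A in components | outer @^-1: A == set0]|.

End Stacking.
Arguments low {l m n} x.
Arguments high {l m n} x.
Arguments outer {l m n} x.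

Definition id_blocks (n : nat) : blocks n n :=
  [set [set inl i; inr i] | i : 'I_n].

Section IdBlocks.
Variable n : nat.

(* The strand of the stack of two identity diagrams to which a point belongs. *)
Let strand (x : stack_pts n n n) : 'I_n :=
  match x with inl (inl i) | inl (inr i) | inr i => i end.

Lemma stack_adj_id x y :
  stack_adj (id_blocks n) (id_blocks n) x y -> strand x = strand y.
Proof.
by case/orP=> /existsP[B /andP[/imsetP[i _ ->]]] /andP[/imsetP[u + ->]];
  rewrite !inE => + /imsetP[v + ->]; rewrite !inE;
  do 2![case/orP=> /eqP->].
Qed.

Lemma connect_id x y :
  connect (stack_adj (id_blocks n) (id_blocks n)) x y = (strand x == strand y).
Proof.
set e := stack_adj _ _.
have cs : connect_sym e.
  by apply: sym_connect_sym => a b; rewrite /e /stack_adj; congr (_ || _);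
     apply: eq_existsb => B; congr (_ && _); rewrite andbC.
have to_mid u : connect e u (inl (inr (strand u))).
  case: u => [[i|i]|i] //=; apply: connect1; apply/orP.
    left; apply/existsP; exists [set inl i; inr i]; apply/andP; split.
      exact: imset_f.
    by rewrite !imset_f // !inE eqxx ?orbT.
  right; apply/existsP; exists [set inl i; inr i]; apply/andP; split.
    exact: imset_f.
  by rewrite (imset_f high (x := inr i)) ?(imset_f high (x := inl i)) //
     !inE eqxx ?orbT.
apply/idP/eqP => [|xy].
  case/connectP=> s + ->; elim: s x => //= z s IH x /andP[/stack_adj_id -> /IH].
  by [].
by apply: connect_trans (to_mid x) _; rewrite xy cs.
Qed.

Lemma outer_component_id x :
  outer @^-1: [set y in [set: stack_pts n n n] |
    connect (stack_adj (id_blocks n) (id_blocks n)) x y]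
  = [set inl (strand x); inr (strand x)].
Proof.
by apply/setP=> -[i|i]; rewrite !inE connect_id /= eq_sym ?orbF.
Qed.

Lemma stack_id : stack (id_blocks n) (id_blocks n) = id_blocks n.
Proof.
apply/setP=> B; rewrite !inE; apply/andP/imsetP.
  by case=> _ /imsetP[A /imsetP[x _ ->] ->]; exists (strand x);
     rewrite // outer_component_id.
case=> i _ ->; split; first by apply/set0Pn; exists (inl i); rewrite !inE eqxx.
apply/imsetP; eexists; first by apply/imsetP; exists (inr i).
by rewrite outer_component_id.
Qed.

Lemma floating_id : floating (id_blocks n) (id_blocks n) = 0%N.
Proof.
apply/eqP; rewrite cards_eq0; apply/eqP/setP=> A; rewrite !inE.
apply/negP=> /andP[/imsetP[x _ ->]]; rewrite outer_component_id.
by move=> /eqP/setP/(_ (inl (strand x))); rewrite !inE eqxx.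
Qed.
End IdBlocks.

Section DiagramCategory.
Variables (K : fieldType) (t : K) (S : block_cond).

(* The objects are the natural numbers, n standing for the n-th tensor power
   of the generating object. *)

Definition diagram (m n : nat) :=
  {P : blocks m n | partition P [set: 'I_m + 'I_n] && [forall B in P, @S m n B]}.

(* The vector space with basis [diagram m n]: f d is the coefficient of d. *)
Definition Hom (m n : nat) := {ffun diagram m n -> K^o}.

(* The bilinear extension of q o p = t ^ floating p q . stack p q. The stack of
   two diagrams in any of the five classes above is again in that class, so no
   term is lost by reading off the coefficients at [diagram l n] only. *)
Definition comp_coef (l m n : nat) (g : Hom m n) (f : Hom l m)
    (d : diagram l n) : K :=
  \sum_(p : diagram l m)
    \sum_(q : diagram m n | stack (val p) (val q) == val d)
      t ^+ floating (val p) (val q) * (g q * f p).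

Definition comp (l m n : nat) (g : Hom m n) (f : Hom l m) : Hom l n :=
  [ffun d => comp_coef g f d].

Definition idm (n : nat) : Hom n n :=
  [ffun d : diagram n n => (val d == id_blocks n)%:R : K].

(* Semisimplicity of the algebra Hom n n: every submodule of the left regular
   module has a complement. *)
Definition left_ideal (n : nat) (U : {vspace Hom n n}) : Prop :=
  forall a x : Hom n n, x \in U -> comp a x \in U.

Definition semisimple_End (n : nat) : Prop :=
  forall U : {vspace Hom n n}, left_ideal U ->
  exists V : {vspace Hom n n},
    [/\ left_ideal V, (U + V = fullv)%VS & (U :&: V = 0)%VS].

Definition generic : Prop := forall n : nat, semisimple_End n.

(* Additive envelope: finite families of objects and matrices of morphisms. *)
Record addOb := AddOb { idx : finType; fam : idx -> nat }.

Definition addHom (X Y : addOb) : Type :=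
  forall (j : idx Y) (i : idx X), Hom (fam i) (fam j).

Definition addComp (X Y Z : addOb) (g : addHom Y Z) (f : addHom X Y) :
    addHom X Z :=
  fun k i => \sum_(j : idx Y) comp (g k j) (f j i).

Definition addZero (X Y : addOb) : addHom X Y := fun _ _ => 0.

(* Karoubi envelope of the additive envelope; the identity of a Karoubi object
   is its idempotent. *)
Record karOb := KarOb {
  kar_ob : addOb;
  kar_idem : addHom kar_ob kar_ob;
  kar_idemP : addComp kar_idem kar_idem = kar_idem }.
Arguments kar_idem : clear implicits.

Definition is_karHom (X Y : karOb) (f : addHom (kar_ob X) (kar_ob Y)) : Prop :=
  addComp (kar_idem Y) (addComp f (kar_idem X)) = f.

Definition kar_zero (X : karOb) : Prop :=
  kar_idem X = @addZero (kar_ob X) (kar_ob X).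

(* X is a direct sum (biproduct) of the Y i. *)
Definition direct_sum (X : karOb) (I : finType) (Y : I -> karOb) : Prop :=
  exists (inc : forall i, addHom (kar_ob (Y i)) (kar_ob X))
         (prj : forall i, addHom (kar_ob X) (kar_ob (Y i))),
  [/\ forall i, is_karHom (inc i) /\ is_karHom (prj i),
      forall i, addComp (prj i) (inc i) = kar_idem (Y i),
      forall i j, i != j ->
        addComp (prj j) (inc i) = @addZero (kar_ob (Y i)) (kar_ob (Y j))
    & forall a b, \sum_(i : I) addComp (inc i) (prj i) a b = kar_idem X a b].

Definition indecomposable (X : karOb) : Prop :=
  ~ kar_zero X /\
  (forall Y : bool -> karOb, direct_sum X Y -> exists b, kar_zero (Y b)).

Definition add_single (n : nat) : addOb := @AddOb unit (fun _ => n).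

Definition idm_single (n : nat) : addHom (add_single n) (add_single n) :=
  fun _ _ => idm n.

Lemma comp_idm n : comp (idm n) (idm n) = idm n.
Proof.
apply/ffunP=> d; rewrite !ffunE /comp_coef.
case: (boolP (val d == id_blocks n)) => [/eqP dE|dN]; last first.
  rewrite big1 // => p _; rewrite big1 // => q /eqP pq; rewrite !ffunE.
  case: eqP => [qE|_]; last by rewrite mul0r mulr0.
  case: eqP => [pE|_]; last by rewrite !mulr0.
  by move: dN; rewrite -pq pE qE stack_id eqxx.
rewrite (bigD1 d) //= [X in _ + X]big1 => [|p pd]; last first.
  by rewrite big1 // => q _; rewrite !ffunE -dE (inj_eq val_inj p) (negPf pd)
     !mulr0.
rewrite (bigD1 d) /= ?dE ?stack_id //= big1 => [|q /andP[_ qd]]; last first.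
  by rewrite !ffunE -dE (inj_eq val_inj q) (negPf qd) mul0r mulr0.
by rewrite !ffunE dE eqxx floating_id expr0 !mulr1 !addr0.
Qed.

Lemma idm_single_idem n :
  addComp (@idm_single n) (@idm_single n) = @idm_single n.
Proof.
apply: functional_extensionality_dep => -[].
apply: functional_extensionality_dep => -[].
by rewrite /addComp (bigD1 tt) //= big1 ?addr0 ?comp_idm // => -[].
Qed.

Definition tensor_power (n : nat) : karOb := KarOb (idm_single_idem n).

(* The n-th tensor power of the generating object is a direct sum of k
   indecomposable objects. *)
Definition has_decomposition (n k : nat) : Prop :=
  exists Y : 'I_k -> karOb,
    (forall i, indecomposable (Y i)) /\ direct_sum (tensor_power n) Y.

(* b n is the number of indecomposable summands of the n-th tensor power; this
   includes that decompositions exist and all have the same length. *)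
Definition summand_numbers (b : nat -> nat) : Prop :=
  forall n k : nat, has_decomposition n k <-> k = b n.

End DiagramCategory.
Arguments kar_idem {K t S} k : rename.

Section Asymptotics.
Variable R : realType.

Definition asymptotic_to (f g : nat -> R) : Prop :=
  ((fun n => f n / g n) @ \oo --> (1 : R))%classic.

Definition nth_root (n b : nat) : R := b%:R `^ (n%:R^-1).
End Asymptotics.

(* Main.v *)
(* If End(n) is semisimple with simple modules of dimensions d_c, then
   b_n = sum d_c, whereas the number of diagrams is dim End(n) = sum d_c^2.  So
   dim End(n) <= b_n^2 <= r dim End(n), with r the number of simple modules.

   The factor r is subexponential: the traces of End(-) on the multiplicity
   spaces Hom(n, -)e, e primitive, are linearly independent on End(n), and each
   of them is determined by its values on permutations of k <= n points, since
   a diagram d = u o l cut at its through blocks has the trace of l o u, a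
   diagram on fewer points.  Hence r is at most the number of partitions of the
   integers k <= n, and b_n^(1/n) grows like the 2n-th root of the number of
   diagrams.  For m = 2n points this number is a Bell number B_m, for which
   k^(m - k) <= B_m <= m! exp(exp x) / x^m, or it is n!, respectively
   (2n - 1)!!, up to a factor exp(O(sqrt n)).

   Identities between stacked diagrams are checked on boolean labelings: the
   number of labelings of the middle points that are constant on the blocks of
   p and q is 2 ^ floating p q if the labels of the outer points are constant
   on the blocks of stack p q, and 0 otherwise; and a set partition is
   determined by the labelings constant on its blocks. *)
From HB Require Import structures.
Require Import Defs.
From mathcomp Require Import all_classical all_reals all_analysis.
From mathcomp Require Import all_boot all_order all_algebra complex.
From mathcomp Require Import fingroup perm fingraph zify ring lra.

Set Implicit Arguments.
Unset Strict Implicit.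
Unset Printing Implicit Defensive.

Import Order.TTheory GRing.Theory Num.Theory numFieldNormedType.Exports.
Local Open Scope ring_scope.

(** * Boolean labelings of set partitions *)

(** No classification of the simple modules enters the bound on [r]. The multiplicity spaces Hom(n,
    k)e are taken for all [k] at once, so that the trace is cyclic for morphisms between different
    objects; cyclicity inside a single End(k) could not lower the number of points.

    Traces also replace the structure theory of semisimple algebras. For primitive [e] and [f], the
    trace of the map sending [x] to [e x f] is 1 or 0 according to whether [e] and [f] are
    equivalent. This one fact gives the dimension formula, the independence of the number of
    summands from the decomposition, and the linear independence behind the bound on [r].
    Eigenvalues come from the algebraically closed field, and characteristic 0 lets natural numbers
    be read off from traces.

    Only [ln b_n] up to an error o(n) matters for the n-th root, so crude bounds on the number of
    diagrams suffice, and all five counts share one error scale. *)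

Section Labelings.
Variable T : finType.
Implicit Types (P : {set {set T}}) (u : T -> bool).

Definition compat P u := [forall B in P, forall x in B, forall y in B, u x == u y].

Lemma compatP P u :
  reflect (forall B x y, B \in P -> x \in B -> y \in B -> u x = u y) (compat P u).
Proof.
apply: (iffP idP) => [/forall_inP h B x y BP xB yB|h].
  by have /forall_inP/(_ _ xB)/forall_inP/(_ _ yB)/eqP := h _ BP.
by do 3![apply/forall_inP => ? ?]; apply/eqP/h; eauto.
Qed.

Lemma eq_compat P u v : u =1 v -> compat P u = compat P v.
Proof.
by move=> uv; apply/compatP/compatP => h B x y BP xB yB;
  move: (h B x y BP xB yB); rewrite !uv.
Qed.

(** The indicator function of the block of [x] is a compatible labeling that separates it from all
    other blocks; this is why two labels are enough. *)
Lemma compat_same_block P D x y : partition P D -> x \in D -> y \in D ->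
  (y \in pblock P x) = [forall u : {ffun T -> bool}, compat P u ==> (u x == u y)].
Proof.
move=> pP xD yD; have /and3P[/eqP cP tP n0P] := pP.
have xP : x \in cover P by rewrite cP.
apply/idP/forallP => [yx u|/(_ [ffun z => z \in pblock P x])/implyP].
  apply/implyP => /compatP/(_ (pblock P x)) h; apply/eqP/h => //.
    exact: pblock_mem.
  by rewrite mem_pblock.
rewrite !ffunE mem_pblock xP => h; have /h/eqP// : compat P [ffun z => z \in pblock P x].
apply/compatP => B z t BP zB tB; rewrite !ffunE.
have BE s : s \in B -> pblock P s = B by exact: def_pblock.
have [xB|xB] := boolP (B == pblock P x).
  by rewrite -(eqP xB) zB tB.
have nB s : s \in B -> (s \in pblock P x) = false.
  by move=> sB; apply: contraNF xB => /(same_pblock tP) <-; rewrite BE.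
by rewrite !nB.
Qed.
End Labelings.

Definition glue m n (a : 'I_m -> bool) (b : 'I_n -> bool) (x : 'I_m + 'I_n) : bool :=
  match x with inl i => a i | inr j => b j end.

(** * Components of a stack and its compatible labelings *)

Section Stack.
Variables (l m n : nat) (p : blocks l m) (q : blocks m n).
Local Notation e := (stack_adj p q).
Local Notation V := (stack_pts l m n).

Lemma stack_adj_sym : symmetric e.
Proof.
by move=> x y; rewrite /stack_adj; congr (_ || _); apply: eq_existsb => B;
  rewrite andbA andbAC -andbA.
Qed.


Let connC : connect_sym e := sym_connect_sym stack_adj_sym.

Lemma connect_equiv : {in [set: V] & &, equivalence_rel (connect e)}.
Proof.
move=> x y z _ _ _; split=> // xy; apply/idP/idP => [|yz].
  by apply: connect_trans; rewrite connC.
exact: connect_trans xy yz.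
Qed.

(** Adjacent points share a block of one layer, so compatibility with both layers spreads along
    paths. This is also the tool for proving two points disconnected: it suffices to exhibit a
    compatible labeling that separates them. *)
Lemma stack_labelP (w : V -> bool) :
  reflect (forall x y, connect e x y -> w x = w y)
          (compat p (w \o low) && compat q (w \o high)).
Proof.
apply: (iffP andP) => [[/compatP hp /compatP hq] x y|h].
  case/connectP => s + ->; elim: s x => //= z s IH x /andP[xz /IH <-].
  case/orP: xz => /exists_inP[B BP /andP[/imsetP[a aB ->] /imsetP[b bB ->]]].
    exact: (hp B).
  exact: (hq B).
split; apply/compatP => B x y BP xB yB; apply/h/connect1/orP; [left|right];
  by apply/exists_inP; exists B => //; rewrite !imset_f.
Qed.

Lemma mem_component x A :
  A \in components p q -> x \in A -> A = [set y in [set: V] | connect e x y].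
Proof.
case/imsetP => z _ -> /[!inE]/= zx; apply/setP => y; rewrite !inE.
apply/idP/idP; last exact: connect_trans.
by apply: connect_trans; rewrite connC.
Qed.

(** Floating components restrict to [set0], which [stack] discards; the other restrictions are the
    connectivity classes of the outer points. *)
Lemma stack_eq_partition : stack p q =
  equivalence_partition (fun x y => connect e (outer x) (outer y)) [set: 'I_l + 'I_n].
Proof.
apply/setP => B; rewrite !inE; apply/andP/imsetP => [[n0 /imsetP[A AC BE]]|[x _ ->]].
  have /set0Pn[x xB] := n0; exists x => //; rewrite BE.
  move: xB; rewrite BE inE => /(mem_component AC) ->.
  by apply/setP => y; rewrite !inE.
split; first by apply/set0Pn; exists x; rewrite !inE connect0.
apply/imsetP; exists [set y in [set: V] | connect e (outer x) y].
  by apply/imsetP; exists (outer x).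
by apply/setP => y; rewrite !inE.
Qed.

Lemma partition_stack : partition (stack p q) [set: 'I_l + 'I_n].
Proof.
by rewrite stack_eq_partition; apply: equivalence_partitionP => x y z _ _ _;
  apply: connect_equiv.
Qed.

Lemma compat_stackP u :
  reflect (forall x y, connect e (outer x) (outer y) -> u x = u y)
          (compat (stack p q) u).
Proof.
rewrite stack_eq_partition; apply: (iffP (compatP _ _)) => [h x y xy|h B x y].
  apply: (h [set z in setT | connect e (outer x) (outer z)]).
  - by apply/imsetP; exists x.
  - by rewrite !inE connect0.
  - by rewrite !inE.
case/imsetP => z _ ->; rewrite !inE /= => zx zy; apply: h.
by apply: connect_trans zy; rewrite connC.
Qed.

(** A compatible labeling of the stack chooses a bit for each component. A component with outer
    points takes its bit from them and a floating one is free, so the labelings correspond to the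
    sets of floating components. *)
Lemma card_middle_labels (a : 'I_l -> bool) (b : 'I_n -> bool) :
  #|[set c : {ffun 'I_m -> bool} | compat p (glue a c) && compat q (glue c b)]|
  = (2 ^ floating p q * compat (stack p q) (glue a b))%N.
Proof.
set u := glue a b; set S := [set c | _].
have labE (c : 'I_m -> bool) (w : V -> bool) :
    (forall o, w (outer o) = u o) -> (forall j, w (inl (inr j)) = c j) ->
    compat p (glue a c) && compat q (glue c b)
    = compat p (w \o low) && compat q (w \o high).
  move=> wo wj; congr (_ && _); apply: eq_compat; case=> i /=;
    rewrite ?wj //; by [rewrite (wo (inl i))|rewrite (wo (inr i))].
case: (compat_stackP u) => [cu|ncu]; last first.
  rewrite muln0; apply: fintype.eq_card0 => c; rewrite !inE; apply/negP.
  pose w (x : V) := match x with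
    | inl (inl i) => a i | inl (inr j) => c j | inr k => b k end.
  rewrite (labE c w) => [/stack_labelP hw|[]|] //.
  by apply: ncu => x y /hw; case: x; case: y.
rewrite muln1 -card_powerset.
(* For a set [X] of floating components, [W X] gives a floating component the bit of its membership
   in [X], and any other component the label of its outer points. *)
pose W (X : {set {set V}}) (x : V) :=
  ([set y in [set: V] | connect e x y] \in X)
  || [exists o, u o && connect e x (outer o)].
pose F := [set A in components p q | outer @^-1: A == set0].
pose g X := [ffun j => W X (inl (inr j))].
have W_conn X x y : connect e x y -> W X x = W X y.
  move=> xy; rewrite /W; congr (_ || _).
    suff -> : [set z in [set: V] | connect e x z] = [set z in [set: V] | connect e y z] by [].
    apply/setP => z; rewrite !inE.
    by have [] := @connect_equiv x y z _ _ _ => // _ ->.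
  by apply: eq_existsb => o; have [] := @connect_equiv x y (outer o) _ _ _ => // _ ->.
have noF x o : connect e x (outer o) -> [set y in [set: V] | connect e x y] \notin F.
  move=> xo; rewrite inE negb_and; apply/orP; right.
  by apply/set0Pn; exists o; rewrite !inE.
have W_out (X : {set {set V}}) o : X \subset F -> W X (outer o) = u o.
  move=> /fintype.subsetP XF; rewrite /W.
  rewrite (contraNF (XF _) (noF _ _ (connect0 _ (outer o)))) /=.
  apply/existsP/idP => [ [z /andP[uz /cu ->]] //|uo].
  by exists o; rewrite uo connect0.
rewrite -[RHS](card_in_imset (f := g)) => [|X Y]; last first.
  rewrite !powersetE => XF YF gXY; apply/setP => A.
  have [AF|AF] := boolP (A \in F); last first.
    by rewrite (contraNF (fintype.subsetP XF A)) ?(contraNF (fintype.subsetP YF A)).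
  move: (AF); rewrite inE => /andP[/imsetP[x _ AE] /eqP A0].
  have no_o o : connect e x (outer o) = false.
    by apply/negP => xo; have := in_set0 o; rewrite -A0 AE !inE xo.
  have W_A Z : W Z x = (A \in Z).
    by rewrite /W -AE orbC; case: existsP => // -[z]; rewrite no_o andbF.
  (* A floating component has only middle points, so its bit is a value of [g X]. *)
  case: x AE no_o W_A => [[i|j]|k] AE no_o W_A.
  - by have := no_o (inl i); rewrite connect0.
  - by move/ffunP/(_ j): gXY; rewrite !ffunE !W_A.
  - by have := no_o (inr k); rewrite connect0.
apply: fintype.eq_card => c; rewrite inE; apply/idP/imsetP => [cS|[X XF ->]]; last first.
  rewrite powersetE in XF.
  rewrite (labE _ (W X)) => [|o|j]; rewrite ?ffunE ?W_out //.
  by apply/stack_labelP => x y; apply: W_conn.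
pose w (x : V) := match x with
  | inl (inl i) => a i | inl (inr j) => c j | inr k => b k end.
have wo o : w (outer o) = u o by case: o.
move: cS; rewrite (labE c w) // => /stack_labelP hw.
(* The floating components labeled [true]. *)
exists [set A in F | [exists x in A, w x]].
  by rewrite powersetE; apply/fintype.subsetP => A; rewrite inE => /andP[].
apply/ffunP => j; rewrite ffunE.
have -> : c j = w (inl (inr j)) by [].
move: (inl (inr j)) => x; rewrite /W inE.
have [/existsP[z xz]|/existsPn no_o] := boolP [exists o, connect e x (outer o)].
  rewrite (negPf (noF _ _ xz)) /= (hw _ _ xz) wo; apply/idP/existsP => [uo|[v /andP[uv xv]]].
    by exists z; rewrite uo.
  by rewrite (cu z v) //; apply: connect_trans xv; rewrite connC.
have -> : [set y in [set: V] | connect e x y] \in F.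
  rewrite inE; apply/andP; split; first by apply/imsetP; exists x.
  by apply/eqP/setP => o; rewrite !inE; apply: negPf (no_o o).
rewrite /= [X in _ || X](_ : _ = false) ?orbF; last first.
  by apply/existsP => -[z]; rewrite (negPf (no_o z)) andbF.
apply/idP/exists_inP => [wx|[y]]; first by exists x; rewrite ?inE ?connect0.
by rewrite !inE /= => /hw ->.
Qed.
End Stack.

Lemma partition_compat_inj (T : finType) (P Q : {set {set T}}) (D : {set T}) :
  partition P D -> partition Q D ->
  (forall u : {ffun T -> bool}, compat P u = compat Q u) -> P = Q.
Proof.
move=> pP pQ PQ.
have sub P1 P2 : partition P1 D -> partition P2 D ->
    (forall u : {ffun T -> bool}, compat P1 u = compat P2 u) -> {subset P1 <= P2}.
  move=> p1 p2 E B BP.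
  have /and3P[/eqP c1 t1 n1] := p1; have /and3P[/eqP c2 t2 n2] := p2.
  have /set0Pn[x xB] : B != set0 by apply: contraNneq n1 => <-.
  have xD : x \in D by rewrite -c1; apply/bigcupP; exists B.
  suff -> : B = pblock P2 x by rewrite pblock_mem ?c2.
  rewrite -(def_pblock t1 BP xB); apply/setP => y.
  have [yD|yD] := boolP (y \in D).
    rewrite (compat_same_block p1) // (compat_same_block p2) //.
    by apply: eq_forallb => u; rewrite E.
  apply/idP/idP; apply: contraTT => _; apply/negP => yB; move/negP: yD; apply.
    by rewrite -c1; apply/bigcupP; exists (pblock P1 x); rewrite // pblock_mem ?c1.
  by rewrite -c2; apply/bigcupP; exists (pblock P2 x); rewrite // pblock_mem ?c2.
by apply/setP => B; apply/idP/idP; apply: sub.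
Qed.

Lemma compat_glue m n (P : blocks m n) (u : 'I_m + 'I_n -> bool) :
  compat P u = compat P (glue (u \o inl) (u \o inr)).
Proof. by apply: eq_compat; case. Qed.

Lemma compat_glue_const m n (P : blocks m n) c : compat P (glue (fun=> c) (fun=> c)).
Proof. by apply/compatP => B [x|x] [y|y]. Qed.

(** Stacking is a matrix product: the 0-1 matrices with entries [compat p (glue a c)] represent
    diagrams on tensor powers of a two-dimensional space, at parameter 2. *)
Lemma sum_middle_labels l m n (p : blocks l m) (q : blocks m n)
    (a : 'I_l -> bool) (b : 'I_n -> bool) :
  (\sum_(c : {ffun 'I_m -> bool}) compat p (glue a c) * compat q (glue c b)
   = 2 ^ floating p q * compat (stack p q) (glue a b))%N.
Proof.
rewrite -card_middle_labels -sum1_card [RHS]big_mkcond /=.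
by apply: eq_bigr => c _; rewrite inE; do 2!case: compat.
Qed.

(** Constant labels are compatible with every partition, so they isolate the power of 2; once it is
    cancelled, the compatible labelings determine the partition. *)
Lemma stack_unique l m n (p : blocks l m) (q : blocks m n) (d : blocks l n) N :
  partition d [set: 'I_l + 'I_n] ->
  (forall a b, \sum_(c : {ffun 'I_m -> bool})
     compat p (glue a c) * compat q (glue c b) = 2 ^ N * compat d (glue a b))%N ->
  stack p q = d /\ floating p q = N.
Proof.
move=> pd h.
have h2 a b : (2 ^ floating p q * compat (stack p q) (glue a b)
               = 2 ^ N * compat d (glue a b))%N by rewrite -sum_middle_labels h.
have E : floating p q = N.
  have := h2 (fun=> false) (fun=> false).
  rewrite !compat_glue_const !muln1.
  by move/eqP; rewrite eqn_exp2l // => /eqP.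
split=> //; apply: (partition_compat_inj (partition_stack p q) pd) => u.
have := h2 (u \o inl) (u \o inr); rewrite -!compat_glue E => /eqP.
by rewrite eqn_pmul2l ?expn_gt0 //; do 2!case: compat.
Qed.

(** Associativity of the matrix product of compatibility matrices. Constant labels again separate
    the exponents from the partitions. *)
Lemma stackA k l m n (p : blocks k l) (q : blocks l m) (r : blocks m n) :
  stack (stack p q) r = stack p (stack q r) /\
  (floating p q + floating (stack p q) r
   = floating q r + floating p (stack q r))%N.
Proof.
have h a b : (2 ^ (floating p q + floating (stack p q) r)
                * compat (stack (stack p q) r) (glue a b)
              = 2 ^ (floating q r + floating p (stack q r))
                * compat (stack p (stack q r)) (glue a b))%N.
  rewrite !expnD -!mulnA -!sum_middle_labels !big_distrr /=.
  under eq_bigr do rewrite mulnA -sum_middle_labels big_distrl /=.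
  rewrite exchange_big /=; apply: eq_bigr => c _.
  rewrite mulnCA -sum_middle_labels big_distrr /=.
  by apply: eq_bigr => d _; rewrite mulnA.
have E : (floating p q + floating (stack p q) r
   = floating q r + floating p (stack q r))%N.
  have := h (fun=> false) (fun=> false).
  rewrite !compat_glue_const !muln1.
  by move/eqP; rewrite eqn_exp2l // => /eqP.
split=> //; apply: (partition_compat_inj (partition_stack _ _) (partition_stack _ _)) => u.
have := h (u \o inl) (u \o inr); rewrite -!compat_glue E => /eqP.
by rewrite eqn_pmul2l ?expn_gt0 //; do 2!case: compat.
Qed.

(** * Permutation diagrams *)

Definition perm_blocks n (s : {perm 'I_n}) : blocks n n :=
  [set [set inl i; inr (s i)] | i : 'I_n].

Lemma id_blocksE n : id_blocks n = perm_blocks (1 : {perm 'I_n}).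
Proof. by apply: eq_imset => i; rewrite perm1. Qed.

Lemma compat_perm_blocks n (s : {perm 'I_n}) a b :
  compat (perm_blocks s) (glue a b) = [forall i, a i == b (s i)].
Proof.
apply/compatP/forallP => [h i|h B x y /imsetP[i _ ->]].
  apply/eqP; apply: (h [set inl i; inr (s i)] (inl i) (inr (s i))).
  - by apply/imsetP; exists i.
  - by rewrite !inE eqxx.
  - by rewrite !inE eqxx orbT.
by rewrite !inE => /orP[]/eqP-> /orP[]/eqP-> //=; rewrite (eqP (h i)).
Qed.

Lemma partition_perm_blocks n (s : {perm 'I_n}) :
  partition (perm_blocks s) [set: 'I_n + 'I_n].
Proof.
apply/and3P; split.
- apply/eqP/setP => x; rewrite inE; apply/bigcupP; case: x => i.
    by exists [set inl i; inr (s i)]; [apply/imsetP; exists i | rewrite !inE eqxx].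
  exists [set inl (s^-1%g i); inr (s (s^-1%g i))].
    by apply/imsetP; exists (s^-1%g i).
  by rewrite permKV !inE eqxx orbT.
- apply/trivIsetP => _ _ /imsetP[i _ ->] /imsetP[j _ ->] ne.
  have {}ne : i != j by apply: contraNneq ne => ->.
  apply/pred0P => x /=; rewrite !inE; case: x => k /=.
    by rewrite ?orbF; apply/negP => /andP[/eqP[->] /eqP[ij]]; rewrite ij eqxx in ne.
  by apply/negP => /andP[/eqP[->] /eqP[/perm_inj ij]]; rewrite ij eqxx in ne.
- apply/imsetP => -[i _ /setP/(_ (inl i))]; by rewrite !inE eqxx.
Qed.

(** The compatibility matrix of [perm_blocks s] is a permutation matrix: only the middle labeling
    [a \o s^-1] contributes to the sum. *)
Lemma stack_perml m n (s : {perm 'I_m}) (p : blocks m n) (d : blocks m n) :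
  partition d [set: 'I_m + 'I_n] ->
  (forall (a : {ffun 'I_m -> bool}) b, compat d (glue a b) = compat p (glue (a \o s^-1%g) b)) ->
  stack (perm_blocks s) p = d /\ floating (perm_blocks s) p = 0%N.
Proof.
move=> pd h; apply: stack_unique => // a b; rewrite mul1n.
rewrite (bigD1 [ffun i => a (s^-1%g i)]) //= big1 => [|c nc].
  rewrite compat_perm_blocks addn0 (introT forallP) ?mul1n => [|i]; last first.
    by rewrite ffunE permK.
  congr nat_of_bool; have -> : compat d (glue a b) = compat d (glue [ffun i => a i] b).
    by apply: eq_compat; case=> i //=; rewrite ffunE.
  by rewrite h; apply: eq_compat; case=> i //=; rewrite ?ffunE /= ?ffunE.
rewrite compat_perm_blocks; case: forallP => // ac; case/eqP: nc; apply/ffunP => i.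
by rewrite ffunE (eqP (ac (s^-1%g i))) permKV.
Qed.

Lemma stack_idl m n (p : blocks m n) : partition p [set: 'I_m + 'I_n] ->
  stack (id_blocks m) p = p /\ floating (id_blocks m) p = 0%N.
Proof.
move=> pp; rewrite id_blocksE; apply: stack_perml => // a b.
by apply: eq_compat; case=> i //=; rewrite invg1 perm1.
Qed.

Lemma stack_idr m n (p : blocks m n) : partition p [set: 'I_m + 'I_n] ->
  stack p (id_blocks n) = p /\ floating p (id_blocks n) = 0%N.
Proof.
move=> pp; apply: stack_unique => // a b; rewrite mul1n.
rewrite (bigD1 [ffun i => b i]) //= big1 => [|c nc].
  rewrite id_blocksE compat_perm_blocks addn0 [in X in (_ * X)%N](introT forallP); last first.
    by move=> i; rewrite perm1 ffunE.
  rewrite muln1; congr nat_of_bool; apply: eq_compat; case=> i //=; by rewrite ffunE.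
rewrite id_blocksE compat_perm_blocks; case: forallP => [ac|]; last by rewrite muln0.
by case/eqP: nc; apply/ffunP => i; rewrite ffunE (eqP (ac i)) perm1.
Qed.

Lemma stack_perm n (s u : {perm 'I_n}) :
  stack (perm_blocks s) (perm_blocks u) = perm_blocks (s * u)%g /\
  floating (perm_blocks s) (perm_blocks u) = 0%N.
Proof.
apply: stack_perml => [|a b]; first exact: partition_perm_blocks.
rewrite !compat_perm_blocks; apply/forallP/forallP => h i.
  by have := h (s^-1%g i); rewrite permM permKV.
by have := h (s i); rewrite /= permK permM.
Qed.

(** * Cutting a diagram at its through blocks *)

Section Factorization.
Variables (m n : nat) (d : blocks m n).
Hypothesis pd : partition d [set: 'I_m + 'I_n].

Definition through : {set {set 'I_m + 'I_n}} :=
  [set B in d | (bottoms B != set0) && (tops B != set0)].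

(** The middle points number the through blocks, so [B] receives a middle point, that of its own
    number, exactly when it is a through block. *)
Definition lower_block (B : {set 'I_m + 'I_n}) : {set 'I_m + 'I_#|through|} :=
  [set x | match x with inl i => inl i \in B | inr r => enum_val r == B end].
Definition upper_block (B : {set 'I_m + 'I_n}) : {set 'I_#|through| + 'I_n} :=
  [set x | match x with inl r => enum_val r == B | inr k => inr k \in B end].

Definition lower_half : blocks m #|through| :=
  [set lower_block B | B in [set B in d | bottoms B != set0]].
Definition upper_half : blocks #|through| n :=
  [set upper_block B | B in [set B in d | tops B != set0]].

Let cd : cover d = [set: _]. Proof. by case/and3P: pd => /eqP. Qed.
Let td : trivIset d. Proof. by case/and3P: pd. Qed.
Let pbE B x : B \in d -> x \in B -> pblock d x = B. Proof. exact: def_pblock. Qed.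
Let pbd x : pblock d x \in d. Proof. by rewrite pblock_mem // cd. Qed.
Let mempb x : x \in pblock d x. Proof. by rewrite mem_pblock cd. Qed.

Lemma through_sub (r : 'I_#|through|) : enum_val r \in d.
Proof. by have := enum_valP r; rewrite inE => /andP[]. Qed.

Lemma through_bottom (r : 'I_#|through|) : exists i, inl i \in enum_val r.
Proof.
by have := enum_valP r; rewrite inE => /andP[_ /andP[/set0Pn[i ir] _]];
  exists i; rewrite inE in ir.
Qed.

Lemma through_top (r : 'I_#|through|) : exists i, inr i \in enum_val r.
Proof.
by have := enum_valP r; rewrite inE => /andP[_ /andP[_ /set0Pn[i ir]]];
  exists i; rewrite inE in ir.
Qed.

Lemma partition_lower_half : partition lower_half [set: 'I_m + 'I_#|through|].
Proof.
apply/and3P; split.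
- apply/eqP/setP => x; rewrite inE; apply/bigcupP; case: x => [i|r].
    exists (lower_block (pblock d (inl i))); last by rewrite inE.
    apply: imset_f; rewrite inE pbd /=; apply/set0Pn; exists i; by rewrite inE.
  have [i ir] := through_bottom r; exists (lower_block (enum_val r)); last by rewrite inE.
  by apply: imset_f; rewrite inE through_sub; apply/set0Pn; exists i; rewrite inE.
- apply/trivIsetP => _ _ /imsetP[B /[!inE] /andP[Bd _] ->] /imsetP[C /[!inE] /andP[Cd _] ->] ne.
  have {}ne : B != C by apply: contraNneq ne => ->.
  apply/pred0P => x /=; apply/negP; rewrite !inE => /andP[]; case: x => [i|r].
    by move=> iB iC; rewrite -(pbE Bd iB) (pbE Cd iC) eqxx in ne.
  by move=> /eqP rB /eqP rC; rewrite -rB -rC eqxx in ne.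
- apply/imsetP => -[B /[!inE] /andP[_ /set0Pn[i iB]]] /setP/(_ (inl i)).
  by move: iB; rewrite !inE => ->.
Qed.

Lemma partition_upper_half : partition upper_half [set: 'I_#|through| + 'I_n].
Proof.
apply/and3P; split.
- apply/eqP/setP => x; rewrite inE; apply/bigcupP; case: x => [r|i]; last first.
    exists (upper_block (pblock d (inr i))); last by rewrite inE.
    apply: imset_f; rewrite inE pbd /=; apply/set0Pn; exists i; by rewrite inE.
  have [i ir] := through_top r; exists (upper_block (enum_val r)); last by rewrite inE.
  by apply: imset_f; rewrite inE through_sub; apply/set0Pn; exists i; rewrite inE.
- apply/trivIsetP => _ _ /imsetP[B /[!inE] /andP[Bd _] ->] /imsetP[C /[!inE] /andP[Cd _] ->] ne.
  have {}ne : B != C by apply: contraNneq ne => ->.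
  apply/pred0P => x /=; apply/negP; rewrite !inE => /andP[]; case: x => [r|i].
    by move=> /eqP rB /eqP rC; rewrite -rB -rC eqxx in ne.
  by move=> iB iC; rewrite -(pbE Bd iB) (pbE Cd iC) eqxx in ne.
- apply/imsetP => -[B /[!inE] /andP[_ /set0Pn[i iB]]] /setP/(_ (inr i)).
  by move: iB; rewrite !inE => ->.
Qed.

(** The label of a middle point is forced to be the common label of its through block. Such a middle
    labeling exists, and is then unique, precisely when the outer labels are constant on the blocks
    of [d]. *)
Lemma stack_halves : stack lower_half upper_half = d /\ floating lower_half upper_half = 0%N.
Proof.
apply: stack_unique => // a b; rewrite mul1n.
set u := glue a b.
have low_mem B : B \in d -> (exists i, inl i \in B) -> lower_block B \in lower_half.
  move=> Bd [i iB]; apply: imset_f; rewrite inE Bd.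
  by apply/set0Pn; exists i; rewrite inE.
have up_mem B : B \in d -> (exists i, inr i \in B) -> upper_block B \in upper_half.
  move=> Bd [i iB]; apply: imset_f; rewrite inE Bd.
  by apply/set0Pn; exists i; rewrite inE.
have [/compatP cu|ncu] := boolP (compat d u); last first.
  apply: big1 => c _; apply/eqP; rewrite muln_eq0 !eqb0 -negb_and.
  apply: contra ncu => /andP[/compatP cl /compatP cr].
  have mid B i k : B \in d -> inl i \in B -> inr k \in B -> a i = b k.
    move=> Bd iB kB.
    have Bt : B \in through.
      rewrite inE Bd /=; apply/andP; split; apply/set0Pn.
        by exists i; rewrite inE.
      by exists k; rewrite inE.
    pose r := enum_rank_in Bt B; have rB : enum_val r = B by exact: enum_rankK_in.
    transitivity (c r).
      apply: (cl (lower_block B) (inl i) (inr r)); rewrite ?inE ?rB //.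
      by apply: low_mem => //; exists i.
    apply: (cr (upper_block B) (inl r) (inr k)); rewrite ?inE ?rB //.
    by apply: up_mem => //; exists k.
  apply/compatP => B [x|x] [y|y] Bd xB yB.
  - apply: (cl (lower_block B) (inl x) (inl y)); rewrite ?inE //.
    by apply: low_mem => //; exists x.
  - exact: mid xB yB.
  - by symmetry; exact: mid yB xB.
  - apply: (cr (upper_block B) (inr x) (inr y)); rewrite ?inE //.
    by apply: up_mem => //; exists x.
(* The common label of the points of [B]; the value [false] concerns only an empty [B]. *)
pose v (B : {set 'I_m + 'I_n}) := if [pick x in B] is Some x then u x else false.
have vE B x : B \in d -> x \in B -> u x = v B.
  rewrite /v => Bd xB; case: pickP => [y yB|/(_ x)]; last by rewrite xB.
  exact: cu xB yB.
rewrite (bigD1 [ffun r => v (enum_val r)]) //= big1 => [|c nc].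
  rewrite addn0 !(introT (compatP _ _)) //.
    have h B x : B \in d -> x \in upper_block B ->
        glue [ffun r => v (enum_val r)] b x = v B.
      move=> Bd; rewrite inE; case: x => [r /eqP<-|k kB] /=; first by rewrite ffunE.
      by rewrite -(vE _ _ Bd kB).
    by move=> _ x y /imsetP[B /[!inE] /andP[Bd _] ->] xB yB; rewrite !(h B).
  have h B x : B \in d -> x \in lower_block B ->
      glue a [ffun r => v (enum_val r)] x = v B.
    move=> Bd; rewrite inE; case: x => [k kB|r /eqP<-] /=; last by rewrite ffunE.
    by rewrite -(vE _ _ Bd kB).
  by move=> _ x y /imsetP[B /[!inE] /andP[Bd _] ->] xB yB; rewrite !(h B).
apply/eqP; rewrite muln_eq0 !eqb0; apply/orP; left; apply: contra nc => /compatP cl.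
apply/eqP/ffunP => r; rewrite ffunE; have [i ir] := through_bottom r.
rewrite -(vE _ _ (through_sub r) ir).
symmetry; apply: (cl (lower_block (enum_val r)) (inl i) (inr r)); rewrite ?inE //.
by apply: low_mem; [exact: through_sub | exists i].
Qed.

Lemma bottoms_lower B : bottoms (lower_block B) = bottoms B.
Proof. by apply/setP => i; rewrite !inE. Qed.

Lemma tops_lower B : #|tops (lower_block B)| = (B \in through).
Proof.
have [Bt|Bt] := boolP (B \in through); last first.
  apply: fintype.eq_card0 => r; rewrite !inE; apply: contraNF Bt => /eqP<-.
  exact: enum_valP.
transitivity #|[set enum_rank_in Bt B]|; last by rewrite cards1.
apply: fintype.eq_card => r; rewrite !inE.
apply/eqP/eqP => [rB|->]; last by rewrite enum_rankK_in.
by apply: enum_val_inj; rewrite enum_rankK_in.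
Qed.

Lemma tops_upper B : tops (upper_block B) = tops B.
Proof. by apply/setP => i; rewrite !inE. Qed.

Lemma bottoms_upper B : #|bottoms (upper_block B)| = (B \in through).
Proof. by rewrite -tops_lower; apply: fintype.eq_card => r; rewrite !inE. Qed.
End Factorization.

Lemma card_bottoms_tops m n (B : {set 'I_m + 'I_n}) : #|B| = (#|bottoms B| + #|tops B|)%N.
Proof.
rewrite -!sum1_card big_mkcond big_sumType /= -!big_mkcond /=.
by congr (_ + _)%N; apply: eq_bigl => i; rewrite inE.
Qed.

(** Each through block takes at least two of the [n + n] points. Equality forces every block to
    consist of one bottom and one top point. *)
Lemma through_leq n (d : blocks n n) : partition d [set: 'I_n + 'I_n] ->
  (#|through d| <= n)%N /\
  (#|through d| = n -> exists s : {perm 'I_n}, d = perm_blocks s).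
Proof.
move=> pd; have /and3P[/eqP cd td n0] := pd.
have size2 : (\sum_(B in d) #|B| = n + n)%N.
  by rewrite -(card_partition pd) cardsT card_sum !card_ord.
have bt B : B \in through d -> (0 < #|bottoms B|)%N && (0 < #|tops B|)%N.
  by rewrite inE => /andP[_]; rewrite -!card_gt0.
have leB B : B \in d -> ((B \in through d).*2 <= #|B| ?= iff (B \in through d) && (#|B| == 2%N))%N.
  move=> Bd; have [/bt/andP[b1 b2]|_] := boolP (B \in through d).
    split; last by rewrite eq_sym.
    by rewrite card_bottoms_tops (leq_add b1 b2).
  by split; rewrite //= eq_sym cards_eq0; apply/negbTE; apply: contraNneq n0 => <-.
have [] := leqif_sum leB; rewrite size2.
have -> : (\sum_(B in d) (B \in through d).*2 = #|through d|.*2)%N.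
  rewrite -sum1_card -[RHS]mul2n big_distrr /= [RHS]big_mkcond [LHS]big_mkcond /=.
  apply: eq_bigr => B _; rewrite inE.
  by case: (B \in d) => //=; case: (_ && _).
rewrite addnn leq_double => le_n eq_n; split=> // th_n.
move: eq_n; rewrite th_n eqxx => /esym/forall_inP allB.
have block1 B : B \in d -> #|bottoms B| = 1%N /\ #|tops B| = 1%N.
  move=> /allB/andP[/bt]; rewrite card_bottoms_tops.
  by move: #|_| #|_| => [|[|x]] [|[|y]]; rewrite ?addnS.
pose top (i : 'I_n) := odflt i [pick k | inr k \in pblock d (inl i)].
have pbd x : pblock d x \in d by rewrite pblock_mem // cd.
have topP i : inr (top i) \in pblock d (inl i).
  rewrite /top; case: pickP => //= none.
  have [_] := block1 _ (pbd (inl i)); rewrite (fintype.eq_card0 (A := tops _)) //.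
  by move=> k; rewrite inE none.
have one_bottom B i k : B \in d -> inl i \in B -> inl k \in B -> i = k.
  move=> /block1[/eqP/cards1P[z zE] _] iB kB.
  have : i \in bottoms B by rewrite inE.
  have : k \in bottoms B by rewrite inE.
  by rewrite !zE !inE => /eqP-> /eqP->.
have one_top B i k : B \in d -> inr i \in B -> inr k \in B -> i = k.
  move=> /block1[_ /eqP/cards1P[z zE]] iB kB.
  have : i \in tops B by rewrite inE.
  have : k \in tops B by rewrite inE.
  by rewrite !zE !inE => /eqP-> /eqP->.
have mempb x : x \in pblock d x by rewrite mem_pblock cd.
have top_inj : injective top.
  move=> i k ik; have := topP k; rewrite -ik => h.
  have := def_pblock td (pbd _) h; rewrite (def_pblock td (pbd _) (topP i)) => E.
  by apply: (one_bottom (pblock d (inl i))); rewrite ?mempb // E mempb.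
exists (perm top_inj).
have pbE i : pblock d (inl i) = [set inl i; inr (perm top_inj i)].
  apply/setP => -[k|k]; rewrite !inE permE.
    rewrite orbF; apply/idP/eqP => [ki|[->] //].
    by congr inl; apply: (one_bottom _ _ _ (pbd _) ki).
  by apply/idP/eqP => [ki|[->] //]; congr inr; apply: (one_top _ _ _ (pbd _) ki).
apply/setP => B; apply/idP/imsetP => [Bd|[i _ ->]]; last by rewrite -pbE.
have [/eqP/cards1P[i iE] _] := block1 _ Bd.
have iB : inl i \in B by have := set11 i; rewrite -iE inE.
by exists i; rewrite // -pbE (def_pblock td Bd iB).
Qed.

(** * Closure of the diagram classes under stacking *)

Section Dihedral.
Variables (T : finType) (f g : T -> T) (x0 : T).
Hypotheses (fK : involutive f) (gK : involutive g) (gx0 : g x0 = x0).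
Local Notation h := (g \o f).
Local Notation L := (order h x0).

Let h_inj : injective h.
Proof. by apply: inj_comp; apply: inv_inj. Qed.

(** Conjugation by [f] or [g] inverts [h], and [g] fixes [x0]. On exponents modulo [L], [g] is
    therefore the reflection k -> -k and [f] the reflection k -> -k - 1. *)
Lemma dihedral_reflect k : (k <= L)%N ->
  g (iter k h x0) = iter (L - k) h x0 /\
  ((k < L)%N -> f (iter k h x0) = iter (L - k.+1) h x0).
Proof.
have step i : (i < L)%N -> g (iter i h x0) = iter (L - i) h x0 ->
    f (iter i h x0) = iter (L - i.+1) h x0.
  by move=> iL gi; apply: h_inj; rewrite /= fK gi -(subnSK iL).
elim: k => [|k IH] kL.
  rewrite subn0 gx0 (iter_order h_inj); split=> // L0.
  by apply: step => //; rewrite subn0 gx0 (iter_order h_inj).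
have [gk /(_ kL) fk] := IH (ltnW kL).
have gS : g (iter k.+1 h x0) = iter (L - k.+1) h x0 by rewrite /= gK.
by split=> // kL'; apply: step.
Qed.

Lemma dihedral_closed y : fconnect h x0 y -> fconnect h x0 (f y) /\ fconnect h x0 (g y).
Proof.
move=> xy; have kL := findex_max xy; rewrite -(iter_findex xy).
have [-> /(_ kL) ->] := dihedral_reflect (ltnW kL).
by split; apply: fconnect_iter.
Qed.

(** Besides 0, the reflection k -> -k fixes L/2 for even [L], and k -> -k - 1 fixes (L - 1)/2 for
    odd [L]; both are [L./2]. *)
Definition antipode := iter L./2 h x0.

Lemma fixed_or_antipode y : fconnect h x0 y -> f y = y \/ g y = y ->
  y = x0 \/ y = antipode.
Proof.
move=> xy; have [k kL ->] : exists2 k, (k < L)%N & y = iter k h x0.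
  by exists (findex h x0 y); rewrite ?findex_max ?iter_findex.
have [gk /(_ kL) fk] := dihedral_reflect (ltnW kL).
have inj i j : (i < L)%N -> (j < L)%N -> iter i h x0 = iter j h x0 -> i = j.
  by move=> iL jL E; rewrite -(findex_iter iL) -(findex_iter jL) E.
rewrite fk gk /antipode; case: (posnP k) => [->|k0]; first by left.
case=> /inj => [|] E; right; congr iter.
  have {}E := E ltac:(lia) kL; lia.
have {}E := E ltac:(lia) kL; lia.
Qed.

Lemma antipode_fixed : f antipode = antipode \/ g antipode = antipode.
Proof.
have L0 : (0 < L)%N := order_gt0 h x0.
have kL : (L./2 < L)%N by lia.
have [gk /(_ kL) fk] := dihedral_reflect (ltnW kL).
rewrite /antipode; have [odL|evL] := boolP (odd L).
  by left; rewrite fk; congr iter; lia.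
by right; rewrite gk; congr iter; lia.
Qed.

(** The exponent [L./2] is nonzero unless the orbit is a single point, which [f] would then fix. *)
Lemma antipode_neq : f x0 <> x0 -> antipode <> x0.
Proof.
move=> nf; have L0 : (0 < L)%N := order_gt0 h x0.
have [L1|L1] := leqP L 1.
  have [_ /(_ L0)] := dihedral_reflect (leq0n L).
  by rewrite /= (_ : L - 1 = 0)%N //; lia.
move=> E; have : findex h x0 (iter L./2 h x0) = L./2 by apply: findex_iter; lia.
have := findex_iter L0; rewrite -/antipode E /= => ->; lia.
Qed.

End Dihedral.

Section StackBlocks.
Variables (l m n : nat) (p : blocks l m) (q : blocks m n).
Hypotheses (pp : partition p [set: 'I_l + 'I_m]) (pq : partition q [set: 'I_m + 'I_n]).
Local Notation e := (stack_adj p q).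
Local Notation V := (stack_pts l m n).

Lemma mem_stack_block B x y : B \in stack p q -> x \in B ->
  (y \in B) = connect e (outer x) (outer y).
Proof.
rewrite stack_eq_partition => /imsetP[z _ ->]; rewrite !inE /= => zx.
by have [] := @connect_equiv _ _ _ p q (outer z) (outer x) (outer y) _ _ _ => // _ ->.
Qed.

Let cp : cover p = [set: _]. Proof. by case/and3P: pp => /eqP. Qed.
Let cq : cover q = [set: _]. Proof. by case/and3P: pq => /eqP. Qed.
Let tp : trivIset p. Proof. by case/and3P: pp. Qed.
Let tq : trivIset q. Proof. by case/and3P: pq. Qed.
Let pbp x : pblock p x \in p. Proof. by rewrite pblock_mem // cp. Qed.
Let pbq x : pblock q x \in q. Proof. by rewrite pblock_mem // cq. Qed.
Let memp x : x \in pblock p x. Proof. by rewrite mem_pblock cp. Qed.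
Let memq x : x \in pblock q x. Proof. by rewrite mem_pblock cq. Qed.

Lemma connect_low x y : y \in pblock p x -> connect e (low x) (low y).
Proof.
move=> yx; apply/connect1/orP; left; apply/exists_inP; exists (pblock p x) => //.
by rewrite !imset_f.
Qed.

Lemma connect_high x y : y \in pblock q x -> connect e (high x) (high y).
Proof.
move=> yx; apply/connect1/orP; right; apply/exists_inP; exists (pblock q x) => //.
by rewrite !imset_f.
Qed.

Lemma rook_stack_bottoms :
  (forall B, B \in p -> (#|bottoms B| <= 1)%N) ->
  (forall B, B \in q -> (#|bottoms B| <= 1)%N) ->
  forall B, B \in stack p q -> (#|bottoms B| <= 1)%N.
Proof.
move=> bp bq B BS; apply/card_le1_eqP => i i'; rewrite !inE => iB i'B.
have := i'B; rewrite (mem_stack_block _ BS iB) => con.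
(* [w] marks the block of [i] in [p] and the blocks of [q] above it. It is constant on blocks
   because a block of [q] has at most one middle point, so it separates [i] from all bottom points
   outside its own block. *)
pose w (x : V) := match x with
  | inl z => z \in pblock p (inl i)
  | inr k => [exists j, (inr j \in pblock p (inl i)) && (inr k \in pblock q (inl j))] end.
suff /stack_labelP/(_ _ _ con) : compat p (w \o low) && compat q (w \o high).
  rewrite /= memp => /esym wi; move/card_le1_eqP: (bp _ (pbp (inl i))).
  by move=> /(_ i i'); apply; rewrite inE // memp.
apply/andP; split; apply/compatP => C x y CP xC yC /=.
  have E z : z \in C -> (z \in pblock p (inl i)) = (C == pblock p (inl i)).
    move=> zC; apply/idP/eqP => [|<- //] h.
    by rewrite -(def_pblock tp CP zC); exact: def_pblock.
  by rewrite !E.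
have E z : z \in C ->
    w (high z) = [exists j, (inr j \in pblock p (inl i)) && (inl j \in C)].
  move=> zC; case: z zC => [j|k] zC /=.
    apply/idP/existsP => [ij|[j' /andP[ij' j'C]]]; first by exists j; rewrite ij.
    by have /card_le1_eqP/(_ j' j) -> := bq _ CP; rewrite ?inE.
  apply: eq_existsb => j; congr (_ && _); apply/idP/idP => [h|h].
    by rewrite -(def_pblock tq CP zC) (def_pblock tq (pbq _) h) memq.
  by rewrite (def_pblock tq CP h).
by rewrite !E.
Qed.

Lemma rook_stack_tops :
  (forall B, B \in p -> (#|tops B| <= 1)%N) ->
  (forall B, B \in q -> (#|tops B| <= 1)%N) ->
  forall B, B \in stack p q -> (#|tops B| <= 1)%N.
Proof.
move=> tp1 tq1 B BS; apply/card_le1_eqP => i i'; rewrite !inE => iB i'B.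
have := i'B; rewrite (mem_stack_block _ BS iB) => con.
(* The mirror image: the block of [i] in [q] and the blocks of [p] below it. *)
pose w (x : V) := match x with
  | inl (inl k) => [exists j, (inl j \in pblock q (inr i)) && (inl k \in pblock p (inr j))]
  | inl (inr j) => inl j \in pblock q (inr i)
  | inr k => inr k \in pblock q (inr i) end.
suff /stack_labelP/(_ _ _ con) : compat p (w \o low) && compat q (w \o high).
  rewrite /= memq => /esym wi; move/card_le1_eqP: (tq1 _ (pbq (inr i))).
  by move=> /(_ i i'); apply; rewrite inE // memq.
apply/andP; split; apply/compatP => C x y CP xC yC /=.
  have E z : z \in C ->
      w (low z) = [exists j, (inl j \in pblock q (inr i)) && (inr j \in C)].
    move=> zC; case: z zC => [k|j] zC /=; last first.
      apply/idP/existsP => [ij|[j' /andP[ij' j'C]]]; first by exists j; rewrite ij.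
      by have /card_le1_eqP/(_ j' j) -> := tp1 _ CP; rewrite ?inE.
    apply: eq_existsb => j; congr (_ && _); apply/idP/idP => [h|h].
      by rewrite -(def_pblock tp CP zC) (def_pblock tp (pbp _) h) memp.
    by rewrite (def_pblock tp CP h).
  by have := E x xC; rewrite -(E y yC).
have E z : z \in C -> w (high z) = (C == pblock q (inr i)).
  move=> zC; have -> : w (high z) = (z \in pblock q (inr i)) by case: z zC.
  apply/idP/eqP => [|<- //] h.
  by rewrite -(def_pblock tq CP zC); exact: def_pblock.
by rewrite !E.
Qed.

Lemma permutation_stack :
  (forall B, B \in p -> permutation_block B) ->
  (forall B, B \in q -> permutation_block B) ->
  forall B, B \in stack p q -> permutation_block B.
Proof.
move=> hp hq B BS.
have /and3P[_ _ n0] := partition_stack p q.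
have b1 : (#|bottoms B| <= 1)%N.
  by apply: rook_stack_bottoms BS => C; [move=> /hp|move=> /hq] => /andP[/eqP->].
have t1 : (#|tops B| <= 1)%N.
  by apply: rook_stack_tops BS => C; [move=> /hp|move=> /hq] => /andP[_ /eqP->].
have top_of (r s : nat) (P : blocks r s) i : (forall C, C \in P -> permutation_block C) ->
    pblock P (inl i) \in P -> exists j, inr j \in pblock P (inl i).
  move=> hP /hP/andP[_ /eqP t]; have /card_gt0P[j] : (0 < #|tops (pblock P (inl i))|)%N by rewrite t.
  by rewrite inE; exists j.
have bot_of (r s : nat) (P : blocks r s) i : (forall C, C \in P -> permutation_block C) ->
    pblock P (inr i) \in P -> exists j, inl j \in pblock P (inr i).
  move=> hP /hP/andP[/eqP t _]; have /card_gt0P[j] : (0 < #|bottoms (pblock P (inr i))|)%N by rewrite t.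
  by rewrite inE; exists j.
have /set0Pn[x xB] : B != set0 by apply: contraNneq n0 => <-.
rewrite /permutation_block !eqn_leq b1 t1 /= !card_gt0; apply/andP; split; apply/set0Pn.
  case: x xB => i iB; first by exists i; rewrite inE.
  have [j ij] := bot_of _ _ _ i hq (pbq _); have [k jk] := bot_of _ _ _ j hp (pbp _).
  exists k; rewrite inE (mem_stack_block _ BS iB).
  exact: connect_trans (connect_high ij) (connect_low jk).
case: x xB => i iB; last by exists i; rewrite inE.
have [j ij] := top_of _ _ _ i hp (pbp _); have [k jk] := top_of _ _ _ j hq (pbq _).
exists k; rewrite inE (mem_stack_block _ BS iB).
exact: connect_trans (connect_low ij) (connect_high jk).
Qed.
End StackBlocks.

Section Partner.
Variables (T : finType) (P : {set {set T}}).
Hypotheses (pP : partition P [set: T]) (P2 : forall B, B \in P -> (#|B| <= 2)%N).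

(** A partition into blocks of size at most 2 as an involution; the default value makes the
    singletons its fixed points. *)
Definition partner x := odflt x [pick y in pblock P x | y != x].

Let cP : cover P = [set: T]. Proof. by case/and3P: pP => /eqP. Qed.
Let tP : trivIset P. Proof. by case/and3P: pP. Qed.
Let pbP x : pblock P x \in P. Proof. by rewrite pblock_mem // cP. Qed.
Let memP x : x \in pblock P x. Proof. by rewrite mem_pblock cP. Qed.

Lemma partner_mem x : partner x \in pblock P x.
Proof. by rewrite /partner; case: pickP => [y /andP[]|]. Qed.

Lemma partner_cases x y : y \in pblock P x -> y = x \/ y = partner x.
Proof.
move=> yx; have [->|nyx] := eqVneq y x; [by left|right].
rewrite /partner; case: pickP => [z /andP[zx nzx] /=|/(_ y)]; last by rewrite yx nyx.
apply/eqP/idPn => nyz; have := P2 (pbP x); rewrite leqNgt => /negP[].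
have yD : y \in pblock P x :\ x by rewrite !inE nyx.
have zD : z \in pblock P x :\ x :\ y by rewrite !inE eq_sym nyz nzx.
by rewrite (cardsD1 x) memP (cardsD1 y (pblock P x :\ x)) yD (cardsD1 z (pblock P x :\ x :\ y)) zD.
Qed.

Lemma partnerK : involutive partner.
Proof.
move=> x; have px := partner_mem x.
have := memP x; rewrite -(def_pblock tP (pbP x) px) => /partner_cases[] E //.
have := partner_mem (partner x); rewrite (def_pblock tP (pbP x) px) => /partner_cases[] //.
by rewrite -E.
Qed.

Lemma partner_neq x : #|pblock P x| = 2%N -> partner x != x.
Proof.
rewrite /partner; case: pickP => [y /andP[]//|none].
by rewrite (cardsD1 x) memP (fintype.eq_card0 (A := _ :\ x)) // => y; rewrite !inE andbC none.
Qed.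
End Partner.

Section StackMatching.
Variables (l m n : nat) (p : blocks l m) (q : blocks m n).
Hypotheses (pp : partition p [set: 'I_l + 'I_m]) (pq : partition q [set: 'I_m + 'I_n]).
Hypotheses (p2 : forall B, B \in p -> (#|B| <= 2)%N) (q2 : forall B, B \in q -> (#|B| <= 2)%N).
Local Notation e := (stack_adj p q).
Local Notation V := (stack_pts l m n).

(** Each layer acts on all points of the stack by an involution that fixes the points outside the
    layer. In particular an outer point is fixed by one of the two moves. *)
Definition low_move (x : V) : V :=
  match x with inl z => low (partner p z) | inr k => x end.
Definition high_move (x : V) : V :=
  match x with
  | inl (inl i) => x
  | inl (inr j) => high (partner q (inl j))
  | inr k => high (partner q (inr k)) end.

Let high_moveE z : high_move (high z) = high (partner q z). Proof. by case: z. Qed.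
Lemma low_moveK : involutive low_move.
Proof. by case=> [z|k] //=; rewrite /low (partnerK pp p2). Qed.

Lemma high_moveK : involutive high_move.
Proof. by case=> [[i|j]|k] //=; rewrite high_moveE (partnerK pq q2). Qed.

Let cp x : pblock p x \in p.
Proof. by rewrite pblock_mem //; case/and3P: pp => /eqP->. Qed.
Let cq x : pblock q x \in q.
Proof. by rewrite pblock_mem //; case/and3P: pq => /eqP->. Qed.

Lemma adj_moves x y : e x y -> [\/ y = x, y = low_move x | y = high_move x].
Proof.
case/orP => /exists_inP[B BP /andP[/imsetP[a aB ->] /imsetP[b bB ->]]].
  have bp : b \in pblock p a by rewrite (def_pblock _ BP aB) //; case/and3P: pp.
  by case: (partner_cases pp p2 bp) => ->; [apply: Or31 | apply: Or32].
have bq : b \in pblock q a by rewrite (def_pblock _ BP aB) //; case/and3P: pq.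
by case: (partner_cases pq q2 bq) => ->; [apply: Or31 | apply: Or33; rewrite high_moveE].
Qed.

Lemma connect_low_move x : connect e x (low_move x).
Proof.
case: x => [z|k]; last exact: connect0.
by apply: connect_low => //; apply: partner_mem.
Qed.

Lemma connect_high_move x : connect e x (high_move x).
Proof.
case: x => [[i|j]|k]; first exact: connect0.
  exact: (@connect_high _ _ _ p _ pq (inl j) _ (partner_mem pq _)).
exact: (@connect_high _ _ _ p _ pq (inr k) _ (partner_mem pq _)).
Qed.

(* The two moves generate a dihedral group, and the component of an outer point
   [x] is its orbit; [x] and the opposite point of the orbit are the only points
   of the component fixed by a move, and outer points are fixed by a move. *)
Lemma component_endpoints (f g : V -> V) x : involutive f -> involutive g ->
  (forall x y, e x y -> [\/ y = x, y = f x | y = g x]) ->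
  (forall y, connect e y (f y)) -> (forall y, connect e y (g y)) ->
  (forall o : 'I_l + 'I_n, f (outer o) = outer o \/ g (outer o) = outer o) ->
  g (outer x) = outer x ->
  let z := antipode f g (outer x) in
  [/\ forall o, connect e (outer x) (outer o) -> outer o \in [set outer x; z],
      connect e (outer x) z, f z = z \/ g z = z & (f (outer x) <> outer x -> z <> outer x)].
Proof.
move=> fK gK adj cf cg fix_outer gx z.
have orb y : connect e (outer x) y -> fconnect (g \o f) (outer x) y.
  suff cl s u : fconnect (g \o f) (outer x) u -> path e u s ->
      fconnect (g \o f) (outer x) (last u s).
    by case/connectP => s es ->; apply: cl.
  elim: s u => //= v s IH u xu /andP[/adj uv]; apply: IH.
  have [cu1 cu2] := dihedral_closed fK gK gx xu.
  by case: uv => ->.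
split.
- move=> o /orb/(fixed_or_antipode fK gK gx) /(_ (fix_outer o)).
  by rewrite !inE => -[] ->; rewrite eqxx ?orbT.
- rewrite /z /antipode; elim: (_./2) => [|k IH]; first exact: connect0.
  by rewrite iterS /=; apply: (connect_trans IH); apply: connect_trans (cg _).
- exact: antipode_fixed.
- exact: antipode_neq.
Qed.

(** A component has at most two outer points, [x] and the opposite point [z] of its orbit. If both
    layers are perfect matchings, no move that reaches a middle point fixes it, so [z] is an outer
    point different from [x]. *)
Lemma stack_block_size B x : B \in stack p q -> x \in B ->
  (#|B| <= 2)%N /\
  ((forall C, C \in p -> #|C| = 2%N) -> (forall C, C \in q -> #|C| = 2%N) -> #|B| = 2%N).
Proof.
move=> BS xB.
have fixb (i : 'I_l) : high_move (outer (inl i)) = outer (inl i) by [].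
have fixt (k : 'I_n) : low_move (outer (inr k)) = outer (inr k) by [].
have outer_inj : injective (@outer l m n) by case=> [i|i] [j|j] //= [->].
have BE y : (y \in B) = connect e (outer x) (outer y) by apply: mem_stack_block.
suff [z [zB zc zf]] : exists z : V, [/\ forall o, connect e (outer x) (outer o) -> outer o \in [set outer x; z],
    connect e (outer x) z &
    (forall C, C \in p -> #|C| = 2%N) -> (forall C, C \in q -> #|C| = 2%N) ->
    (low_move z = z \/ high_move z = z) /\ z <> outer x].
  have B2 : (#|B| <= 2)%N.
    rewrite -(card_imset _ outer_inj); apply: leq_trans (_ : #|[set outer x; z]| <= 2)%N; last first.
      by rewrite cards2; case: (_ == _).
    apply: subset_leq_card; apply/fintype.subsetP => _ /imsetP[y yB ->].
    by apply: zB; rewrite -BE.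
  split=> // P2 Q2; have [zfix zx] := zf P2 Q2.
  have [y zy] : exists y, z = outer y.
    case: z zfix {zB zc zf zx} => [[i|j]|k] zfix; [by exists (inl i)| |by exists (inr k)].
    exfalso; case: zfix => /=.
      move=> [] /eqP; apply/negP; rewrite partner_neq //; exact: P2.
    move=> E; have : high (partner q (inl j)) = high (inl j) :> V by [].
    case E' : (partner q (inl j)) => [j'|//] /= [jj].
    have := partner_neq pq (Q2 _ (cq (inl j))).
    by rewrite E' jj eqxx.
  apply/eqP; rewrite eqn_leq B2 (cardsD1 x) xB (cardsD1 y) !inE BE -zy zc andbT.
  by rewrite (_ : y != x) //; apply/eqP => yx; rewrite yx in zy.
(* The involution called [g] in the dihedral lemmas must fix the starting point: this is the high
   move at a bottom point and the low move at a top point. *)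
case: x xB BE => [i|k] xB BE.
  have [h1 h2 h3 h4] := @component_endpoints low_move high_move (inl i) low_moveK high_moveK
    adj_moves connect_low_move connect_high_move
    ltac:(by case=> ?; [right|left]) (fixb i).
  exists (antipode low_move high_move (outer (inl i))); split=> // P2 Q2; split=> //.
  apply: h4 => -[] /eqP; apply/negP; apply: partner_neq => //; exact: P2.
have [h1 h2 h3 h4] := @component_endpoints high_move low_move (inr k) high_moveK low_moveK
    ltac:(by move=> ? ? /adj_moves[]; [apply: Or31|apply: Or33|apply: Or32])
    connect_high_move connect_low_move
    ltac:(by case=> ?; [left|right]) (fixt k).
exists (antipode high_move low_move (outer (inr k))); split=> // P2 Q2; split.
  by case: h3; [right|left].
apply: h4 => E; have : high (partner q (inr k)) = high (inr k) :> V by [].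
case E' : (partner q (inr k)) => [//|k'] /= [kk].
have := partner_neq pq (Q2 _ (cq (inr k))).
by rewrite E' kk eqxx.
Qed.

End StackMatching.

(** Closure under cutting keeps both halves of a diagram in the category, so that its trace can be
    reduced to fewer points there. *)
Record diagram_class (S : block_cond) : Prop := DiagramClass {
  dc_perm : forall n (s : {perm 'I_n}) B, B \in perm_blocks s -> S n n B;
  dc_stack : forall l m n (p : blocks l m) (q : blocks m n),
    partition p [set: 'I_l + 'I_m] -> partition q [set: 'I_m + 'I_n] ->
    (forall B, B \in p -> S l m B) -> (forall B, B \in q -> S m n B) ->
    forall B, B \in stack p q -> S l n B;
  dc_lower : forall m n (d : blocks m n), (forall B, B \in d -> S m n B) ->
    forall B, B \in lower_half d -> S m #|through d| B;
  dc_upper : forall m n (d : blocks m n), (forall B, B \in d -> S m n B) ->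
    forall B, B \in upper_half d -> S #|through d| n B }.

Lemma card_perm_block n (s : {perm 'I_n}) B : B \in perm_blocks s ->
  #|bottoms B| = 1%N /\ #|tops B| = 1%N.
Proof.
case/imsetP => i _ ->; split.
  rewrite (_ : bottoms _ = [set i]) ?cards1 //; apply/setP => k.
  by rewrite !inE orbF; apply/eqP/eqP => [[]|->].
rewrite (_ : tops _ = [set s i]) ?cards1 //; apply/setP => k.
by rewrite !inE; apply/eqP/eqP => [[]|->].
Qed.

(** Cutting turns a block with [a] bottom and [b] top points, both positive, into blocks of profiles
    (a, 1) and (1, b), and leaves the profile of any other block unchanged. *)
Lemma profile_diagram_class (S : block_cond) (c : nat -> nat -> bool) :
  (forall m n (B : {set 'I_m + 'I_n}), S m n B = c #|bottoms B| #|tops B|) ->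
  c 1%N 1%N ->
  (forall a b, (0 < a)%N -> (0 < b)%N -> c a b -> c a 1%N && c 1%N b) ->
  (forall l m n (p : blocks l m) (q : blocks m n),
    partition p [set: 'I_l + 'I_m] -> partition q [set: 'I_m + 'I_n] ->
    (forall B, B \in p -> S l m B) -> (forall B, B \in q -> S m n B) ->
    forall B, B \in stack p q -> S l n B) -> diagram_class S.
Proof.
move=> SE c11 chalf Sst; split=> // [n s B /card_perm_block[b1 t1]|m n d dS _ /imsetP[B /[!inE] /andP[Bd nB] ->]|m n d dS _ /imsetP[B /[!inE] /andP[Bd nB] ->]].
- by rewrite SE b1 t1.
- rewrite SE bottoms_lower tops_lower inE Bd nB /=.
  have := dS _ Bd; rewrite SE; have [->|nt] := eqVneq (tops B) set0; first by rewrite cards0.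
  by move=> /chalf; rewrite !card_gt0 nB nt => /(_ isT isT)/andP[].
- rewrite SE tops_upper bottoms_upper inE Bd nB /=.
  have := dS _ Bd; rewrite SE; have [->|nt] := eqVneq (bottoms B) set0; first by rewrite cards0.
  by move=> /chalf; rewrite !card_gt0 nB nt => /(_ isT isT)/andP[].
Qed.

Lemma any_class : diagram_class any_block.
Proof. by apply: (@profile_diagram_class _ (fun _ _ => true)). Qed.

Lemma stack_block_gt0 l m n (p : blocks l m) (q : blocks m n) B :
  B \in stack p q -> exists x, x \in B.
Proof.
move=> BS; apply/set0Pn; apply: contraTneq BS => ->.
by have /and3P[] := partition_stack p q.
Qed.

Lemma rook_brauer_class : diagram_class rook_brauer_block.
Proof.
apply: (@profile_diagram_class _ (fun a b => (a + b == 1) || (a + b == 2))%N) => //.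
- by move=> m n B; rewrite -card_bottoms_tops.
- by move=> a b; lia.
move=> l m n p q pp pq Sp Sq B BS; have [x xB] := stack_block_gt0 BS.
have [||B2 _] := stack_block_size pp pq _ _ BS xB.
- by move=> C /Sp/orP[]/eqP->.
- by move=> C /Sq/orP[]/eqP->.
have : (0 < #|B|)%N by apply/card_gt0P; exists x.
rewrite /rook_brauer_block; lia.
Qed.

Lemma brauer_class : diagram_class brauer_block.
Proof.
apply: (@profile_diagram_class _ (fun a b => (a + b == 2))%N) => //.
- by move=> m n B; rewrite -card_bottoms_tops.
- by move=> a b; lia.
move=> l m n p q pp pq Sp Sq B BS; have [x xB] := stack_block_gt0 BS.
have [||_ B2] := stack_block_size pp pq _ _ BS xB.
- by move=> C /Sp/eqP->.
- by move=> C /Sq/eqP->.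
by apply/eqP/B2 => C; [move=> /Sp/eqP|move=> /Sq/eqP].
Qed.

Lemma rook_class : diagram_class rook_block.
Proof.
apply: (@profile_diagram_class _ (fun a b => ((a + b == 1) || (a + b == 2)) && (a <= 1) && (b <= 1))%N) => //.
- by move=> m n B; rewrite /rook_block -card_bottoms_tops.
- by move=> a b; lia.
move=> l m n p q pp pq Sp Sq B BS; have [x xB] := stack_block_gt0 BS.
have : (0 < #|B|)%N by apply/card_gt0P; exists x.
have : (#|bottoms B| <= 1)%N.
  by apply: rook_stack_bottoms BS => // C; [move=> /Sp|move=> /Sq] => /andP[/andP[]].
have : (#|tops B| <= 1)%N.
  by apply: rook_stack_tops BS => // C; [move=> /Sp|move=> /Sq] => /andP[].
rewrite /rook_block card_bottoms_tops; lia.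
Qed.

Lemma permutation_class : diagram_class permutation_block.
Proof.
apply: (@profile_diagram_class _ (fun a b => (a == 1) && (b == 1))%N) => //.
- by move=> a b; lia.
by move=> l m n p q pp pq Sp Sq B BS; apply: permutation_stack BS.
Qed.

(** * The linear category of diagrams *)

Section LinearCategory.
Variables (K : fieldType) (t : K) (S : block_cond).
Hypothesis SC : diagram_class S.
Local Notation diag := (diagram S).
Local Notation Hom := (Defs.Hom K S).
Local Notation "g ∘ f" := (Defs.comp t g f) (at level 40, left associativity).

Lemma diag_partition m n (d : diag m n) : partition (val d) [set: 'I_m + 'I_n].
Proof. by case/andP: (valP d). Qed.

Lemma diag_blocks m n (d : diag m n) B : B \in val d -> S B.
Proof. by case/andP: (valP d) => _ /forall_inP; apply. Qed.

Lemma stack_diagram_proof l m n (p : diag l m) (q : diag m n) :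
  partition (stack (val p) (val q)) [set: 'I_l + 'I_n]
  && [forall B in stack (val p) (val q), S B].
Proof.
rewrite partition_stack; apply/forall_inP => B.
by apply: (dc_stack SC) => [||C|C]; rewrite ?diag_partition //; apply: diag_blocks.
Qed.

Definition stackd l m n (p : diag l m) (q : diag m n) : diag l n :=
  Sub (stack (val p) (val q)) (stack_diagram_proof p q).

Lemma perm_diagram_proof n (s : {perm 'I_n}) :
  partition (perm_blocks s) [set: 'I_n + 'I_n] && [forall B in perm_blocks s, S B].
Proof.
by rewrite partition_perm_blocks; apply/forall_inP => B; apply: (dc_perm SC).
Qed.

Definition permd n (s : {perm 'I_n}) : diag n n := Sub (perm_blocks s) (perm_diagram_proof s).

Definition basis_vec m n (d : diag m n) : Hom m n := [ffun e => (e == d)%:R].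

Lemma comp_coefE l m n (g : Hom m n) (f : Hom l m) d :
  (g ∘ f) d = \sum_p \sum_(q | stackd p q == d) t ^+ floating (val p) (val q) * (g q * f p).
Proof. by rewrite ffunE. Qed.

Lemma compDl l m n (g h : Hom m n) (f : Hom l m) : (g + h) ∘ f = g ∘ f + h ∘ f.
Proof.
apply/ffunP => d; rewrite [RHS]ffunE !comp_coefE -big_split; apply: eq_bigr => p _.
by rewrite -big_split; apply: eq_bigr => q _; rewrite ffunE mulrDl mulrDr.
Qed.

Lemma compDr l m n (g : Hom m n) (f h : Hom l m) : g ∘ (f + h) = g ∘ f + g ∘ h.
Proof.
apply/ffunP => d; rewrite [RHS]ffunE !comp_coefE -big_split; apply: eq_bigr => p _.
by rewrite -big_split; apply: eq_bigr => q _; rewrite ffunE !mulrDr.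
Qed.

Lemma scale_homE m n a (f : Hom m n) d : (a *: f) d = a * f d :> K.
Proof. by rewrite ffunE. Qed.

Lemma compZl l m n a (g : Hom m n) (f : Hom l m) : (a *: g) ∘ f = a *: (g ∘ f).
Proof.
apply/ffunP => d; rewrite scale_homE !comp_coefE mulr_sumr; apply: eq_bigr => p _.
by rewrite mulr_sumr; apply: eq_bigr => q _; rewrite scale_homE -mulrA mulrCA.
Qed.

Lemma compZr l m n a (g : Hom m n) (f : Hom l m) : g ∘ (a *: f) = a *: (g ∘ f).
Proof.
apply/ffunP => d; rewrite scale_homE !comp_coefE mulr_sumr; apply: eq_bigr => p _.
rewrite mulr_sumr; apply: eq_bigr => q _.
by rewrite scale_homE [g q * _]mulrCA [LHS]mulrCA.
Qed.

Lemma comp0l l m n (f : Hom l m) : (0 : Hom m n) ∘ f = 0.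
Proof. by have := compZl 0 (0 : Hom m n) f; rewrite !scale0r. Qed.

Lemma comp0r l m n (g : Hom m n) : g ∘ (0 : Hom l m) = 0.
Proof. by have := compZr 0 g (0 : Hom l m); rewrite !scale0r. Qed.

Lemma comp_suml l m n (I : finType) (P : pred I) (g : I -> Hom m n) (f : Hom l m) :
  (\sum_(i | P i) g i) ∘ f = \sum_(i | P i) (g i ∘ f).
Proof. by apply: (big_morph (fun x => x ∘ f)) => [x y|]; [exact: compDl|exact: comp0l]. Qed.

Lemma comp_sumr l m n (I : finType) (P : pred I) (g : Hom m n) (f : I -> Hom l m) :
  g ∘ (\sum_(i | P i) f i) = \sum_(i | P i) (g ∘ f i).
Proof. by apply: (big_morph (fun x => g ∘ x)) => [x y|]; [exact: compDr|exact: comp0r]. Qed.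

Lemma basis_sum m n (f : Hom m n) : f = \sum_d f d *: basis_vec d.
Proof.
apply/ffunP => d; rewrite sum_ffunE (bigD1 d) //= big1 ?addr0 => [|e ne].
  by rewrite !ffunE eqxx -[LHS]mulr1.
by rewrite !ffunE eq_sym (negPf ne) scaler0.
Qed.

Lemma comp_basis l m n (p : diag l m) (q : diag m n) :
  basis_vec q ∘ basis_vec p = t ^+ floating (val p) (val q) *: basis_vec (stackd p q).
Proof.
apply/ffunP => d; rewrite comp_coefE (bigD1 p) //= [X in _ + X]big1 ?addr0; last first.
  by move=> p' np; rewrite big1 // => q' _; rewrite !ffunE (negPf np) !mulr0.
rewrite !ffunE big_mkcond (bigD1 q) //= big1 => [|q' nq]; last first.
  by case: ifP => // _; rewrite !ffunE (negPf nq) mul0r mulr0.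
rewrite !ffunE !eqxx addr0 eq_sym; case: eqP => _; last by rewrite scaler0.
by rewrite mulr1 [RHS]mulr1 mulr1.
Qed.

Lemma compA k l m n (h : Hom m n) (g : Hom l m) (f : Hom k l) :
  h ∘ (g ∘ f) = (h ∘ g) ∘ f.
Proof.
have Af r q : basis_vec r ∘ (basis_vec q ∘ f) = (basis_vec r ∘ basis_vec q) ∘ f.
  rewrite (basis_sum f) !comp_sumr; apply: eq_bigr => p _; rewrite !compZr.
  congr (_ *: _).
  rewrite (comp_basis p q) compZr comp_basis (comp_basis q r) compZl comp_basis.
  rewrite !scalerA -!exprD.
  have [E1 E2] := stackA (val p) (val q) (val r).
  have -> : stackd p (stackd q r) = stackd (stackd p q) r by apply/val_inj/esym.
  by rewrite E2.
have Ag r : basis_vec r ∘ (g ∘ f) = (basis_vec r ∘ g) ∘ f.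
  rewrite (basis_sum g) comp_suml !comp_sumr comp_suml; apply: eq_bigr => q _.
  by rewrite compZl !compZr compZl Af.
rewrite (basis_sum h) !comp_suml; apply: eq_bigr => r _.
by rewrite !compZl Ag.
Qed.

Lemma comp_idl m n (f : Hom m n) : idm K S n ∘ f = f.
Proof.
have -> : idm K S n = basis_vec (permd 1%g).
  by apply/ffunP => d; rewrite !ffunE id_blocksE.
rewrite {2}(basis_sum f) {1}(basis_sum f) comp_sumr; apply: eq_bigr => p _.
have := stack_idr (diag_partition p); rewrite id_blocksE => -[E1 E2].
rewrite compZr comp_basis E2 expr0 scale1r.
by congr (_ *: basis_vec _); apply: val_inj.
Qed.

Lemma comp_idr m n (f : Hom m n) : f ∘ idm K S m = f.
Proof.
have -> : idm K S m = basis_vec (permd 1%g).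
  by apply/ffunP => d; rewrite !ffunE id_blocksE.
rewrite {2}(basis_sum f) {1}(basis_sum f) comp_suml; apply: eq_bigr => p _.
have := stack_idl (diag_partition p); rewrite id_blocksE => -[E1 E2].
rewrite compZl comp_basis E2 expr0 scale1r.
by congr (_ *: basis_vec _); apply: val_inj.
Qed.

End LinearCategory.

(** * Semisimple algebras *)

Section SemisimpleAlgebra.
Variables (K : numClosedFieldType) (D : finType).
Local Notation A := {ffun D -> K^o}.
Variables (mul : A -> A -> A) (one : A).
Local Notation "x ∘ y" := (mul x y) (at level 40, left associativity).
Hypotheses (mulDl : forall x y z, (x + y) ∘ z = x ∘ z + y ∘ z)
  (mulDr : forall x y z, x ∘ (y + z) = x ∘ y + x ∘ z)
  (mulZl : forall a x y, (a *: x) ∘ y = a *: (x ∘ y))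
  (mulZr : forall a x y, x ∘ (a *: y) = a *: (x ∘ y))
  (mA : forall x y z, x ∘ (y ∘ z) = x ∘ y ∘ z)
  (m1l : forall x, one ∘ x = x) (m1r : forall x, x ∘ one = x).

Let m0l x : 0 ∘ x = 0. Proof. by have := mulZl 0 0 x; rewrite !scale0r. Qed.
Let m0r x : x ∘ 0 = 0. Proof. by have := mulZr 0 x 0; rewrite !scale0r. Qed.
Let mNl x y : (- x) ∘ y = - (x ∘ y). Proof. by rewrite -[- x]scaleN1r mulZl scaleN1r. Qed.
Let mNr x y : x ∘ (- y) = - (x ∘ y). Proof. by rewrite -[- y]scaleN1r mulZr scaleN1r. Qed.
Let msuml (I : finType) (P : pred I) (f : I -> A) x :
  (\sum_(i | P i) f i) ∘ x = \sum_(i | P i) (f i ∘ x).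
Proof. by apply: (big_morph (fun z => z ∘ x)) => [y z|]; [exact: mulDl|exact: m0l]. Qed.
Let msumr (I : finType) (P : pred I) (f : I -> A) x :
  x ∘ (\sum_(i | P i) f i) = \sum_(i | P i) (x ∘ f i).
Proof. by apply: (big_morph (fun z => x ∘ z)) => [y z|]; [exact: mulDr|exact: m0r]. Qed.

(** For idempotents [a] and [b] this projects the algebra onto the corner aAb, so its trace is the
    dimension of that corner. *)
Definition sandwich (a b x : A) : A := a ∘ x ∘ b.

Lemma sandwich_linear a b : linear (sandwich a b).
Proof. by move=> c x y; rewrite /sandwich mulDr mulZr mulDl mulZl. Qed.

HB.instance Definition _ a b :=
  GRing.isLinear.Build K A A *:%R (sandwich a b) (sandwich_linear a b).

Definition sandwich_lfun a b : 'Hom(A, A) := linfun (sandwich a b).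

Lemma sandwich_lfunE a b x : sandwich_lfun a b x = a ∘ x ∘ b.
Proof. by rewrite lfunE. Qed.

Hypothesis ss : forall U : {vspace A}, (forall a x, x \in U -> a ∘ x \in U) ->
  exists V : {vspace A}, [/\ (forall a x, x \in V -> a ∘ x \in V),
    (U + V = fullv)%VS & (U :&: V = 0)%VS].

Definition primitive e := [/\ e <> 0, e ∘ e = e &
  forall g h, g ∘ g = g -> h ∘ h = h -> g ∘ h = 0 -> h ∘ g = 0 -> g + h = e ->
    g = 0 \/ h = 0].

(** Write [one = u + v] along a complement [V] of [U]. For [x] in [U], the element
    [x ∘ v = x - x ∘ u] lies in both ideals, hence vanishes. *)
Lemma left_ideal_generator (U : {vspace A}) : (forall a x, x \in U -> a ∘ x \in U) ->
  exists2 u, u \in U & forall x, x \in U -> x ∘ u = x.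
Proof.
move=> UI; have [V [VI UV UV0]] := ss UI.
have : one \in (U + V)%VS by rewrite UV memvf.
case/memv_addP => u uU [v vV E]; exists u => // x xU.
have xv : x ∘ v = x - x ∘ u by rewrite -{2}[x]m1r E mulDr addrC addKr.
have : x ∘ v \in (U :&: V)%VS.
  by rewrite memv_cap VI // andbT xv rpredB // UI.
by rewrite UV0 memv0 xv subr_eq0 => /eqP.
Qed.

Definition principal x : {vspace A} := limg (sandwich_lfun one x).

Lemma mem_principal x y : reflect (exists a, y = a ∘ x) (y \in principal x).
Proof.
apply: (iffP memv_imgP) => [[a _ ->]|[a ->]].
  by exists a; rewrite sandwich_lfunE m1l.
by exists a; rewrite ?memvf // sandwich_lfunE m1l.
Qed.

(** The left ideal of [x] has a right unit [u = a ∘ x], and [e ∘ u] is an idempotent below [e]. By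
    primitivity it is 0, which would make [x] vanish, or it is [e], and then [e ∘ a] is the left
    inverse. *)
Lemma primitive_left_inverse e x : primitive e -> x <> 0 -> x ∘ e = x ->
  exists y, y ∘ x = e.
Proof.
move=> [e0 ee ep] x0 xe.
have [|u /mem_principal[a uE] ux] := @left_ideal_generator (principal x).
  by move=> b _ /mem_principal[c ->]; apply/mem_principal; exists (b ∘ c); rewrite mA.
have ue : u ∘ e = u by rewrite uE -mA xe.
have uu : u ∘ u = u by apply: ux; apply/mem_principal; exists a.
pose g := e ∘ u.
have gg : g ∘ g = g by rewrite /g -mA (mA u) ue uu.
have ge : g ∘ e = g by rewrite /g -mA ue.
have eg : e ∘ g = g by rewrite /g mA ee.
case: (ep g (e - g)).
- by [].
- by rewrite mulDl !mulDr !mNl !mNr ee ge eg gg opprK addNr addr0.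
- by rewrite mulDr mNr ge gg subrr.
- by rewrite mulDl mNl eg gg subrr.
- by rewrite addrC subrK.
- move=> g0; case: x0; rewrite -(ux x); last by apply/mem_principal; exists one; rewrite m1l.
  by rewrite -uu -{1}ue -mA -/g g0 !m0r.
move/eqP; rewrite subr_eq0 => /eqP E; exists (e ∘ a).
by rewrite -mA -uE -/g -E.
Qed.

Lemma eigenvector_on (W : {vspace A}) x : W != 0%VS ->
  (forall y, y \in W -> y ∘ x \in W) ->
  exists2 y, y \in W & y <> 0 /\ exists l : K, y ∘ x = l *: y.
Proof.
move=> W0 Wx; pose b := vbasis W.
pose N := (\matrix_(i, j) coord b j (b`_i ∘ x)) : 'M[K]_(\dim W).
have bW i : (i < \dim W)%N -> b`_i \in W.
  by move=> iW; apply: vbasis_mem; rewrite mem_nth // size_tuple.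
have [l /eigenvalueP[v vN v0]] : exists l, eigenvalue N l.
  apply: eigenvalue_closed; by rewrite lt0n dimv_eq0.
pose y := \sum_i v 0 i *: b`_i.
exists y; first by rewrite rpred_sum // => i _; rewrite rpredZ // bW.
have fb : free b := basis_free (vbasisP W).
split.
  move=> y0; case/eqP: v0; apply/rowP => i; rewrite mxE.
  have := coord_sum_free (fun i => v 0 i) i fb.
  by rewrite -/y y0 linear0 => <-.
exists l; rewrite /y msuml scaler_sumr.
transitivity (\sum_i \sum_j (v 0 i * N i j) *: b`_j).
  apply: eq_bigr => i _; rewrite mulZl {1}(coord_vbasis (Wx _ (bW _ (ltn_ord i)))).
  by rewrite scaler_sumr; apply: eq_bigr => j _; rewrite scalerA mxE.
rewrite exchange_big; apply: eq_bigr => j _ /=; rewrite -scaler_suml scalerA.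
by move/rowP: vN => /(_ j); rewrite !mxE => ->.
Qed.

(** Schur's lemma: an eigenvector [y] in eAe of right multiplication by [x] has a left inverse [z]
    with [z ∘ y = e], whence [x = z ∘ y ∘ x = l *: e]. *)
Lemma primitive_corner e x : primitive e -> e ∘ x = x -> x ∘ e = x ->
  exists l : K, x = l *: e.
Proof.
move=> pe ex xe; have [e0 ee _] := pe.
pose W := limg (sandwich_lfun e e).
have WP y : reflect (e ∘ y ∘ e = y) (y \in W).
  apply: (iffP memv_imgP) => [[a _ ->]|E].
    by rewrite sandwich_lfunE !mA ee -mA ee.
  by exists y; rewrite ?memvf // sandwich_lfunE.
have eW : e \in W by apply/WP; rewrite ee ee.
have [||y /WP yW [y0 [l yx]]] := @eigenvector_on W x.
- by apply: contraTneq eW => ->; rewrite memv0; apply/eqP.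
- by move=> y /WP yW; apply/WP; rewrite -yW !mA ee -!mA xe ex.
have ye : y ∘ e = y by rewrite -yW -mA ee.
have [z zy] := primitive_left_inverse pe y0 ye.
by exists l; rewrite -{1}ex -{1}zy -mA yx mulZr zy.
Qed.

(** For primitive [e] and [f], right multiplication by a nonzero element of eAf is an isomorphism
    between the left ideals they generate: both belong to the same simple module. *)
Definition prim_equiv e f := exists2 x, x <> 0 & e ∘ x = x /\ x ∘ f = x.

Lemma schur_inverse e f x : primitive e -> primitive f ->
  x <> 0 -> e ∘ x = x -> x ∘ f = x ->
  exists y, [/\ f ∘ y = y, y ∘ e = y, x ∘ y = e & y ∘ x = f].
Proof.
move=> pe pf x0 ex xf; have [e0 ee _] := pe; have [f0 ff _] := pf.
have [z zx] := primitive_left_inverse pf x0 xf.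
pose y := f ∘ z ∘ e.
have fy : f ∘ y = y by rewrite /y !mA ff.
have ye : y ∘ e = y by rewrite /y -mA ee.
have yx : y ∘ x = f by rewrite /y -mA ex -mA zx ff.
exists y; split=> //.
have [||l xyl] := @primitive_corner e (x ∘ y) pe.
- by rewrite mA ex.
- by rewrite -mA ye.
have xy0 : x ∘ y <> 0.
  by move=> E; apply: f0; rewrite -ff -{1}yx -mA -yx (mA x) E m0l m0r.
have : (x ∘ y) ∘ (x ∘ y) = x ∘ y by rewrite mA -(mA x y x) yx xf.
(* [x ∘ y] is a nonzero idempotent and a multiple of [e], so the scalar is 1. *)
rewrite xyl mulZl mulZr ee scalerA => /eqP; rewrite -subr_eq0 -scalerBl scaler_eq0.
case/orP=> [|/eqP//]; rewrite -[X in _ - X]mulr1 -mulrBr mulf_eq0 => /orP[/eqP l0|].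
  by case: xy0; rewrite xyl l0 scale0r.
by rewrite subr_eq0 => /eqP->; rewrite scale1r.
Qed.

Lemma prim_equiv_refl e : primitive e -> prim_equiv e e.
Proof. by case=> e0 ee _; exists e. Qed.

Lemma prim_equiv_sym e f : primitive e -> primitive f -> prim_equiv e f -> prim_equiv f e.
Proof.
move=> pe pf [x x0 [ex xf]]; have [y [fy ye xy yx]] := schur_inverse pe pf x0 ex xf.
exists y => // y0; case: pf => f0 _ _; apply: f0; by rewrite -yx y0 m0l.
Qed.

Lemma prim_equiv_trans e f g : primitive e -> primitive f ->
  prim_equiv e f -> prim_equiv f g -> prim_equiv e g.
Proof.
move=> pe pf [x x0 [ex xf]] [z z0 [fz zg]].
have [y [fy ye xy yx]] := schur_inverse pe pf x0 ex xf.
exists (x ∘ z); last by rewrite mA ex -mA zg.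
by move=> xz0; apply: z0; rewrite -fz -yx -mA xz0 m0r.
Qed.

Definition mx_unit (d : D) : A := [ffun d' => (d' == d)%:R].
Definition op_trace (F : A -> A) : K := \sum_d F (mx_unit d) d.

Lemma mx_unit_sum (x : A) : x = \sum_d x d *: mx_unit d.
Proof.
apply/ffunP => d; rewrite sum_ffunE (bigD1 d) //= big1 ?addr0 => [|e ne].
  by rewrite !ffunE eqxx -[LHS]mulr1.
by rewrite !ffunE eq_sym (negPf ne) scaler0.
Qed.

(** By Schur's lemma the corner is zero or spanned by [x], and [sandwich e f] fixes [x]. *)
Lemma trace_sandwich e f : primitive e -> primitive f ->
  op_trace (sandwich e f) = (`[< prim_equiv e f >])%:R.
Proof.
move=> pe pf; case: asboolP => [[x x0 [ex xf]]|nef]; last first.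
  rewrite /op_trace big1 // => d _; suff -> : sandwich e f (mx_unit d) = 0 by rewrite ffunE.
  apply: contrapT => h; apply: nef; exists (sandwich e f (mx_unit d)) => //.
  have [_ ee _] := pe; have [_ ff _] := pf.
  by split; [rewrite /sandwich !mA ee | rewrite /sandwich -mA ff].
have [y [fy ye xy yx]] := schur_inverse pe pf x0 ex xf.
have scal z : exists l : K, sandwich e f z = l *: x.
  have [_ ee _] := pe; have [_ ff _] := pf.
  have [||l El] := @primitive_corner e (sandwich e f z ∘ y) pe.
  - by rewrite /sandwich !mA ee.
  - by rewrite -mA ye.
  by exists l; rewrite -{1}ex -mulZl -El -mA yx /sandwich -[RHS]mA ff.
pose l d := projT1 (cid (scal (mx_unit d))).
have lE d : sandwich e f (mx_unit d) = l d *: x by rewrite /l; case: cid.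
have xE : sandwich e f x = x by rewrite /sandwich ex xf.
have : (\sum_d x d * l d) *: x = 1 *: x.
  rewrite scale1r -[RHS]xE [X in _ = sandwich e f X](mx_unit_sum x) linear_sum scaler_suml.
  by apply: eq_bigr => d _; rewrite linearZ /= lE scalerA.
move/eqP; rewrite -subr_eq0 -scalerBl scaler_eq0 subr_eq0 => /orP[/eqP E|/eqP//].
rewrite /= -E /op_trace; apply: eq_bigr => d _.
by rewrite lE ffunE mulrC.
Qed.

Definition prim_decomp (I : finType) (f : I -> A) (e : A) :=
  [/\ forall i, primitive (f i), forall i j, i != j -> f i ∘ f j = 0 & \sum_i f i = e].

(** Induction on the dimension of the left ideal of [e]: if a nonzero [e] is not primitive, it
    splits into two orthogonal idempotents with strictly smaller left ideals. *)
Lemma idem_decomp e : e ∘ e = e -> exists (I : finType) (f : I -> A), prim_decomp f e.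
Proof.
move: {2}(\dim (principal e)) (leqnn (\dim (principal e))) => n.
elim: n e => [|n IH] e dime ee.
  exists void, (fun i : void => match i return A with end); split; try by case.
  rewrite big1; last by case.
  apply/esym/eqP; rewrite -memv0; move: dime; rewrite leqn0 dimv_eq0 => /eqP <-.
  by apply/mem_principal; exists e.
have [pe|npe] := pselect (primitive e).
  by exists unit, (fun _ => e); split=> [|[] []|]; rewrite // big_const card_unit /= addr0.
have [->|e0] := pselect (e = 0).
  exists void, (fun i : void => match i return A with end); split; try by case.
  by rewrite big1 //; case.
have [g [h [gg hh gh hg [ghe g0 h0]]]] : exists g h, [/\ g ∘ g = g, h ∘ h = h,
    g ∘ h = 0, h ∘ g = 0 & [/\ g + h = e, g <> 0 & h <> 0]].
  apply: contrapT => no; apply: npe; split=> // g h gg hh gh hg ghe.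
  apply: contrapT => /not_orP[g0 h0]; apply: no.
  by exists g, h; split=> //; split.
have dim_lt u v : u ∘ u = u -> v ∘ v = v -> u ∘ v = 0 -> v ∘ u = 0 ->
    u + v = e -> v <> 0 -> (\dim (principal u) <= n)%N.
  move=> uu vv uv vu uve v0; rewrite -ltnS; apply: leq_trans dime.
  have sub : (principal u <= principal e)%VS.
    apply/subvP => _ /mem_principal[a ->]; apply/mem_principal; exists (a ∘ u).
    by rewrite -uve mulDr -!mA uu uv m0r addr0.
  rewrite ltn_neqAle dimvS // andbT; apply/negP => /eqP E.
  have Eq : principal u = principal e by apply/eqP; rewrite eqEdim sub E leqnn.
  have : v \in principal e by apply/mem_principal; exists v; rewrite -uve mulDr vu vv add0r.
  rewrite -Eq => /mem_principal[a va]; apply: v0.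
  by rewrite -vv {1}va -mA uv m0r.
have [I1 [f1 [p1 o1 s1]]] := IH g (dim_lt g h gg hh gh hg ghe h0) gg.
have [I2 [f2 [p2 o2 s2]]] := IH h (dim_lt h g hh gg hg gh (etrans (addrC _ _) ghe) g0) hh.
have corner (I : finType) (f : I -> A) u : prim_decomp f u ->
    forall i, f i ∘ u = f i /\ u ∘ f i = f i.
  move=> [p o <-] i; rewrite msumr msuml; split.
    rewrite (bigD1 i) //= big1 ?addr0 => [|j ji]; first by case: (p i).
    by apply: o; rewrite eq_sym.
  rewrite (bigD1 i) //= big1 ?addr0 => [|j ji]; first by case: (p i).
  exact: o.
have c1 := corner _ f1 g (And3 p1 o1 s1); have c2 := corner _ f2 h (And3 p2 o2 s2).
exists (I1 + I2)%type, (fun i => match i with inl a => f1 a | inr b => f2 b end); split.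
- by case.
- case=> [a|a] [b|b] ab.
  + by apply: o1; apply: contraNneq ab => ->.
  + by rewrite -(c1 a).1 -(c2 b).2 -mA (mA g) gh m0l m0r.
  + by rewrite -(c2 a).1 -(c1 b).2 -mA (mA h) hg m0l m0r.
  + by apply: o2; apply: contraNneq ab => ->.
- by rewrite big_sumType /= s1 s2.
Qed.

Section Decomposition.
Variables (I : finType) (f : I -> A).
Hypothesis df : prim_decomp f one.

(** The multiplicity in the regular module of the simple module of [e], which equals the dimension
    of that simple module. *)
Definition mult e := #|[set i | `[< prim_equiv e (f i) >]]|.

Lemma trace_mult e : primitive e -> op_trace (sandwich e one) = (mult e)%:R.
Proof.
move=> pe; have [pf _ f1] := df.
have -> : op_trace (sandwich e one) = \sum_i op_trace (sandwich e (f i)).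
  rewrite /op_trace exchange_big; apply: eq_bigr => d _.
  by rewrite -sum_ffunE /sandwich -msumr f1.
rewrite /mult -sum1_card natr_sum [RHS]big_mkcond; apply: eq_bigr => i _.
by rewrite trace_sandwich // inE; case: asbool.
Qed.

(** Both sides are the trace of the identity, with the left factor [one] expanded over the [f i].
    Each of the [d_c] idempotents of a class contributes [d_c], so this is the sum of squares. *)
Lemma card_basis : #|D| = \sum_i mult (f i).
Proof.
have [pf _ f1] := df.
apply/eqP; rewrite -(eqr_nat K) natr_sum; apply/eqP.
under eq_bigr do rewrite -trace_mult //.
rewrite /op_trace exchange_big /=.
rewrite -sum1_card natr_sum; apply: eq_bigr => d _.
by rewrite -sum_ffunE /sandwich -!msuml f1 m1l m1r ffunE eqxx.
Qed.

Lemma mult_gt0 i : (0 < mult (f i))%N.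
Proof.
have [pf _ f1] := df; apply/card_gt0P; exists i; rewrite inE; apply/asboolP.
exact: prim_equiv_refl.
Qed.
End Decomposition.

(** The multiplicity is a trace that involves [e] alone. *)
Lemma mult_unique (I J : finType) (f : I -> A) (g : J -> A) e :
  prim_decomp f one -> prim_decomp g one -> primitive e -> mult f e = mult g e.
Proof.
move=> df dg pe; apply/eqP; rewrite -(eqr_nat K).
by rewrite -(trace_mult df) // (trace_mult dg).
Qed.

Lemma mult_equiv (I : finType) (f : I -> A) e e' : prim_decomp f one ->
  primitive e -> primitive e' -> prim_equiv e e' -> mult f e = mult f e'.
Proof.
move=> [pf _ _] pe pe' ee'; rewrite /mult; apply: fintype.eq_card => i; rewrite !inE.
apply/asboolP/asboolP; last exact: prim_equiv_trans.
by apply: prim_equiv_trans => //; apply: prim_equiv_sym.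
Qed.

(** Double counting: weight each pair of equivalent [f i] and [g j] by the inverse of the size of
    their class. Every row and every column then has sum 1. *)
Lemma decomp_card_unique (I J : finType) (f : I -> A) (g : J -> A) :
  prim_decomp f one -> prim_decomp g one -> #|I| = #|J|.
Proof.
move=> df dg; have [pf _ _] := df; have [pg _ _] := dg.
have m0 (L : finType) (h : L -> A) i : prim_decomp h one -> (mult h (h i))%:R != 0 :> K.
  by move=> dh; rewrite pnatr_eq0 -lt0n mult_gt0.
pose E i j := (`[< prim_equiv (f i) (g j) >])%:R / (mult g (f i))%:R : K.
have rowI i : \sum_j E i j = 1.
  rewrite /E -mulr_suml -[RHS](divff (m0 _ f i df)) (mult_unique df dg) //; congr (_ / _).
  rewrite /mult -sum1_card natr_sum [RHS]big_mkcond; apply: eq_bigr => j _.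
  by rewrite inE; case: asbool.
have colJ j : \sum_i E i j = 1.
  rewrite -[RHS](divff (m0 _ g j dg)).
  transitivity (\sum_i (`[< prim_equiv (g j) (f i) >])%:R / (mult g (g j))%:R : K).
    apply: eq_bigr => i _; rewrite /E.
    have -> : `[< prim_equiv (g j) (f i) >] = `[< prim_equiv (f i) (g j) >].
      by apply/asboolP/asboolP; apply: prim_equiv_sym.
    by case: asboolP => [ij|]; rewrite ?mul0r // (mult_equiv dg _ _ ij).
  rewrite -mulr_suml -(mult_unique df dg) //; congr (_ / _).
  rewrite /mult -sum1_card natr_sum [RHS]big_mkcond; apply: eq_bigr => i _.
  by rewrite inE; case: asbool.
apply/eqP; rewrite -(eqr_nat K) -!sum1_card !natr_sum.
rewrite -(eq_bigr _ (fun i _ => rowI i)) exchange_big /=.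
by rewrite (eq_bigr _ (fun j _ => colJ j)).
Qed.
End SemisimpleAlgebra.

(** * Indecomposable objects of the Karoubi envelope *)

Section Karoubi.
Variables (K : numClosedFieldType) (t : K) (S : block_cond).
Hypothesis SC : diagram_class S.
Local Notation Hom := (Defs.Hom K S).
Local Notation "g ∘ f" := (Defs.comp t g f) (at level 40, left associativity).
Local Notation "g ⊚ f" := (addComp t g f) (at level 40, left associativity).
Local Notation addHom := (@addHom K S).
Local Notation karOb := (@karOb K t S).
Local Notation primitive := (primitive (fun x y => x ∘ y)).
Local Notation prim_decomp := (prim_decomp (fun x y => x ∘ y)).

Lemma addHom_ext X Y (f g : addHom X Y) : (forall j i, f j i = g j i) -> f = g.
Proof.
by move=> h; do 2![apply: functional_extensionality_dep => ?]; apply: h.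
Qed.

Lemma addCompA (W X Y Z : addOb) (h : addHom Y Z) (g : addHom X Y) (f : addHom W X) :
  h ⊚ (g ⊚ f) = h ⊚ g ⊚ f.
Proof.
apply: addHom_ext => k i; rewrite /addComp.
transitivity (\sum_j \sum_a (h k j ∘ (g j a ∘ f a i))).
  by apply: eq_bigr => j _; apply: (comp_sumr t SC).
rewrite exchange_big; apply: eq_bigr => a _ /=.
rewrite (comp_suml t SC); apply: eq_bigr => b _.
exact: (compA t SC).
Qed.

Lemma addComp0l (X Y Z : addOb) (f : addHom X Y) :
  addZero K S (X := Y) (Y := Z) ⊚ f = addZero K S (X := X) (Y := Z).
Proof. by apply: addHom_ext => k i; rewrite /addComp big1 // => j _; apply: (comp0l t SC). Qed.

Lemma addComp0r (X Y Z : addOb) (g : addHom Y Z) :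
  g ⊚ addZero K S (X := X) (Y := Y) = addZero K S (X := X) (Y := Z).
Proof. by apply: addHom_ext => k i; rewrite /addComp big1 // => j _; apply: (comp0r t SC). Qed.

Lemma karHom_idem (X Y : karOb) (f : addHom (kar_ob X) (kar_ob Y)) : is_karHom f ->
  f ⊚ kar_idem X = f /\ kar_idem Y ⊚ f = f.
Proof.
by rewrite /is_karHom => fE; split; rewrite -{2}fE -{1}fE ?addCompA ?kar_idemP //
  -!addCompA kar_idemP.
Qed.

Lemma addComp_suml (X Y Z : addOb) (I : finType) (M : I -> addHom Y Z) N (f : addHom X Y) :
  (forall a b, \sum_i M i a b = N a b) -> forall a b, \sum_i (M i ⊚ f) a b = (N ⊚ f) a b.
Proof.
move=> MN a b; rewrite /addComp exchange_big /=; apply: eq_bigr => j _.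
by rewrite -(comp_suml t SC) MN.
Qed.

Lemma addComp_sumr (X Y Z : addOb) (I : finType) (M : I -> addHom X Y) N (g : addHom Y Z) :
  (forall a b, \sum_i M i a b = N a b) -> forall a b, \sum_i (g ⊚ M i) a b = (g ⊚ N) a b.
Proof.
move=> MN a b; rewrite /addComp exchange_big /=; apply: eq_bigr => j _.
by rewrite -(comp_sumr t SC) MN.
Qed.

Section Power.
Variable n : nat.
Local Notation X := (add_single n).

Definition lift_end (x : Hom n n) : addHom X X := fun _ _ => x.

Lemma addComp_single (Y Z : addOb) (g : addHom X Z) (f : addHom Y X) k i :
  (g ⊚ f) k i = g k tt ∘ f tt i.
Proof. by rewrite /addComp (bigD1 tt) //= big1 ?addr0 // => -[]. Qed.

Lemma lift_comp x y : lift_end x ⊚ lift_end y = lift_end (x ∘ y).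
Proof. by apply: addHom_ext => -[] []; rewrite addComp_single. Qed.

Lemma lift_endE (f : addHom X X) : f = lift_end (f tt tt).
Proof. by apply: addHom_ext => -[] []. Qed.

Lemma lift_idl (Y : addOb) (f : addHom Y X) : lift_end (idm K S n) ⊚ f = f.
Proof. by apply: addHom_ext => -[] i; rewrite addComp_single (comp_idl t SC). Qed.

Lemma lift_idr (Y : addOb) (f : addHom X Y) : f ⊚ lift_end (idm K S n) = f.
Proof. by apply: addHom_ext => i -[]; rewrite addComp_single (comp_idr t SC). Qed.

Definition image_ob (e : Hom n n) (ee : e ∘ e = e) : karOb :=
  KarOb (etrans (lift_comp e e) (f_equal lift_end ee)).

(** [inc] and [prj] split [e], so they carry decompositions of [Y] into two objects to
    decompositions of [e] into two orthogonal idempotents, and back. *)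
Lemma indecomposable_summand (Y : karOb) (inc : addHom (kar_ob Y) X)
    (prj : addHom X (kar_ob Y)) (e : Hom n n) :
  prj ⊚ inc = kar_idem Y -> inc ⊚ prj = lift_end e ->
  inc ⊚ kar_idem Y = inc -> kar_idem Y ⊚ prj = prj ->
  indecomposable Y <-> primitive e.
Proof.
move=> pi ip incY Yprj.
have ee : e ∘ e = e.
  have : lift_end e ⊚ lift_end e = lift_end e.
    by rewrite -ip addCompA -(addCompA inc) pi incY.
  by rewrite lift_comp => /(f_equal (fun f : addHom X X => f tt tt)).
split=> [[nY indY]|[e0 _ pe]].
  split=> //.
    move=> e0; apply: nY; rewrite /kar_zero -(kar_idemP Y) -pi.
    rewrite -addCompA (addCompA inc) ip e0.
    have -> : lift_end 0 = addZero K S (X := X) (Y := X) by [].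
    by rewrite addComp0l addComp0r.
  move=> g h gg hh gh hg ghe.
  have ge : g ∘ e = g by rewrite -ghe (compDr t SC) gg gh addr0.
  have he : h ∘ e = h by rewrite -ghe (compDr t SC) hh hg add0r.
  pose c (b : bool) := if b then g else h.
  have cc b : c b ∘ c b = c b by case: b.
  have ce b : c b ∘ e = c b by case: b.
  have [] := indY (fun b => image_ob (cc b)); last first.
    move=> [] /(f_equal (fun f : addHom X X => f tt tt)) /= E; [left|right]; exact: E.
  exists (fun b => prj ⊚ lift_end (c b)), (fun b => lift_end (c b) ⊚ inc); split.
  - move=> b; split; rewrite /is_karHom /=.
      by rewrite -addCompA lift_comp cc addCompA Yprj.
    by rewrite -(addCompA _ inc) incY addCompA lift_comp cc.
  - move=> b /=; rewrite -addCompA (addCompA inc) ip !lift_comp.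
    by rewrite (compA t SC) ce cc.
  - move=> b b' bb'; rewrite -addCompA (addCompA inc) ip !lift_comp.
    rewrite (compA t SC) ce.
    suff -> : c b' ∘ c b = 0 by [].
    by case: b b' bb' => [] [].
  - move=> a b; rewrite -(kar_idemP Y) -pi.
    have -> : prj ⊚ inc ⊚ (prj ⊚ inc) = prj ⊚ (lift_end e ⊚ inc).
      by rewrite -addCompA (addCompA inc) ip.
    have term x : x ∘ x = x -> (prj ⊚ lift_end x ⊚ (lift_end x ⊚ inc)) a b
        = prj a tt ∘ (x ∘ inc tt b).
      move=> xx; rewrite -(addCompA prj) (addCompA (lift_end x)) lift_comp xx.
      by rewrite !addComp_single.
    by rewrite big_bool /= !term // -(compDr t SC) -(compDl t SC) ghe !addComp_single.
split=> [Y0|Z [inc' [prj' [kar id0 ort sum]]]].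
  apply: e0; have : lift_end e = addZero K S (X := X) (Y := X).
    by rewrite -ip -incY Y0 addComp0r addComp0l.
  by move/(f_equal (fun f : addHom X X => f tt tt)).
(* The idempotent that the summand [Z b] cuts out below [e]; it vanishes only if [Z b] is zero. *)
pose c b := (inc ⊚ (inc' b ⊚ prj' b) ⊚ prj) tt tt.
have cE b : lift_end (c b) = inc ⊚ (inc' b ⊚ prj' b) ⊚ prj by rewrite -lift_endE.
have incZ b : inc' b ⊚ kar_idem (Z b) = inc' b by have [/karHom_idem[]] := kar b.
have prjZ b : prj' b ⊚ kar_idem Y = prj' b by have [_ /karHom_idem[]] := kar b.
have Yinc b : kar_idem Y ⊚ inc' b = inc' b by have [/karHom_idem[]] := kar b.
have cc b b' : lift_end (c b ∘ c b') = inc ⊚ (inc' b ⊚ (prj' b ⊚ inc' b') ⊚ prj' b') ⊚ prj.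
  rewrite -lift_comp !cE -!addCompA (addCompA prj) pi (addCompA _ _ prj).
  by rewrite !addCompA -(addCompA _ (prj' b) (kar_idem Y)) prjZ.
have inj x y : lift_end x = lift_end y -> x = y.
  by move/(f_equal (fun f : addHom X X => f tt tt)).
have czero b : c b = 0 -> kar_zero (Z b).
  move=> c0; rewrite /kar_zero.
  have E : prj' b ⊚ inc' b = prj' b ⊚ prj ⊚ inc ⊚ inc' b.
    by rewrite -(addCompA (prj' b)) pi prjZ.
  transitivity (prj' b ⊚ prj ⊚ (inc ⊚ (inc' b ⊚ prj' b) ⊚ prj) ⊚ (inc ⊚ inc' b)).
    by rewrite -(kar_idemP (Z b)) -(id0 b) E !addCompA.
  rewrite -cE c0; have -> : lift_end 0 = addZero K S (X := X) (Y := X) by [].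
  by rewrite addComp0r addComp0l.
have cidem b : c b ∘ c b = c b.
  by apply: inj; rewrite cc id0 incZ -cE.
have cort b b' : b != b' -> c b ∘ c b' = 0.
  move=> bb'; apply: inj; rewrite cc ort; last by rewrite eq_sym.
  by rewrite addComp0r addComp0l addComp0r addComp0l.
have [|||||c0|c0] := pe (c true) (c false).
- exact: cidem.
- exact: cidem.
- exact: cort.
- exact: cort.
- have := addComp_suml prj (addComp_sumr inc sum) tt tt.
  by rewrite big_bool incY ip.
- by exists true; apply: czero.
- by exists false; apply: czero.
Qed.

Lemma has_decompositionP k : has_decomposition t S n k <->
  exists f : 'I_k -> Hom n n, prim_decomp f (idm K S n).
Proof.
have id_lift : kar_idem (tensor_power t S n) = lift_end (idm K S n) by [].
have inj x y : lift_end x = lift_end y -> x = y.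
  by move/(f_equal (fun f : addHom X X => f tt tt)).
split=> [[Y [indY [inc [prj [kar id0 ort sum]]]]]|[f [pf of_ sf]]].
  have incY i : inc i ⊚ kar_idem (Y i) = inc i by have [/karHom_idem[]] := kar i.
  have Yprj i : kar_idem (Y i) ⊚ prj i = prj i by have [_ /karHom_idem[]] := kar i.
  pose f i := (inc i ⊚ prj i) tt tt.
  have fE i : inc i ⊚ prj i = lift_end (f i) by rewrite [LHS]lift_endE.
  exists f; split.
  - by move=> i; apply/(indecomposable_summand (id0 i) (fE i) (incY i) (Yprj i)).
  - move=> i j ij; apply: inj; rewrite -lift_comp -!fE addCompA -(addCompA (inc i)).
    by rewrite ort 1?eq_sym // addComp0r addComp0l.
  - exact: sum.
have ff i : f i ∘ f i = f i by case: (pf i).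
exists (fun i => image_ob (ff i)); split=> [i|].
  have E : lift_end (f i) ⊚ lift_end (f i) = lift_end (f i) by rewrite lift_comp ff.
  by have [_] := @indecomposable_summand (image_ob (ff i)) _ _ _ E E E E; apply.
exists (fun i => lift_end (f i)), (fun i => lift_end (f i)); split.
- move=> i; rewrite /is_karHom id_lift /=; split.
    by rewrite lift_comp ff lift_idl.
  by rewrite lift_idr lift_comp ff.
- by move=> i /=; rewrite lift_comp ff.
- move=> i j ij; rewrite lift_comp of_ 1?eq_sym //.
- move=> [] []; rewrite id_lift /lift_end -sf; apply: eq_bigr => i _.
  by rewrite addComp_single ff.
Qed.
End Power.
End Karoubi.

(** * Traces *)

Section CategoricalTrace.
Variables (K : numClosedFieldType) (t : K) (S : block_cond).
Hypothesis SC : diagram_class S.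
Local Notation Hom := (Defs.Hom K S).
Local Notation diag := (diagram S).
Local Notation "g ∘ f" := (Defs.comp t g f) (at level 40, left associativity).
Local Notation basis := (@basis_vec K S _ _).

Section Trace.
Variables (n : nat) (e : Hom n n).

(* For an idempotent [e] this is the trace of [a] on the morphisms from the
   image of [e] to [k]. *)
Definition cat_trace k (a : Hom k k) : K := \sum_(d : diag n k) (a ∘ basis d ∘ e) d.

(** Composition with [e] on the right commutes with composition by [f] and [g] on the left. Expanded
    in the diagram bases of Hom(n, j) and Hom(n, k), both sides become the same double sum. *)
Lemma cat_traceC j k (f : Hom j k) (g : Hom k j) : cat_trace (g ∘ f) = cat_trace (f ∘ g).
Proof.
transitivity (\sum_(d : diag n j) \sum_(c : diag n k)
    (f ∘ basis d ∘ e) c * (g ∘ basis c) d).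
  apply: eq_bigr => d _; rewrite -!(compA t SC) (compA t SC f).
  rewrite {1}(basis_sum (f ∘ basis d ∘ e)) (comp_sumr t SC) sum_ffunE.
  by apply: eq_bigr => c _; rewrite (compZr t SC) scale_homE.
rewrite exchange_big; apply: eq_bigr => c _ /=.
rewrite -(compA t SC f) [X in _ = (f ∘ X ∘ e) c](basis_sum (g ∘ basis c)).
rewrite (comp_sumr t SC) (comp_suml t SC) sum_ffunE; apply: eq_bigr => d _.
by rewrite (compZr t SC) (compZl t SC) scale_homE mulrC.
Qed.

Lemma cat_traceZ k l (a : Hom k k) : cat_trace (l *: a) = l * cat_trace a.
Proof.
rewrite /cat_trace mulr_sumr; apply: eq_bigr => d _.
by rewrite !(compZl t SC) scale_homE.
Qed.

Lemma cat_trace_sum k (x : Hom k k) :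
  cat_trace x = \sum_d x d * cat_trace (basis d).
Proof.
rewrite /cat_trace.
under [RHS]eq_bigr do rewrite mulr_sumr.
rewrite exchange_big /=; apply: eq_bigr => c _.
rewrite {1}(basis_sum x) !(comp_suml t SC) sum_ffunE; apply: eq_bigr => d _.
by rewrite !(compZl t SC) scale_homE.
Qed.
End Trace.

Lemma basis_comp l m n (p : diag l m) (q : diag m n) (d : diag l n) :
  stack (val p) (val q) = val d /\ floating (val p) (val q) = 0%N ->
  basis q ∘ basis p = basis d.
Proof.
case=> E F; rewrite (comp_basis t SC) F expr0 scale1r.
by congr basis_vec; apply: val_inj.
Qed.

Lemma basis_perm_comp k (s u : {perm 'I_k}) :
  basis (permd SC u) ∘ basis (permd SC s) = basis (permd SC (s * u)%g).
Proof. exact/basis_comp/stack_perm. Qed.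

Lemma cat_trace_conj n (e : Hom n n) k (s u : {perm 'I_k}) :
  cat_trace e (basis (permd SC (s ^ u)%g)) = cat_trace e (basis (permd SC s)).
Proof.
rewrite conjgE -(basis_perm_comp u^-1%g (s * u)%g) cat_traceC.
by rewrite basis_perm_comp mulgK.
Qed.

(* Cutting a diagram at its through blocks and turning the two halves around
   yields a diagram on fewer points, unless the diagram is a permutation. *)
Lemma cat_trace_perm n k (d : diag k k) : exists (j : nat) (s : {perm 'I_j}) (l : K),
  (j <= k)%N /\ forall e : Hom n n, cat_trace e (basis d) = l * cat_trace e (basis (permd SC s)).
Proof.
have [N le_kN] := ubnP k; elim: N k le_kN d => // N IH k le_kN d.
have [le_k eq_k] := through_leq (diag_partition d).
have [ek|nk] := eqVneq #|through (val d)| k.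
  have [s dE] := eq_k ek; exists k, s, 1; split=> // e; rewrite mul1r.
  by congr (cat_trace e (basis_vec _ _)); apply: val_inj.
have {nk le_k} lt_k : (#|through (val d)| < k)%N by rewrite ltn_neqAle nk.
set j := #|through (val d)| in lt_k.
have low_ok : partition (lower_half (val d)) [set: 'I_k + 'I_j]
    && [forall B in lower_half (val d), S B].
  rewrite partition_lower_half ?diag_partition //; apply/forall_inP.
  by apply: (dc_lower SC) => B; apply: diag_blocks.
have up_ok : partition (upper_half (val d)) [set: 'I_j + 'I_k]
    && [forall B in upper_half (val d), S B].
  rewrite partition_upper_half ?diag_partition //; apply/forall_inP.
  by apply: (dc_upper SC) => B; apply: diag_blocks.
pose p : diag k j := Sub (lower_half (val d)) low_ok.
pose q : diag j k := Sub (upper_half (val d)) up_ok.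
have dE : basis d = basis q ∘ basis p.
  by symmetry; apply/basis_comp/stack_halves/diag_partition.
have [|i [s [l [ij E]]]] := IH j _ (stackd SC q p); first by apply: leq_trans lt_k _.
exists i, s, (t ^+ floating (val q) (val p) * l); split=> [|e].
  exact: leq_trans ij (ltnW lt_k).
by rewrite dE cat_traceC (comp_basis t SC) cat_traceZ E mulrA.
Qed.
End CategoricalTrace.

(** * Numbers of summands, of simple modules and of diagrams *)

Section SummandBounds.
Variables (K : numClosedFieldType) (t : K) (S : block_cond).
Hypothesis SC : diagram_class S.
Variable n : nat.
Local Notation A := (Defs.Hom K S n n).
Local Notation "g ∘ f" := (Defs.comp t g f) (at level 40, left associativity).
Local Notation mul := (fun x y : A => x ∘ y).

Let mDl : forall x y z : A, (x + y) ∘ z = x ∘ z + y ∘ z := fun x y z => compDl t SC x y z.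
Let mDr : forall x y z : A, x ∘ (y + z) = x ∘ y + x ∘ z := fun x y z => compDr t SC x y z.
Let mZl : forall a (x y : A), (a *: x) ∘ y = a *: (x ∘ y) := fun a x y => compZl t SC a x y.
Let mZr : forall a (x y : A), x ∘ (a *: y) = a *: (x ∘ y) := fun a x y => compZr t SC a x y.
Let mA : forall x y z : A, x ∘ (y ∘ z) = x ∘ y ∘ z := fun x y z => compA t SC x y z.
Let m1l : forall x : A, idm K S n ∘ x = x := fun x => comp_idl t SC x.
Let m1r : forall x : A, x ∘ idm K S n = x := fun x => comp_idr t SC x.

Hypothesis ss : semisimple_End t S n.

Variables (I : finType) (f : I -> A).
Hypothesis df : prim_decomp mul f (idm K S n).

Let pf i : primitive mul (f i). Proof. by case: df. Qed.
Let eqv (i j : I) : bool := `[< prim_equiv mul (f i) (f j) >].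
Let eqvP i j : reflect (prim_equiv mul (f i) (f j)) (eqv i j). Proof. exact: asboolP. Qed.
Let eqv_refl i : eqv i i. Proof. exact/eqvP/prim_equiv_refl. Qed.
Let eqv_sym i j : eqv i j = eqv j i.
Proof. by apply/eqvP/eqvP => h; apply: (prim_equiv_sym mDl mDr mZl mZr mA m1l m1r ss _ _ h). Qed.
Let eqv_trans i j k : eqv i j -> eqv j k -> eqv i k.
Proof.
by move=> /eqvP ij /eqvP jk; apply/eqvP;
  apply: (prim_equiv_trans mDl mDr mZl mZr mA m1l m1r ss _ _ ij jk).
Qed.

(** A canonical representative of the class of [i]: the outcome of [pick] depends only on the
    predicate [eqv i]. *)
Let root i := odflt i [pick j | eqv i j].
Let eqv_root i : eqv i (root i). Proof. by rewrite /root; case: pickP. Qed.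
Let root_eqv i j : (root i == root j) = eqv i j.
Proof.
apply/eqP/idP => [E|ij].
  by apply: eqv_trans (eqv_root i) _; rewrite E eqv_sym.
rewrite /root (eq_pick (Q := eqv j)) => [|k].
  by case: pickP => // /(_ j); rewrite eqv_refl.
by apply/idP/idP; apply: eqv_trans; rewrite // eqv_sym.
Qed.
Let roots := [set i | root i == i].

Let size_class i := #|[set j | eqv i j]|.

Lemma card_diagram_sum : #|{: diagram S n n}| = (\sum_i size_class i)%N.
Proof. exact: (card_basis mDl mDr mZl mZr mA m1l m1r ss df). Qed.

Lemma diagrams_le_square : (#|{: diagram S n n}| <= #|I| ^ 2)%N.
Proof.
rewrite card_diagram_sum; apply: leq_trans (_ : \sum_(i : I) #|I| <= _)%N.
  by apply: leq_sum => i _; apply: max_card.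
by rewrite sum_nat_const.
Qed.

Let sum_roots (F : I -> nat) : (\sum_i F (root i) = \sum_(c in roots) F c * size_class c)%N.
Proof.
have rr i : root i \in roots by rewrite inE; apply/eqP/esym/eqP; rewrite root_eqv.
rewrite (partition_big root (fun c => c \in roots)) //=.
apply: eq_bigr => c; rewrite inE => /eqP rc.
rewrite (eq_bigr (fun=> F c)) => [|i /eqP-> //]; rewrite sum_nat_const mulnC.
congr (_ * _)%N; apply: fintype.eq_card => i.
rewrite unfold_in /= inE; transitivity (root i == root c); first by rewrite rc.
by rewrite root_eqv eqv_sym.
Qed.

(** Cauchy-Schwarz for the sum of the class sizes, from 2cc' <= c^2 + c'^2 summed over all pairs of
    classes. *)
Lemma square_le_diagrams : (#|I| ^ 2 <= #|roots| * #|{: diagram S n n}|)%N.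
Proof.
have -> : #|{: diagram S n n}| = (\sum_(c in roots) size_class c * size_class c)%N.
  rewrite card_diagram_sum -sum_roots; apply: eq_bigr => i _.
  apply: fintype.eq_card => j; rewrite !inE.
  by apply/idP/idP; apply: eqv_trans; rewrite // eqv_sym.
have -> : #|I| = (\sum_(c in roots) size_class c)%N.
  rewrite -sum1_card (sum_roots (fun=> 1%N)); apply: eq_bigr => c _; exact: mul1n.
rewrite -leq_double -!mul2n -mulnn big_distrlr /= big_distrr /=.
under eq_bigr do rewrite big_distrr /=.
apply: (@leq_trans (\sum_(c in roots) \sum_(c' in roots)
    (size_class c * size_class c + size_class c' * size_class c')))%N.
  apply: leq_sum => c _; apply: leq_sum => c' _.
  by have [h _] := nat_Cauchy (size_class c) (size_class c'); rewrite !mulnn.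
under eq_bigr do rewrite big_split /= sum_nat_const.
by rewrite big_split /= sum_nat_const -big_distrr /= addnn -mul2n.
Qed.

Variables (L : finType) (label : {k : 'I_n.+1 & {perm 'I_k}} -> L).
Hypothesis labelP : forall x y, label x = label y -> exists E : tag x = tag y,
  exists u, tagged y = (cast_perm (f_equal val E) (tagged x) ^ u)%g.

(** The traces of the class representatives on each other's multiplicity spaces form an identity
    matrix. A trace is a multiple of its value at a permutation, which depends only on the label, so
    this matrix factors through [L]. *)
Lemma card_roots_le : (#|roots| <= #|L|)%N.
Proof.
pose phi k (c : 'I_#|roots|) (a : Defs.Hom K S k k) := cat_trace t (f (enum_val c)) a.
pose bp (x : {k : 'I_n.+1 & {perm 'I_k}}) := basis_vec K (permd SC (tagged x)).
have phi_label x y : label x = label y -> forall c, phi _ c (bp x) = phi _ c (bp y).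
  case: x y => [k s] [k' s'] /labelP[/= E]; subst k' => -[u].
  rewrite (eq_irrelevance (f_equal val _) erefl) cast_perm_id => -> c.
  exact: esym (cat_trace_conj t SC _ _ _).
have red (d : diagram S n n) : exists (x : {k : 'I_n.+1 & {perm 'I_k}}) (l : K),
    forall c, phi _ c (basis_vec K d) = l * phi _ c (bp x).
  have [j [s [l [jn E]]]] := cat_trace_perm t SC n d.
  exists (Tagged (fun k : 'I_n.+1 => {perm 'I_k}) (s : {perm 'I_(Ordinal (n := n.+1) jn)})), l.
  by move=> c; apply: E.
have [xd xdP] := choice red; have [ld phi_d] := choice xdP.
pose rep z := [pick x | label x == z].
(* The traces at one permutation per label; the value 0 is for labels that are not attained. *)
pose Psi := \matrix_(c < #|roots|, z < #|L|)
  (if rep (enum_val z) is Some x then phi _ c (bp x) else 0).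
pose Theta := \matrix_(z < #|L|, d < #|{: diagram S n n}|)
  (ld (enum_val d) *+ (enum_val z == label (xd (enum_val d)))).
pose E := \matrix_(d < #|{: diagram S n n}|, c < #|roots|) (f (enum_val c) (enum_val d) : K).
have PT : Psi *m Theta = \matrix_(c, d) phi _ c (basis_vec K (enum_val d)).
  apply/matrixP => c d; rewrite !mxE (bigD1 (enum_rank (label (xd (enum_val d))))) //=.
  rewrite big1 ?addr0 => [|z nz]; last first.
    rewrite !mxE; case: eqP => [Ez|]; last by rewrite mulr0n mulr0.
    by rewrite -Ez enum_valK eqxx in nz.
  rewrite !mxE enum_rankK eqxx mulr1n phi_d mulrC /rep.
  case: pickP => [x /eqP lx|/(_ (xd (enum_val d)))]; last by rewrite eqxx.
  by rewrite (phi_label _ _ lx).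
have PTE : Psi *m Theta *m E = 1%:M.
  apply/matrixP => a c; rewrite PT !mxE.
  transitivity (phi _ a (f (enum_val c))).
    rewrite /phi (cat_trace_sum t SC (f (enum_val a))).
    rewrite (reindex _ (onW_bij _ (@enum_val_bij {: diagram S n n}))) /=.
    by apply: eq_bigr => d _; rewrite !mxE mulrC.
  have -> : phi _ a (f (enum_val c)) = op_trace (sandwich mul (f (enum_val c)) (f (enum_val a))).
    by [].
  rewrite (trace_sandwich mDl mDr mZl mZr mA m1l m1r ss) //.
  congr (_ %:R); rewrite -/(eqv _ _) -root_eqv.
  have /setIdP[_ /eqP->] : enum_val c \in [set i in I | root i == i].
    by have := enum_valP c; rewrite !inE.
  have := enum_valP a; rewrite inE => /eqP->.
  by rewrite (inj_eq enum_val_inj) eq_sym.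
have : \rank (Psi *m Theta *m E) = #|roots| by rewrite PTE mxrank1.
rewrite -mulmxA => <-; apply: leq_trans (mxrankM_maxl _ _) _.
exact: rank_leq_col.
Qed.

Lemma summand_bounds :
  (#|{: diagram S n n}| <= #|I| ^ 2 <= #|L| * #|{: diagram S n n}|)%N.
Proof.
rewrite diagrams_le_square /=; apply: leq_trans square_le_diagrams _.
by rewrite leq_mul2r card_roots_le orbT.
Qed.
End SummandBounds.

(** * Cycle types *)

Section CycleType.
Variable T : finType.
Implicit Types f g : T -> T.

(** For injective [f], one point of each cycle of length [o], so that the cardinality counts these
    cycles. *)
Definition cycle_roots f o : {set T} := [set x | (froot f x == x) && (order f x == o)].

Lemma cycle_roots0 f o : (forall x, order f x <> o) -> #|cycle_roots f o| = 0%N.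
Proof.
move=> no; apply/eqP; rewrite cards_eq0; apply/eqP/setP => x; rewrite !inE.
by apply/negP => /andP[_ /eqP]; apply: no.
Qed.

Lemma order_froot f x : injective f -> order f (froot f x) = order f x.
Proof.
move=> fi; rewrite /order; apply: fintype.eq_card => y; rewrite !inE.
by rewrite (same_connect (fconnect_sym fi) (connect_root _ x)).
Qed.

Lemma froot_cycle_roots f x : injective f -> froot f x \in cycle_roots f (order f x).
Proof.
by move=> fi; rewrite inE order_froot // eqxx andbT; apply: (roots_root (fconnect_sym fi)).
Qed.

Lemma froot_iter f i x : injective f -> froot f (iter i f x) = froot f x.
Proof. by move=> fi; apply/eqP; rewrite (root_connect (fconnect_sym fi)) fconnect_sym // fconnect_iter. Qed.

(* Two permutations with as many cycles of each length are conjugate: match the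
   cycles of equal length, and each cycle step by step from its root. *)
Lemma cycle_roots_conj f g : injective f -> injective g ->
  (forall o, #|cycle_roots f o| = #|cycle_roots g o|) ->
  exists2 h : T -> T, injective h & forall x, h (f x) = g (h x).
Proof.
move=> fi gi fg.
(* The roots of the cycles of length [o] are matched by their positions in the two enumerations,
   which have equal length. *)
pose rho o r := nth r (enum (cycle_roots g o)) (index r (enum (cycle_roots f o))).
have rhoP o r : r \in cycle_roots f o -> rho o r \in cycle_roots g o.
  by move=> rf; rewrite -mem_enum mem_nth // -cardE -fg cardE index_mem mem_enum.
have rho_inj o : {in cycle_roots f o &, injective (rho o)}.
  move=> r r' rf rf'; rewrite /rho (set_nth_default r) => [E|]; last first.
    by rewrite -cardE -fg cardE index_mem mem_enum.
  have := nth_uniq r _ _ (enum_uniq (cycle_roots g o)); rewrite -!cardE -fg !cardE.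
  move=> /(_ (index r (enum (cycle_roots f o))) (index r' (enum (cycle_roots f o)))).
  rewrite !index_mem !mem_enum => /(_ rf rf'); rewrite E eqxx => /esym/eqP ii.
  by rewrite -[r](nth_index r (s := enum (cycle_roots f o))) ?mem_enum // ii nth_index ?mem_enum.
pose h x := iter (findex f (froot f x) x) g (rho (order f x) (froot f x)).
have ro x := froot_cycle_roots x fi.
have ox x : order g (rho (order f x) (froot f x)) = order f x.
  by have := rhoP _ _ (ro x); rewrite inE => /andP[_ /eqP].
have rx x : froot g (rho (order f x) (froot f x)) = rho (order f x) (froot f x).
  by have := rhoP _ _ (ro x); rewrite inE => /andP[/eqP].
have con x : fconnect f (froot f x) x by rewrite fconnect_sym // connect_root.
have lt x : (findex f (froot f x) x < order f x)%N.
  by rewrite -(order_froot x fi) findex_max.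
exists h => [x y|x].
  move=> hxy; have := f_equal (froot g) hxy; rewrite /h !froot_iter // !rx => rr.
  have oxy : order f x = order f y by rewrite -(ox x) rr ox.
  have froots_eq : froot f x = froot f y.
    by apply: (rho_inj (order f x)); rewrite ?rr oxy // -oxy.
  move: hxy; rewrite /h rr => E.
  have : findex f (froot f x) x = findex f (froot f y) y.
    rewrite -(@findex_iter _ g (rho (order f y) (froot f y)) (findex f (froot f x) x)).
      by rewrite E findex_iter // ox.
    by rewrite ox -oxy.
  by move=> kk; rewrite -[RHS](iter_findex (con y)) -[LHS](iter_findex (con x)) kk froots_eq.
have fx : froot f (f x) = froot f x by apply: (froot_iter 1).
have ofx : order f (f x) = order f x by rewrite -order_froot // fx order_froot.
rewrite /h fx ofx; set r := froot f x; set k := findex f r x.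
have xE : iter k f r = x := iter_findex (con x).
(* At the last point of a cycle both sides return to the matched root. *)
have := lt x; rewrite -/r -/k leq_eqVlt => /predU1P[kE|klt].
  have -> : f x = r by rewrite -xE -iterS kE -(order_froot x fi) iter_order.
  rewrite findex0 /= -iterS kE.
  by have := iter_order gi (rho (order f x) r); rewrite ox => ->.
by rewrite -{1}xE -iterS findex_iter // order_froot.
Qed.

Lemma sum_cycle_roots f N : injective f -> (#|T| <= N)%N ->
  (\sum_(i < N) i.+1 * #|cycle_roots f i.+1| = #|T|)%N.
Proof.
move=> fi TN.
have ord_lt x : ((order f x).-1 < N)%N.
  by rewrite orderSpred; apply: leq_trans (max_card _) TN.
rewrite -sum1_card (partition_big (fun x => Ordinal (ord_lt x)) xpredT) //=.
apply: eq_bigr => i _.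
transitivity #|order_set f i.+1|; last first.
  rewrite -sum1_card; apply: eq_bigl => x; rewrite !inE.
  by rewrite -val_eqE /= -[in LHS](orderSpred f x) eqSS.
have cl : fclosed f (order_set f i.+1).
  move=> x y /eqP <-; rewrite !inE.
  by rewrite -(order_froot x fi) -(froot_iter 1 x fi) order_froot.
rewrite -(fcard_order_set fi (subxx _) cl) mulnC.
by congr (_ * _)%N; apply: fintype.eq_card => x; rewrite !inE.
Qed.
End CycleType.

(** Entry [i] is for cycles of length [i.+1]. If [k <= n], the counts are at most [n] and [inord]
    leaves them unchanged. *)
Definition cycle_type n k (s : {perm 'I_k}) : {ffun 'I_n -> 'I_n.+1} :=
  [ffun i : 'I_n => inord #|cycle_roots s i.+1|].

(** The partitions of the integers at most [n], with [m i] parts equal to [i.+1]. *)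
Definition cycle_types n :=
  [set m : {ffun 'I_n -> 'I_n.+1} | (\sum_(i < n) i.+1 * m i <= n)%N].

Lemma cycle_typeE n k (s : {perm 'I_k}) (i : 'I_n) : (k <= n)%N ->
  cycle_type n s i = #|cycle_roots s i.+1| :> nat.
Proof.
move=> kn; rewrite ffunE inordK // ltnS; apply: leq_trans kn.
by rewrite -[X in (_ <= X)%N](card_ord k); apply: max_card.
Qed.

Lemma cycle_type_sum n k (s : {perm 'I_k}) : (k <= n)%N ->
  (\sum_(i < n) i.+1 * cycle_type n s i = k)%N.
Proof.
move=> kn; under eq_bigr do rewrite cycle_typeE //.
by rewrite sum_cycle_roots ?card_ord //; apply: perm_inj.
Qed.

Lemma cycle_type_conj n k (s s' : {perm 'I_k}) : (k <= n)%N ->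
  cycle_type n s = cycle_type n s' -> exists u, s' = (s ^ u)%g.
Proof.
move=> kn E.
have [||o|h hi hs] := @cycle_roots_conj _ s s'; try exact: perm_inj.
  have big (u : {perm 'I_k}) : (o == 0) || (n < o)%N -> #|cycle_roots u o| = 0%N.
    move=> no; apply: cycle_roots0 => x oE; have := order_gt0 u x.
    have : (order u x <= #|'I_k|)%N by apply: max_card.
    by rewrite oE card_ord; lia.
  case: (boolP ((o == 0) || (n < o)%N)) => [no|]; first by rewrite (big s no) (big s' no).
  case: o {big} => [|o]; first by rewrite eqxx.
  rewrite /= -leqNgt => on.
  have := cycle_typeE s (Ordinal on) kn; have := cycle_typeE s' (Ordinal on) kn.
  by rewrite E => ->.
exists (perm hi); apply/permP => x; rewrite -[x](permKV (perm hi)) permJ !permE.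
by rewrite hs.
Qed.

Lemma cycle_type_label n : exists label : {k : 'I_n.+1 & {perm 'I_k}} -> {m | m \in cycle_types n},
  forall x y, label x = label y -> exists E : tag x = tag y,
    exists u, tagged y = (cast_perm (f_equal val E) (tagged x) ^ u)%g.
Proof.
have ok (x : {k : 'I_n.+1 & {perm 'I_k}}) : cycle_type n (tagged x) \in cycle_types n.
  by case: x => k s; rewrite inE cycle_type_sum /= -ltnS.
exists (fun x => exist (fun m => m \in cycle_types n) _ (ok x)) => -[k s] [k' s'] /(f_equal val) /= E.
(* The cycle type determines the degree, as the sum of the cycle lengths. *)
have kE : k = k'.
  apply: val_inj; rewrite /= -(@cycle_type_sum n k s); last by rewrite -ltnS.
  by rewrite E cycle_type_sum // -ltnS.
subst k'; exists erefl; have [|u ->] := cycle_type_conj _ E; first by rewrite -ltnS.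
by exists u; rewrite (eq_irrelevance (f_equal val _) erefl) cast_perm_id.
Qed.

(** * The number of summands and the number of diagrams *)

Theorem summand_number_bounds (K : numClosedFieldType) (t : K) (S : block_cond) :
  diagram_class S -> generic t S ->
  exists b : nat -> nat, summand_numbers t S b /\
    forall n, (#|{: diagram S n n}| <= b n ^ 2 <= #|cycle_types n| * #|{: diagram S n n}|)%N.
Proof.
move=> SC gen.
suff h n : exists k : nat, (forall j, has_decomposition t S n j <-> j = k) /\
    (#|{: diagram S n n}| <= k ^ 2 <= #|cycle_types n| * #|{: diagram S n n}|)%N.
  have [b bP] := choice h; exists b; split=> [n k|n].
    exact: (bP n).1.
  exact: (bP n).2.
pose A := Defs.Hom K S n n; pose mul (x y : A) : A := Defs.comp t x y.
have mDl : forall x y z : A, mul (x + y) z = mul x z + mul y z by exact: (compDl t SC).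
have mDr : forall x y z : A, mul x (y + z) = mul x y + mul x z by exact: (compDr t SC).
have mZl : forall a (x y : A), mul (a *: x) y = a *: mul x y by exact: (compZl t SC).
have mZr : forall a (x y : A), mul x (a *: y) = a *: mul x y by exact: (compZr t SC).
have mA : forall x y z : A, mul x (mul y z) = mul (mul x y) z by exact: (compA t SC).
have m1l : forall x : A, mul (idm K S n) x = x by exact: (comp_idl t SC).
have m1r : forall x : A, mul x (idm K S n) = x by exact: (comp_idr t SC).
have [I [f df]] := idem_decomp mDl mDr mZl mZr mA m1l (m1l (idm K S n)).
have dec : has_decomposition t S n #|I|.
  apply/(has_decompositionP t SC); exists (fun i : 'I_#|I| => f (enum_val i)).
  have [pf of_ sf] := df; split=> // [i j ij|].
    by apply: of_; rewrite (inj_eq enum_val_inj).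
  by rewrite -sf (reindex _ (onW_bij _ (@enum_val_bij I))).
exists #|I|; split=> [j|]; last first.
  have [label labelP] := cycle_type_label n.
  have -> : #|cycle_types n| = #|{: {m | m \in cycle_types n}}|.
    by rewrite card_sig; apply: fintype.eq_card => m; rewrite !inE.
  have h := summand_bounds SC (gen n) df labelP; exact: h.
split=> [/(has_decompositionP t SC)[g dg]|-> //].
rewrite -(card_ord j).
exact: (decomp_card_unique mDl mDr mZl mZr mA m1l m1r (gen n) dg df).
Qed.

(** * Counting diagrams *)

Section CountPartitions.
Variables (T : finType) (s : pred {set T}).
Implicit Types (A B : {set T}) (P : {set {set T}}).

Definition npart A := #|[set P | partition P A && [forall B in P, s B]]|.

Lemma npart0 : npart set0 = 1%N.
Proof.
rewrite -(cards1 (set0 : {set {set T}})); apply: fintype.eq_card => P.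
rewrite !inE partition_set0; apply: andb_idr => /eqP->.
by apply/forall_inP => B; rewrite inE.
Qed.

Lemma npart_rec A x : x \in A ->
  npart A = (\sum_(B : {set T} | [&& B \subset A, x \in B & s B]) npart (A :\: B))%N.
Proof.
move=> xA; rewrite /npart -sum1_card.
rewrite (partition_big (fun P : {set {set T}} => pblock P x) (fun B : {set T} => [&& B \subset A, x \in B & s B])) /=; last first.
  move=> P; rewrite inE => /andP[/and3P[/eqP cP tP n0] /forall_inP sP].
  have xP : pblock P x \in P by rewrite pblock_mem ?cP.
  have sub : pblock P x \subset A by rewrite -cP /cover; apply: (bigcup_max (pblock P x)).
  by rewrite sub sP // mem_pblock cP xA.
apply: eq_bigr => B /and3P[BA xB sB].
have nB : B != set0 by apply/set0Pn; exists x.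
rewrite sum1_card -[RHS](card_in_imset (f := fun P : {set {set T}} => B |: P)); last first.
  have notin P : P \in [set P | partition P (A :\: B) && [forall B in P, s B]] -> B \notin P.
    rewrite inE => /andP[/and3P[/eqP cP _ _] _]; apply/negP => BP.
    have : x \in A :\: B by rewrite -cP; apply/bigcupP; exists B.
    by rewrite inE xB.
  move=> P Q /notin BP /notin BQ E.
  by rewrite -[P](setU1K BP) E setU1K.
apply: fintype.eq_card => P; rewrite unfold_in /= inE; apply/idP/imsetP => [|[Q]].
  move=> /andP[/andP[pP /forall_inP sP] /eqP xP].
  have BP : B \in P by rewrite -xP pblock_mem //; case/and3P: pP => /eqP->.
  exists (P :\ B); last by rewrite setD1K.
  rewrite inE partitionD1 //=; apply/forall_inP => C; rewrite inE => /andP[_]; exact: sP.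
rewrite inE => /andP[pQ /forall_inP sQ] ->.
have pBQ : partition (B |: Q) A.
  have -> : A = B :|: (A :\: B) by rewrite -[LHS](setID A B) (setIidPr BA).
  apply: partitionU1 => //; apply/pred0P => y /=; rewrite !inE.
  by case: (y \in B).
rewrite pBQ /=; apply/andP; split.
  by apply/forall_inP => C /[!inE] /predU1P[->//|]; apply: sQ.
by apply/eqP/def_pblock => //; [case/and3P: pBQ | rewrite setU11].
Qed.

(** The term [y = x] stands for the singleton block of [x]. *)
Lemma npart_pairs A x : (forall B, s B -> (#|B| <= 2)%N) -> x \in A ->
  npart A = (\sum_(y in A | s [set x; y]) npart (A :\: [set x; y]))%N.
Proof.
move=> s2 xA; rewrite (npart_rec xA).
rewrite -(big_imset (h := fun y => [set x; y]) (A := [pred y in A | s [set x; y]]) (fun B => npart (A :\: B))) /=.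
  apply: eq_bigl => B; apply/idP/imsetP => [/and3P[BA xB sB]|[y]].
    have [y yE] : exists y, B = [set x; y].
      have := s2 _ sB; rewrite (cardsD1 x) xB add1n ltnS => c1.
      have [B0|/set0Pn[y yB]] := eqVneq (B :\ x) set0.
        by exists x; rewrite -(setD1K xB) B0 setU0 setUid.
      exists y; rewrite -(setD1K xB); congr (_ :|: _).
      by apply/eqP; rewrite eq_sym eqEcard sub1set yB cards1.
    exists y => //; rewrite inE -yE sB andbT.
    by apply: (fintype.subsetP BA); rewrite yE !inE eqxx orbT.
  rewrite inE => /andP[yA sB] ->; rewrite sB subUset !sub1set xA yA.
  by rewrite !inE eqxx.
move=> y z _ _ /setP E.
have : (y == x) || (y == z) by have := E y; rewrite !inE eqxx orbT => <-.
have : (z == x) || (z == y) by have := E z; rewrite !inE eqxx orbT => ->.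
by case/orP=> /eqP yE /orP[]/eqP zE; congruence.
Qed.
End CountPartitions.

Lemma card_diagram (S : block_cond) n : #|{: diagram S n n}| = npart (@S n n) [set: 'I_n + 'I_n].
Proof. by rewrite card_sig; apply: fintype.eq_card => P; rewrite !inE. Qed.

Lemma npart_mono (T : finType) (s s' : pred {set T}) A :
  (forall B, s B -> s' B) -> (npart s A <= npart s' A)%N.
Proof.
move=> ss'; apply: subset_leq_card; apply/fintype.subsetP => P; rewrite !inE.
by case/andP=> -> /forall_inP sP; apply/forall_inP => B /sP/ss'.
Qed.

(** Fix a set [C] of [k] points and let each remaining point join one of them. Every block of the
    resulting partition contains exactly one point of [C], from which the choices are recovered. *)
Lemma npart_any_ge (T : finType) (k : nat) : (k <= #|T|)%N ->
  (k ^ (#|T| - k) <= npart (fun _ : {set T} => true) [set: T])%N.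
Proof.
move=> kT; have [C CE] : exists C : {set T}, #|C| = k.
  exists [set x in take k (enum T)]; rewrite cardsE (card_uniqP _) ?size_takel //.
    by rewrite -cardE.
  exact/take_uniq/enum_uniq.
pose G := {ffun {x | x \in ~: C} -> {x | x \in C}}.
have <- : #|{: G}| = (k ^ (#|T| - k))%N.
  rewrite card_ffun !card_sig.
  congr (_ ^ _)%N.
    by rewrite -CE; apply: fintype.eq_card => x; rewrite !inE.
  by rewrite -CE -(cardsC C) addKn; apply: fintype.eq_card => x; rewrite !inE.
pose ext (g : G) x := if insub x is Some z then val (g z) else x.
have extC g x : x \in C -> ext g x = x.
  by move=> xC; rewrite /ext insubF //= inE xC.
have ext_in g x : ext g x \in C.
  rewrite /ext; case: insubP => [z _ _|]; first exact: valP.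
  by rewrite inE negbK.
have eqv g : {in [set: T] & &, equivalence_rel [rel x y | ext g x == ext g y]}.
  by move=> x y z _ _ _ /=; split=> // /eqP->.
rewrite -cardsT -(card_in_imset (f := fun g => preim_partition (ext g) [set: T])) => [|g g' _ _ E].
  apply: subset_leq_card; apply/fintype.subsetP => _ /imsetP[g _ ->].
  by rewrite inE preim_partitionP; apply/forall_inP.
apply/ffunP => z; apply: val_inj; set x := val z; set c := ext g x.
have zE (h : G) : val (h z) = ext h x by rewrite /ext valK.
have : x \in pblock (preim_partition (ext g) [set: T]) c.
  by rewrite (pblock_equivalence_partition (eqv g)) ?inE //= extC ?ext_in // eqxx.
rewrite E (pblock_equivalence_partition (eqv g')) ?inE //= extC ?ext_in // => /eqP.
by rewrite !zE.
Qed.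

(** A partition into [k] blocks together with a numbering of them determines a surjection of [T]
    onto [k] labels, and can be recovered from it. *)
Lemma npart_any_le (T : finType) k (s : pred {set T}) :
  (#|[set P in [set P | partition P [set: T] && [forall B in P, s B]] | #|P| == k]|
     * k`! <= k ^ #|T|)%N.
Proof.
set X := [set P in _ | _].
have XP P : P \in X -> partition P [set: T] /\ #|P| = k.
  by rewrite !inE => /andP[/andP[? _] /eqP].
case: k @X XP => [|k] X XP.
  rewrite muln1; have [T0|T0] := posnP #|T|.
    rewrite T0 expn0 -(cards1 (set0 : {set {set T}})); apply: subset_leq_card.
    apply/fintype.subsetP => P /XP[_ /eqP]; by rewrite cards_eq0 inE.
  rewrite exp0n // leqn0 cards_eq0; apply/eqP/setP => P; rewrite [RHS]inE.
  apply/negP => /XP[/and3P[/eqP cP _ _] /eqP]; rewrite cards_eq0 => /eqP P0.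
  by move: cP T0; rewrite P0 /cover big_set0 -cardsT => <-; rewrite cards0.
pose lab (P : {set {set T}}) x : 'I_k.+1 := inord (index (pblock P x) (enum P)).
have pbP P x : P \in X -> pblock P x \in P.
  by move=> /XP[/and3P[/eqP cP _ _] _]; rewrite pblock_mem // cP.
have ix P x : P \in X -> (index (pblock P x) (enum P) < k.+1)%N.
  by move=> PX; rewrite -(XP _ PX).2 cardE index_mem mem_enum pbP.
have labE P x y : P \in X -> (lab P x == lab P y) = (y \in pblock P x).
  move=> PX; have [pP _] := XP _ PX; have /and3P[/eqP cP tP _] := pP.
  rewrite -eq_pblock ?cP //; apply/eqP/eqP => [/(f_equal val)|]; last by rewrite /lab => ->.
  rewrite /= !inordK ?ix // => E.
  by rewrite -(nth_index set0 (s := enum P) (x := pblock P x)) ?mem_enum ?pbP // E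
    nth_index // mem_enum pbP.
have lab_onto P i : P \in X -> exists x, lab P x = i.
  move=> PX; have [/and3P[/eqP cP tP n0] cardP] := XP _ PX.
  have iP : (i < size (enum P))%N by rewrite -cardE cardP.
  have BP : nth set0 (enum P) i \in P by rewrite -mem_enum mem_nth.
  have /set0Pn[x xB] : nth set0 (enum P) i != set0 by apply: contraNneq n0 => <-.
  exists x; apply: val_inj; rewrite /lab (def_pblock tP BP xB) /= inordK.
    by rewrite index_uniq ?enum_uniq.
  by rewrite index_uniq ?enum_uniq.
have <- : #|{: {perm 'I_k.+1}}| = (k.+1)`! by rewrite card_Sn.
rewrite -[X in (_ <= X ^ _)%N]card_ord -card_ffun -[#|{: {perm _}}|]cardsT -cardsX.
pose F (u : {set {set T}} * {perm 'I_k.+1}) := [ffun x => u.2 (lab u.1 x)].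
rewrite -(card_in_imset (f := F)); first exact: max_card.
move=> [P s1] [Q s2]; rewrite !inE /= !andbT => PX QX /ffunP E.
have {}E x : s1 (lab P x) = s2 (lab Q x) by have := E x; rewrite !ffunE.
have PX' : P \in X by rewrite !inE.
have QX' : Q \in X by rewrite !inE.
have PQ : P = Q.
  have [pP _] := XP _ PX'; have [pQ _] := XP _ QX'.
  rewrite -(equivalence_partition_pblock pP) -(equivalence_partition_pblock pQ).
  rewrite /equivalence_partition; apply: eq_imset => x; apply/setP => y; rewrite !inE /=.
  by rewrite -!labE // -(inj_eq (@perm_inj _ s1)) !E (inj_eq perm_inj).
subst Q; congr (_, _); apply/permP => i.
by have [x <-] := lab_onto P i PX'.
Qed.

Lemma npart_perfect_matching (T : finType) m (A : {set T}) : #|A| = m.*2 ->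
  npart (fun B => #|B| == 2) A = (\prod_(i < m) i.*2.+1)%N.
Proof.
elim: m A => [|m IH] A cA.
  by rewrite big_ord0; move/eqP: cA; rewrite cards_eq0 => /eqP->; apply: npart0.
have [x xA] : exists x, x \in A by apply/card_gt0P; rewrite cA.
rewrite (npart_pairs _ xA) => [|B /eqP-> //].
rewrite (eq_bigr (fun=> \prod_(i < m) i.*2.+1)%N) => [|y /andP[yA]]; last first.
  rewrite cards2 eqSS eqb1 => xy; apply: IH.
  have sub : [set x; y] \subset A by rewrite subUset !sub1set xA.
  by rewrite cardsD cA (setIidPr sub) cards2 xy doubleS subn2.
rewrite big_ord_recr /= sum_nat_const mulnC; congr (_ * _)%N.
transitivity #|A :\ x|; last by have := cardsD1 x A; rewrite xA cA; lia.
apply: fintype.eq_card => y; rewrite !inE unfold_in /= cards2 eqSS eqb1 eq_sym.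
by rewrite andbC.
Qed.

Lemma factorial_le_diagrams (S : block_cond) n : diagram_class S ->
  (n`! <= npart (@S n n) [set: 'I_n + 'I_n])%N.
Proof.
move=> SC; rewrite -card_Sn -(card_imset _ (f := @perm_blocks n)).
  apply: subset_leq_card; apply/fintype.subsetP => _ /imsetP[u _ ->].
  by rewrite inE partition_perm_blocks; apply/forall_inP => B; apply: (dc_perm SC).
move=> u v E; apply/permP => i.
have : [set inl i; inr (u i)] \in perm_blocks v by rewrite -E; apply/imsetP; exists i.
case/imsetP => j _ /setP uv; have := uv (inl i); have := uv (inr (u i)).
rewrite !inE !eqxx orbT /= => /esym/eqP[->] /esym.
by rewrite orbF => /eqP[->].
Qed.

(** * Upper bounds for numbers of partial matchings *)

Section PairingBound.
Variable R : realType.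
Implicit Type c : nat -> nat.

(** A product majorant for the recursion a(m + 2) = a(m + 1) + c(m + 1) a(m), where a point is
    removed alone or with one of c(m + 1) partners. *)
Definition pairing_bound c m : R := \prod_(i < m) (1 + Num.sqrt (c i)%:R).

Lemma pairing_bound_gt0 c m : 0 < pairing_bound c m.
Proof. by apply: prodr_gt0 => i _; rewrite ltr_wpDr ?sqrtr_ge0. Qed.

(** After division by common factors the claim is sqrt(c(m + 1)) <= 1 + sqrt(c(m)), which holds
    because [c] grows by at most 1. *)
Lemma pairing_bound_step c m : (c m.+1 <= (c m).+1)%N ->
  pairing_bound c m.+1 + (c m.+1)%:R * pairing_bound c m <= pairing_bound c m.+2.
Proof.
move=> cS; rewrite [leRHS]/pairing_bound big_ord_recr /= -/(pairing_bound c m.+1).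
rewrite mulrDr mulr1 lerD2l.
rewrite -{1}[(c m.+1)%:R](sqr_sqrtr (ler0n R _)) expr2 -mulrA mulrC.
rewrite ler_wpM2r ?sqrtr_ge0 // /pairing_bound big_ord_recr /= mulrC.
apply: (ler_wpM2l (ltW (pairing_bound_gt0 _ _))).
rewrite -ler_sqr ?nnegrE ?addr_ge0 ?sqrtr_ge0 //.
rewrite sqrrD expr1n !sqr_sqrtr ?ler0n // mul1r.
apply: (@le_trans _ _ (c m).+1%:R); first by rewrite ler_nat.
by rewrite -natr1 [leLHS]addrC lerD2r lerDl mulrn_wge0 ?sqrtr_ge0.
Qed.

(* In each step a point [x] is removed from the set, alone or with a partner;
   [c] bounds the number of possible partners. *)
Lemma npart_le_pairing (T : finType) (s : pred {set T}) (G : nat -> {set T} -> Prop) c :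
  (forall B, s B -> (#|B| <= 2)%N) ->
  (forall A, G 0%N A -> A = set0) -> c 0%N = 0%N -> (forall m, (c m.+1 <= (c m).+1)%N) ->
  (forall m A, G m.+1 A -> exists x, [/\ x \in A, G m (A :\ x),
     (#|[set y in A | (y != x) && s [set x; y]]| <= c m)%N &
     forall y, y \in A -> y != x -> s [set x; y] -> G m.-1 (A :\: [set x; y])]) ->
  forall m A, G m A -> (npart s A)%:R <= pairing_bound c m.
Proof.
move=> s2 G0 c0 cS GS m; have [N] := ubnP m; elim: N m => // N IH m /ltnSE mN A GA.
case: m mN GA => [|m] mN GA; first by rewrite (G0 _ GA) npart0 /pairing_bound big_ord0.
have [x [xA G1 cy G2]] := GS _ _ GA.
set Y := [set y in A | (y != x) && s [set x; y]] in cy.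
have le_sum : (npart s A <= npart s (A :\ x) + \sum_(y in Y) npart s (A :\: [set x; y]))%N.
  rewrite (npart_pairs s2 xA) (bigID (pred1 x)) /= leq_add //.
    rewrite big_mkcond (bigD1 x) //= big1 => [|y /negPf yx]; last first.
      by rewrite yx andbF.
    by rewrite addn0 setUid; case: ifP.
  by rewrite leq_eqVlt; apply/orP; left; apply/eqP/eq_bigl => y; rewrite !inE -andbA [s _ && _]andbC.
apply: (@le_trans _ _ (npart s (A :\ x) + \sum_(y in Y) npart s (A :\: [set x; y]))%:R).
  by rewrite ler_nat.
rewrite natrD; case: m mN GA G1 cy G2 => [|m] mN GA G1 cy G2.
  rewrite big_pred0 => [|y]; last first.
    by move: cy; rewrite c0 leqn0 cards_eq0 => /eqP->; rewrite inE.
  by rewrite addr0; apply: (le_trans (IH 0%N _ _ G1)) => //;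
    rewrite /pairing_bound big_ord0 big_ord_recr big_ord0 /= c0 sqrtr0 addr0 mulr1.
apply: le_trans (pairing_bound_step (cS m)); rewrite lerD //; first exact: IH.
rewrite natr_sum; apply: (@le_trans _ _ (\sum_(y in Y) pairing_bound c m)).
  apply: ler_sum => y; rewrite inE => /and3P[yA yx sy].
  by apply: IH; [exact: ltnW | exact: G2].
rewrite sumr_const -[leLHS]mulr_natl; apply: ler_wpM2r; last by rewrite ler_nat.
exact/ltW/pairing_bound_gt0.
Qed.

Lemma npart_rook_brauer_le (T : finType) (s : pred {set T}) A :
  (forall B, s B -> (#|B| <= 2)%N) -> (npart s A)%:R <= pairing_bound id #|A|.
Proof.
move=> s2; apply: (@npart_le_pairing T s (fun m A => #|A| = m)) => // [B /eqP|m B cB].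
  by rewrite cards_eq0 => /eqP.
have [x xB] : exists x, x \in B by apply/card_gt0P; rewrite cB.
have cBx : #|B :\ x| = m by have := cardsD1 x B; rewrite xB cB; lia.
exists x; split=> //.
  rewrite -[X in (_ <= X)%N]cBx; apply: subset_leq_card; apply/fintype.subsetP => y.
  by rewrite !inE => /and3P[-> ->].
move=> y yB yx _; have sub : [set x; y] \subset B by rewrite subUset !sub1set xB.
by rewrite cardsD cB (setIidPr sub) cards2 eq_sym yx subn2.
Qed.

(** Removing each time a point of a larger side keeps the two sides balanced up to one point. Its
    partners lie on the other side, so among [m.+1] points there are at most [uphalf m] of them. *)
Lemma npart_rook_le n :
  (npart (@rook_block n n) [set: 'I_n + 'I_n])%:R <= pairing_bound uphalf n.*2.
Proof.
pose G m (A : {set 'I_n + 'I_n}) := [/\ (#|bottoms A| + #|tops A| = m)%N,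
  (#|bottoms A| <= #|tops A|.+1)%N & (#|tops A| <= #|bottoms A|.+1)%N].
apply: (@npart_le_pairing _ _ G) => //.
- by move=> B /andP[/andP[/orP[]/eqP-> _] _].
- by move=> A [bt _ _]; apply/eqP; rewrite -cards_eq0 card_bottoms_tops bt.
- by move=> m; rewrite uphalf_half; lia.
- move=> m A [bt b1 t1]; have [le|lt] := leqP #|tops A| #|bottoms A|.
    have [i iA] : exists i, i \in bottoms A by apply/card_gt0P; lia.
    rewrite inE in iA; exists (inl i).
    have bD (C : {set 'I_n + 'I_n}) : (forall k, (inl k \in C) = (k == i)) ->
        #|bottoms (A :\: C)| = #|bottoms A|.-1.
      move=> hC; rewrite (cardsD1 i (bottoms A)) inE iA /=; apply: fintype.eq_card => k.
      by rewrite !inE hC.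
    have only_top (y : 'I_n + 'I_n) : y != inl i -> rook_block [set inl i; y] -> exists k, y = inr k.
      case: y => [k|k] yx; last by exists k.
      case/andP=> /andP[_ /card_le1_eqP h] _; case/eqP: yx; congr inl.
      by apply: h; rewrite !inE ?eqxx ?orbT.
    split=> //.
    + have bE : #|bottoms (A :\ inl i)| = #|bottoms A|.-1 by apply: bD => k; rewrite inE.
      have tE : tops (A :\ inl i) = tops A by apply/setP => k; rewrite !inE.
      by split; rewrite bE tE; lia.
    + apply: (@leq_trans #|tops A|); last by rewrite uphalf_half; lia.
      have inj : injective (inr : 'I_n -> 'I_n + 'I_n) by move=> ? ? [].
      rewrite -(card_imset _ inj).
      apply: subset_leq_card; apply/fintype.subsetP => y; rewrite inE => /and3P[yA yx sy].
      have [k yk] := only_top _ yx sy; subst y; apply/imsetP; exists k => //.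
      by rewrite inE.
    + move=> y yA yx sy; have [k yk] := only_top _ yx sy; subst y.
      have tD : #|tops (A :\: [set inl i; inr k])| = #|tops A|.-1.
        rewrite (cardsD1 k (tops A)) inE yA /=; apply: fintype.eq_card => j.
        by rewrite !inE.
      have tA : (0 < #|tops A|)%N by apply/card_gt0P; exists k; rewrite inE.
      have bE : #|bottoms (A :\: [set inl i; inr k])| = #|bottoms A|.-1.
        by apply: bD => j; rewrite !inE orbF.
      by split; rewrite tD bE; lia.
  have [i iA] : exists i, i \in tops A by apply/card_gt0P; lia.
  rewrite inE in iA; exists (inr i).
  have tD (C : {set 'I_n + 'I_n}) : (forall k, (inr k \in C) = (k == i)) ->
      #|tops (A :\: C)| = #|tops A|.-1.
    move=> hC; rewrite (cardsD1 i (tops A)) inE iA /=; apply: fintype.eq_card => k.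
    by rewrite !inE hC.
  have only_bottom (y : 'I_n + 'I_n) : y != inr i -> rook_block [set inr i; y] -> exists k, y = inl k.
    case: y => [k|k] yx; first by exists k.
    case/andP=> _ /card_le1_eqP h; case/eqP: yx; congr inr.
    by apply: h; rewrite !inE ?eqxx ?orbT.
  split=> //.
  + have tE : #|tops (A :\ inr i)| = #|tops A|.-1 by apply: tD => k; rewrite inE.
    have bE : bottoms (A :\ inr i) = bottoms A by apply/setP => k; rewrite !inE.
    by split; rewrite bE tE; lia.
  + apply: (@leq_trans #|bottoms A|); last by rewrite uphalf_half; lia.
    have inj : injective (inl : 'I_n -> 'I_n + 'I_n) by move=> ? ? [].
      rewrite -(card_imset _ inj).
    apply: subset_leq_card; apply/fintype.subsetP => y; rewrite inE => /and3P[yA yx sy].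
    have [k yk] := only_bottom _ yx sy; subst y; apply/imsetP; exists k => //.
    by rewrite inE.
  + move=> y yA yx sy; have [k yk] := only_bottom _ yx sy; subst y.
    have bD : #|bottoms (A :\: [set inr i; inl k])| = #|bottoms A|.-1.
      rewrite (cardsD1 k (bottoms A)) inE yA /=; apply: fintype.eq_card => j.
      by rewrite !inE.
    have bA : (0 < #|bottoms A|)%N by apply/card_gt0P; exists k; rewrite inE.
    have tE : #|tops (A :\: [set inr i; inl k])| = #|tops A|.-1.
      by apply: tD => j; rewrite !inE orbF.
    by split; rewrite bD tE; lia.
- rewrite /G; have -> : bottoms [set: 'I_n + 'I_n] = [set: 'I_n] by apply/setP => i; rewrite !inE.
  have -> : tops [set: 'I_n + 'I_n] = [set: 'I_n] by apply/setP => i; rewrite !inE.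
  by rewrite !cardsT !card_ord addnn.
Qed.
End PairingBound.

Section CycleTypeCount.
Variable R : realType.

Lemma geometric_sum_le (y : R) n : 0 <= y -> y < 1 -> \sum_(j < n) y ^+ j <= (1 - y)^-1.
Proof.
move=> y0 y1; have d0 : 0 < 1 - y by rewrite subr_gt0.
rewrite -(ler_pM2l d0) mulfV ?gt_eqF // -opprB mulNr -subrX1 opprB.
by rewrite gerBl exprn_ge0.
Qed.

(* The generating function of partitions, prod_i 1 / (1 - x ^ i), is finite for x < 1. *)
Lemma cycle_types_le (x : R) n : 0 < x -> x < 1 ->
  #|cycle_types n|%:R * x ^+ n <= expR ((1 - x)^-1 * (1 - x)^-1).
Proof.
move=> x0 x1; have d0 : 0 < 1 - x by rewrite subr_gt0.
apply: (@le_trans _ _ (\prod_(i < n) \sum_(j < n.+1) (x ^+ i.+1) ^+ j)).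
  (* In the expanded product, a vector of [cycle_types n] contributes a power of [x] with exponent
     at most [n], hence at least [x ^+ n]. *)
  rewrite bigA_distr_bigA /= -sum1_card natr_sum mulr_suml big_mkcond /=.
  apply: ler_sum => m _; case: ifP => [|_]; last first.
    by apply: prodr_ge0 => i _; rewrite !exprn_ge0 // ltW.
  rewrite inE mul1r => mn.
  apply: (@le_trans _ _ (x ^+ (\sum_(i < n) i.+1 * m i))).
    by rewrite ler_wiXn2l // ltW.
  rewrite le_eqVlt; apply/orP; left; apply/eqP.
  elim/big_ind2: _ => // [a b c d <- <-|i _]; first by rewrite exprD.
  by rewrite exprM.
(* With y = x^(i + 1) <= x, a factor is at most 1/(1 - y) = 1 + y/(1 - y) <= exp(y/(1 - x)); the
   exponents then form a geometric series. *)
apply: (@le_trans _ _ (\prod_(i < n) expR (x ^+ i.+1 * (1 - x)^-1))).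
  apply: ler_prod => i _; apply/andP; split.
    by apply: sumr_ge0 => j _; rewrite !exprn_ge0 // ltW.
  have y0 : 0 <= x ^+ i.+1 by rewrite exprn_ge0 // ltW.
  have yx : x ^+ i.+1 <= x by rewrite exprS ler_piMr ?exprn_ile1 ?ltW.
  have y1 : x ^+ i.+1 < 1 by apply: le_lt_trans yx x1.
  apply: (le_trans (geometric_sum_le _ y0 y1)).
  apply: le_trans (expR_ge1Dx _).
  have d1 : 0 < 1 - x ^+ i.+1 by rewrite subr_gt0.
  have -> : (1 - x ^+ i.+1)^-1 = 1 + x ^+ i.+1 * (1 - x ^+ i.+1)^-1.
    by field; rewrite gt_eqF.
  rewrite lerD2l ler_wpM2l // lef_pV2 ?posrE //.
  by rewrite lerD2l lerN2.
rewrite -expR_sum ler_expR -mulr_suml; apply: ler_wpM2r; first by rewrite invr_ge0 ltW.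
apply: le_trans (geometric_sum_le n (ltW x0) x1).
by apply: ler_sum => i _; rewrite exprS; apply: ler_piMl; rewrite ?exprn_ge0 // ltW.
Qed.

(** The generating function bound at x = exp(-e). As [e] is arbitrary, the number of cycle types is
    subexponential. *)
Lemma ln_cycle_types_le (e : R) n : 0 < e ->
  ln #|cycle_types n|%:R <= n%:R * e + (1 - expR (- e))^-1 * (1 - expR (- e))^-1.
Proof.
move=> e0; have x1 : expR (- e) < 1 by rewrite expR_lt1 oppr_lt0.
have := cycle_types_le n (expR_gt0 (- e)) x1.
have [->|nz] := eqVneq #|cycle_types n| 0%N.
  have i0 : 0 <= (1 - expR (- e))^-1 by rewrite invr_ge0 subr_ge0 ltW.
  by rewrite ln0 // => _; apply: addr_ge0; apply: mulr_ge0; rewrite // ltW.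
rewrite -expRM_natl mulrN => h.
rewrite -ler_expR lnK ?posrE ?ltr0n ?lt0n //.
by rewrite expRD -ler_pdivrMl ?expR_gt0 // -expRN mulrC.
Qed.
End CycleTypeCount.

(** * Growth rates *)

Section Estimates.
Variable R : realType.
Local Notation sqrt := (@Num.sqrt R).

Lemma sum_exp_le (y : R) M : 0 <= y -> \sum_(k < M) y ^+ k / k`!%:R <= expR y.
Proof.
move=> y0; rewrite /expR -(big_mkord xpredT (fun k => y ^+ k / k`!%:R)).
apply: (@nondecreasing_cvgn_le R (series (exp_coeff y)) _ _ M).
  apply/nondecreasing_seqP => n; rewrite /series /= big_nat_recr //= lerDl.
  by rewrite /exp_coeff /= divr_ge0 ?exprn_ge0.
exact: is_cvg_series_exp_coeff.
Qed.

Lemma term_exp_le (y : R) k : 0 <= y -> y ^+ k / k`!%:R <= expR y.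
Proof.
move=> y0; apply: le_trans (sum_exp_le k.+1 y0); rewrite big_ord_recr /= lerDr.
by apply: sumr_ge0 => i _; rewrite divr_ge0 ?exprn_ge0.
Qed.

(** There are at most k^N/k! partitions into [k] blocks, and (k x)^N <= N! exp(k x) as a single term
    of the exponential series; summing exp(x)^k/k! over [k] gives the double exponential. *)
Lemma npart_any_exp_le (T : finType) (s : pred {set T}) (x : R) : 0 < x ->
  (npart s [set: T])%:R <= (#|T|)`!%:R / x ^+ #|T| * expR (expR x).
Proof.
move=> x0; set N := #|T|; set X := [set P | partition P [set: T] && [forall B in P, s B]].
have lt (P : {set {set T}}) : (#|P| < #|{set T}|.+1)%N by rewrite ltnS max_card.
have -> : npart s [set: T] = (\sum_(k < #|{set T}|.+1) #|[set P in X | #|P| == k]|)%N.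
  rewrite /npart -/X -[LHS]sum1_card (partition_big (fun P => Ordinal (lt P)) xpredT) //=.
  by apply: eq_bigr => k _; rewrite -[RHS]sum1_card; apply: eq_bigl => P; rewrite !inE.
have f0 k : 0 < k`!%:R :> R by rewrite ltr0n fact_gt0.
have xN0 : 0 < x ^+ N by rewrite exprn_gt0.
rewrite natr_sum; apply: (@le_trans _ _ (\sum_(k < #|{set T}|.+1)
    (N`!%:R / x ^+ N * (expR x ^+ k / k`!%:R)))).
  apply: ler_sum => k _; rewrite mulrA ler_pdivlMr //.
  apply: (@le_trans _ _ ((k%:R : R) ^+ N)).
    by rewrite -natrX -natrM ler_nat; apply: npart_any_le.
  rewrite mulrAC ler_pdivlMr // -exprMn [leRHS]mulrC -ler_pdivrMr //.
  by rewrite -expRM_natl; apply: term_exp_le; rewrite mulr_ge0 // ltW.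
rewrite -mulr_sumr ler_wpM2l ?sum_exp_le ?expR_ge0 //.
by rewrite divr_ge0 // ltW.
Qed.

Lemma ln_sqrt_le (x : R) : 0 < x -> ln x <= 2 * sqrt x.
Proof.
move=> x0; rewrite -{1}(sqr_sqrtr (ltW x0)) lnXn ?sqrtr_gt0 // -[leLHS]mulr_natl.
by rewrite ler_pM2l // ltW // ln_sublinear // sqrtr_gt0.
Qed.

Lemma sqrt_ln (x : R) : 0 < x -> ln (sqrt x) = ln x / 2.
Proof.
by move=> x0; rewrite -{2}(sqr_sqrtr (ltW x0)) lnXn ?sqrtr_gt0 //; field.
Qed.

Lemma ln_le_sub1 (x : R) : 0 < x -> ln x <= x - 1.
Proof.
move=> x0; have h : -1 < x - 1 by lra.
by have := le_ln1Dx h; rewrite addrC subrK.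
Qed.

Lemma ln_succ n : (0 < n)%N ->
  ln n.+1%:R - ln n%:R <= n%:R^-1 :> R /\ n.+1%:R^-1 <= ln n.+1%:R - ln n%:R :> R.
Proof.
move=> n0; have n0' : 0 < n%:R :> R by rewrite ltr0n.
rewrite -ln_div ?posrE ?ltr0n //; split.
  apply: (le_trans (ln_le_sub1 _)); first by rewrite divr_gt0 // ltr0n.
  by rewrite -natr1 mulrDl divff ?gt_eqF // addrAC subrr add0r mul1r.
rewrite -[leRHS]opprK -lnV ?posrE ?divr_gt0 ?ltr0n // invf_div lerNr.
apply: (le_trans (ln_le_sub1 _)); first by rewrite divr_gt0 // ltr0n.
rewrite le_eqVlt; apply/orP; left; apply/eqP; rewrite -natr1.
by field; rewrite natr1 pnatr_eq0.
Qed.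

Lemma ln_fact_ge n : n%:R * ln n%:R - n%:R <= ln n`!%:R :> R.
Proof.
elim: n => [|n IH]; first by rewrite mul0r subrr fact0 ln1.
rewrite factS natrM lnM ?posrE ?ltr0n ?fact_gt0 //.
case: n IH => [|n] IH; first by rewrite fact0 !ln1; lra.
have [h _] := ln_succ (ltn0Sn n).
have : n.+1%:R * (ln n.+2%:R - ln n.+1%:R) <= 1 :> R.
  by rewrite mulrC -ler_pdivlMr ?ltr0n // mul1r.
have E : n.+2%:R = n.+1%:R + 1 :> R by rewrite natr1.
move: IH; move: (ln n.+1%:R) (ln n.+2%:R) (ln _`!%:R) => a b c; rewrite E.
move: (n.+1%:R) => d; nra.
Qed.

Lemma ln_fact_le n : (0 < n)%N ->
  ln n`!%:R <= (n%:R + 1) * ln n%:R - n%:R + 1 :> R.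
Proof.
elim: n => [//|[|n] IH] _; first by rewrite factS fact0 muln1 ln1; lra.
have {}IH := IH isT; have [_ h] := ln_succ (ltn0Sn n).
rewrite factS natrM lnM ?posrE ?ltr0n ?fact_gt0 //.
have : 1 <= n.+2%:R * (ln n.+2%:R - ln n.+1%:R) :> R.
  by rewrite mulrC -ler_pdivrMr ?ltr0n // mul1r.
have E : n.+2%:R = n.+1%:R + 1 :> R by rewrite natr1.
move: IH; move: (ln n.+1%:R) (ln n.+2%:R) (ln _`!%:R) => a b c; rewrite E.
move: (n.+1%:R) => d; nra.
Qed.

(** For a = sqrt(n + 1) and b = sqrt n, the correction ln(1 + 1/a) is at most 1/a <= 2(a - b)
    because a^2 - b^2 = 1; in this form it telescopes over a product. *)
Lemma ln_1Dsqrt n : ln (1 + sqrt n.+1%:R) <=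
  ln n.+1%:R / 2 + 2 * (sqrt n.+1%:R - sqrt n%:R).
Proof.
set a := sqrt n.+1%:R; set b := sqrt n%:R.
have a0 : 0 < a by rewrite sqrtr_gt0 ltr0n.
have a2 : a ^+ 2 = b ^+ 2 + 1 by rewrite !sqr_sqrtr // natr1.
have -> : 1 + a = a * (1 + a^-1) by rewrite mulrDr mulr1 divff ?gt_eqF // addrC.
rewrite lnM ?posrE ?addr_gt0 ?invr_gt0 // sqrt_ln ?ltr0n // lerD2l.
apply: (le_trans (le_ln1Dx _)); first by rewrite (lt_trans (ltrN10 _)) // invr_gt0.
rewrite -[leLHS]mul1r ler_pdivrMr //.
have := sqr_ge0 (a - b); rewrite sqrrB a2; nra.
Qed.

Lemma ln_1Dsqrt_mono n : ln (1 + sqrt n%:R) <= ln (1 + sqrt n.+1%:R).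
Proof.
have s0 k : 0 < 1 + sqrt k%:R by rewrite ltr_wpDr ?sqrtr_ge0.
by rewrite ler_ln ?posrE // lerD2l ler_sqrt ?ltr0n // ler_nat.
Qed.

Lemma ln_pairing_id m :
  ln (pairing_bound R id m) <= ln m`!%:R / 2 + 2 * sqrt m%:R.
Proof.
elim: m => [|m IH]; first by rewrite /pairing_bound big_ord0 fact0 ln1 sqrtr0; lra.
rewrite /pairing_bound big_ord_recr /= -/(pairing_bound R id m).
have s0 : 0 < 1 + sqrt m%:R by rewrite ltr_wpDr ?sqrtr_ge0.
rewrite lnM ?posrE ?pairing_bound_gt0 // factS natrM lnM ?posrE ?ltr0n ?fact_gt0 //.
have := ln_1Dsqrt m; have := ln_1Dsqrt_mono m; lra.
Qed.

(** The two new factors have [c] equal to [m] and [m.+1]. Each contributes at most half of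
    [ln m.+1%:R] plus a telescoping term. *)
Lemma ln_pairing_uphalf m :
  ln (pairing_bound R uphalf m.*2) <= ln m`!%:R + 4 * sqrt m%:R.
Proof.
elim: m => [|m IH]; first by rewrite /pairing_bound big_ord0 fact0 ln1 sqrtr0; lra.
rewrite doubleS /pairing_bound !big_ord_recr /= -/(pairing_bound R uphalf m.*2).
have s0 k : 0 < 1 + sqrt k%:R by rewrite ltr_wpDr ?sqrtr_ge0.
have -> : uphalf m.*2 = m by rewrite uphalf_double.
rewrite !lnM ?posrE ?mulr_gt0 ?pairing_bound_gt0 // factS natrM lnM ?posrE ?ltr0n ?fact_gt0 //.
rewrite doubleK; have := ln_1Dsqrt m; have := ln_1Dsqrt_mono m; lra.
Qed.

(** [2 ^ m * m!] is the double factorial (2m)!!, which is at most 2m (2m - 1)!!. *)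
Lemma ln_odd_prod_ge m : (0 < m)%N ->
  m%:R * ln 2 + ln m`!%:R - ln (2 * m%:R) <= ln (\prod_(i < m) i.*2.+1)%N%:R :> R.
Proof.
have pos k : (0 < \prod_(i < k) i.*2.+1)%N by apply: prodn_gt0.
move=> m0; suff h : (2 ^ m * m`! <= m.*2 * \prod_(i < m) i.*2.+1)%N.
  rewrite lerBlDr mulr_natl -lnXn // -!lnM ?posrE ?exprn_gt0 ?ltr0n ?fact_gt0 ?mulr_gt0 ?ltr0n //.
  rewrite ler_ln ?posrE ?mulr_gt0 ?exprn_gt0 ?ltr0n ?fact_gt0 //.
  by rewrite -natrX -!natrM ler_nat [leqRHS]mulnC mul2n.
elim: m m0 => [//|[|m] IH] _; first by rewrite big_ord_recr big_ord0.
rewrite big_ord_recr /= expnS (factS m.+1); have := IH isT.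
move: (\prod_(_ < _) _)%N (2 ^ _)%N (_`!) => P a b h.
apply: (@leq_trans (2 * m.+2 * (m.+1.*2 * P))%N).
  have := leq_mul (leqnn (2 * m.+2)%N) h; lia.
rewrite -!muln2; nia.
Qed.
End Estimates.

(** * From logarithmic estimates to n-th roots *)

Section Asymptotics.
Local Open Scope classical_set_scope.
Variable R : realType.
Local Notation sqrt := (@Num.sqrt R).

(** The relative error common to all five counts. It is dictated by the Bell numbers, through the
    term [sqrt L] in [x = L - sqrt L]. *)
Definition rate n : R := (sqrt (ln (2 * n%:R)))^-1.

Lemma near_large (M : R) : \forall n \near \oo, M <= n%:R.
Proof. exact: nbhs_infty_ger. Qed.

Lemma ln_double_ge (c : R) n : expR c <= n%:R -> c <= ln (2 * n%:R).
Proof.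
move=> h; have n0 : 0 < n%:R :> R by apply: lt_le_trans h; apply: expR_gt0.
rewrite -ler_expR lnK ?posrE ?mulr_gt0 //; lra.
Qed.

Lemma rate_small (C e : R) : 0 < e -> \forall n \near \oo, C * rate n <= e.
Proof.
move=> e0; near=> n; pose c := `|C| / e + 1.
have c0 : 0 < c by rewrite ltr_wpDl // divr_ge0 // ltW.
have h : c ^+ 2 <= ln (2 * n%:R) by apply: ln_double_ge; near: n; apply: near_large.
have h' : c <= sqrt (ln (2 * n%:R)).
  by rewrite -(ger0_norm (ltW c0)) -sqrtr_sqr ler_wsqrtr.
have s0 : 0 < sqrt (ln (2 * n%:R)) by apply: lt_le_trans h'.
apply: (@le_trans _ _ (`|C| * rate n)).
  by rewrite ler_wpM2r ?ler_norm // /rate invr_ge0 ltW.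
rewrite /rate ler_pdivrMr // mulrC -ler_pdivrMr //.
by apply: le_trans h'; rewrite /c lerDl.
Unshelve. all: by end_near. Qed.


(** [2 ln (b n)] exceeds [ln (D n)] by at most the logarithm of the number of cycle types, which is
    o(n). Hence the logarithm [u] of the quotient tends to 0. *)
Lemma root_asymptotic (D b : nat -> nat) (g : nat -> R) (C M : R) :
  (forall n, (0 < D n)%N) ->
  (forall n, (D n <= b n ^ 2 <= #|cycle_types n| * D n)%N) ->
  (forall n, M <= n%:R -> 0 < g n /\
     `|ln (D n)%:R - n.*2%:R * ln (g n)| <= C * (n.*2%:R * rate n)) ->
  asymptotic_to (fun n => nth_root R n (b n)) g.
Proof.
move=> D0 bD gD.
have b0 n : (0 < b n)%N.
  by have := D0 n; case/andP: (bD n) => h _ /leq_trans/(_ h); rewrite expn_gt0 orbF.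
have N0 n : (0 < #|cycle_types n|)%N.
  have := b0 n; case/andP: (bD n) => _ h; rewrite -(ltn_sqr 0) => /leq_trans/(_ h).
  by rewrite muln_gt0 => /andP[].
pose u n := ln (b n)%:R / n%:R - ln (g n).
pose X n : R := 2 * ln (b n)%:R - ln (D n)%:R.
have lnb n : 0 <= X n /\ X n <= ln #|cycle_types n|%:R.
  have E : 2 * ln (b n)%:R = ln (b n ^ 2)%:R :> R.
    by rewrite natrX lnXn ?ltr0n // mulr_natl.
  case/andP: (bD n) => h1 h2.
  have bb : (0 < b n ^ 2)%N by rewrite expn_gt0 b0.
  have ND : (0 < #|cycle_types n| * D n)%N by rewrite muln_gt0 N0 D0.
  rewrite /X E; split; first by rewrite subr_ge0 ler_ln ?posrE ?ltr0n ?ler_nat.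
  rewrite lerBlDr -lnM ?posrE ?ltr0n // -natrM.
  by rewrite ler_ln ?posrE ?ltr0n ?ler_nat.
have u0 : u @ \oo --> 0.
  apply/cvgr0Pnorm_le => e e0; near=> n.
  (* The budget for [2 n |u n|] is [2 n e]: the cycle types take [n e / 2 + K] with [K <= n e - e],
     and the growth of [D] takes the other [n e / 2]. *)
  pose K : R := (1 - expR (- (e / 2)))^-1 * (1 - expR (- (e / 2)))^-1.
  have nM : M <= n%:R by near: n; apply: near_large.
  have nK : K / e + 1 <= n%:R by near: n; apply: near_large.
  have n1 : 1 <= n%:R :> R by near: n; apply: near_large.
  have r1 : C * rate n <= e / 4 by near: n; apply: rate_small; lra.
  have n0 : 0 < n%:R :> R by lra.
  have [_ gDn] := gD _ nM.
  have cN : ln #|cycle_types n|%:R <= n%:R * (e / 2) + K.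
    by apply: ln_cycle_types_le; lra.
  have Kn : K <= n%:R * e - e.
    have : K / e <= n%:R - 1 by lra.
    by rewrite ler_pdivrMr //; lra.
  rewrite -(ler_pM2l n0) -{1}(ger0_norm (ltW n0)) -normrM.
  have -> : n%:R * u n = ln (b n)%:R - n%:R * ln (g n).
    by rewrite /u mulrBr mulrCA divff ?gt_eqF // mulr1.
  move: gDn; rewrite -muln2 natrM !ler_norml => /andP[g1 g2].
  have Cr : C * (n%:R * 2 * rate n) <= n%:R * (e / 2).
    have : n%:R * (C * rate n) <= n%:R * (e / 4) by rewrite ler_pM2l.
    lra.
  have [] := lnb n; rewrite /X => b1 b2.
  apply/andP; split; lra.
have eu : (fun n => expR (u n)) @ \oo --> (1 : R).
  by rewrite -expR0; apply: continuous_cvg => //; apply: continuous_expR.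
rewrite /asymptotic_to; apply: cvg_trans eu; apply: near_eq_cvg; near=> n.
have nM : M <= n%:R by near: n; apply: near_large.
have [g0 _] := gD _ nM.
have bn : 0 < (b n)%:R :> R by rewrite ltr0n.
rewrite /u expRD expRN lnK ?posrE // /nth_root.
by congr (_ / _); rewrite -[RHS]lnK ?posrE ?powR_gt0 // ln_powR mulrC.
Unshelve. all: by end_near. Qed.
End Asymptotics.

Section GrowthRates.
Variable R : realType.
Local Notation sqrt := (@Num.sqrt R).
Local Notation rate := (rate R).

(** Since [ln (2 n) <= n], errors of order [sqrt n] fit into the common scale. *)
Lemma sqrt_le_rate n : 1 <= n%:R :> R -> sqrt n%:R <= n%:R * rate n.
Proof.
move=> n1; have n0 : 0 < n%:R :> R by lra.
have s0 : 0 < sqrt n%:R by rewrite sqrtr_gt0.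
have L0 : 0 < ln (2 * n%:R) :> R by apply: ln_gt0; lra.
have Ln : ln (2 * n%:R) <= n%:R :> R.
  rewrite lnM ?posrE //; have := ln_le_sub1 n0; have := @ln_le_sub1 R 2 (ltr0n _ 2); lra.
rewrite /rate ler_pdivlMr ?sqrtr_gt0 //.
apply: (@le_trans _ _ (sqrt n%:R * sqrt n%:R)); first by rewrite ler_pM2l // ler_wsqrtr.
by rewrite -expr2 sqr_sqrtr // ltW.
Qed.

Lemma sqrt_double_le n : sqrt n.*2%:R <= 2 * sqrt n%:R.
Proof.
rewrite -{1}(ger0_norm (ler0n R 2)) -sqrtr_sqr -sqrtrM ?sqr_ge0 // ler_wsqrtr //.
by rewrite -natrX -natrM ler_nat; lia.
Qed.

Lemma sqrt_nat_ge1 n : 1 <= n%:R :> R -> 1 <= sqrt n%:R.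
Proof. by move=> n1; rewrite -{1}sqrtr1 ler_wsqrtr. Qed.

Lemma ln_nat_le n : 1 <= n%:R :> R -> ln n%:R <= 2 * sqrt n%:R.
Proof. by move=> n1; apply: ln_sqrt_le; lra. Qed.

Lemma expR1_sqrt_gt0 : 0 < sqrt (expR 1). Proof. by rewrite sqrtr_gt0 expR_gt0. Qed.

(** Stirling's estimate leaves [ln n + 1 <= 3 sqrt n], and the hypothesis adds [4 sqrt n]; this
    accounts for the 7, which is also large enough for the other counts. *)
Lemma factorial_growth (x : R) n : 1 <= n%:R :> R ->
  ln n`!%:R <= x -> x <= ln n`!%:R + 4 * sqrt n%:R ->
  0 < 1 / sqrt (expR 1) * sqrt n%:R /\
  `|x - n.*2%:R * ln (1 / sqrt (expR 1) * sqrt n%:R)| <= 7 * (n.*2%:R * rate n).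
Proof.
move=> n1 x1 x2; have n0 : 0 < n%:R :> R by lra.
have s0 : 0 < sqrt n%:R by rewrite sqrtr_gt0.
have e0 := expR1_sqrt_gt0.
split; first by rewrite mulr_gt0 // divr_gt0.
have -> : ln (1 / sqrt (expR 1) * sqrt n%:R) = (ln n%:R - 1) / 2.
  rewrite lnM ?posrE ?divr_gt0 // ln_div ?posrE // ln1 !sqrt_ln ?expR_gt0 // expRK.
  by lra.
have f1 := ln_fact_ge R n; have f2 := @ln_fact_le R n.
have {}f2 := f2 ltac:(by rewrite -(ltr0n R)).
have h1 := sqrt_le_rate n1; have h2 := ln_nat_le n1; have h3 := sqrt_nat_ge1 n1.
by rewrite -muln2 natrM ler_norml; apply/andP; split; lra.
Qed.

Lemma matching_growth (x : R) n : 1 <= n%:R :> R ->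
  ln (\prod_(i < n) i.*2.+1)%N%:R <= x ->
  x <= ln (n.*2)`!%:R / 2 + 2 * sqrt n.*2%:R ->
  0 < sqrt 2 / sqrt (expR 1) * sqrt n%:R /\
  `|x - n.*2%:R * ln (sqrt 2 / sqrt (expR 1) * sqrt n%:R)| <= 7 * (n.*2%:R * rate n).
Proof.
move=> n1 x1 x2; have n0 : 0 < n%:R :> R by lra.
have n0' : (0 < n)%N by rewrite -(ltr0n R).
have s0 : 0 < sqrt n%:R by rewrite sqrtr_gt0.
have e0 := expR1_sqrt_gt0; have t0 : 0 < sqrt 2 by rewrite sqrtr_gt0.
split; first by rewrite mulr_gt0 // divr_gt0.
have -> : ln (sqrt 2 / sqrt (expR 1) * sqrt n%:R) = (ln 2 + ln n%:R - 1) / 2.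
  rewrite lnM ?posrE ?divr_gt0 // ln_div ?posrE // !sqrt_ln ?expR_gt0 // expRK.
  by lra.
have f1 := ln_fact_ge R n; have := @ln_fact_le R n.*2; rewrite double_gt0 => /(_ n0') f2.
have f3 := ln_odd_prod_ge R n0'.
have h1 := sqrt_le_rate n1; have h2 := ln_nat_le n1; have h3 := sqrt_nat_ge1 n1.
have h4 := sqrt_double_le n.
have h5 : ln (2 * n%:R) = ln 2 + ln n%:R :> R by rewrite lnM ?posrE.
have h6 : ln n.*2%:R = ln 2 + ln n%:R :> R by rewrite -mul2n natrM h5.
have h7 := @ln_le_sub1 R 2 (ltr0n _ 2).
move: f2 f3; rewrite h5 h6 -!muln2 natrM => f2 f3.
rewrite ler_norml; move: (sqrt (n * 2)%:R) x2 h4 => y; rewrite -muln2 => x2 h4.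
apply/andP; split; nra.
Qed.

(* The upper bound is used at [x = L - sqrt L] and the lower bound at [k = m / L],
   where [m = 2 n] and [L = ln m]. *)
Lemma bell_growth (D n : nat) : expR 16 <= n%:R :> R -> (0 < D)%N ->
  (forall k, (k <= n.*2)%N -> (k ^ (n.*2 - k) <= D)%N) ->
  (forall x : R, 0 < x -> D%:R <= (n.*2)`!%:R / x ^+ n.*2 * expR (expR x)) ->
  0 < 2 / expR 1 * (n%:R / ln (2 * n%:R)) :> R /\
  `|ln D%:R - n.*2%:R * ln (2 / expR 1 * (n%:R / ln (2 * n%:R)))| <= 7 * (n.*2%:R * rate n).
Proof.
move=> nbig D0 lower upper.
have n0 : 0 < n%:R :> R by apply: lt_le_trans nbig; apply: expR_gt0.
set L : R := ln (2 * n%:R); have L16 : 16 <= L by apply: ln_double_ge.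
have L0 : 0 < L by lra.
have mL : n.*2%:R = expR L by rewrite /L lnK ?posrE ?mulr_gt0 // -mul2n natrM.
have m0 : (0 < n.*2)%N by rewrite double_gt0 -(ltr0n R).
have -> : rate n = (sqrt L)^-1 by [].
have s0 : 0 < sqrt L by rewrite sqrtr_gt0.
have s2 : sqrt L * sqrt L = L by rewrite -expr2 sqr_sqrtr // ltW.
have s4 : 4 <= sqrt L by nra.
have e1 := expR_gt0 (1 : R).
split; first by rewrite !mulr_gt0 ?invr_gt0.
have -> : ln (2 / expR 1 * (n%:R / L)) = L - ln L - 1.
  have -> : 2 / expR 1 * (n%:R / L) = 2 * n%:R / L / expR 1 by field; rewrite !gt_eqF.
  by rewrite !ln_div ?posrE ?divr_gt0 ?mulr_gt0 // expRK.
set d := (sqrt L)^-1; set m : R := n.*2%:R.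
have d0 : 0 < d by rewrite invr_gt0.
have sd : sqrt L * d = 1 by rewrite divff ?gt_eqF.
have Ld : L * d = sqrt L by rewrite -{1}s2 -mulrA sd mulr1.
have d4 : d <= 4^-1 by rewrite lef_pV2 ?posrE.
have mpos : 0 < m by rewrite /m ltr0n.
(* From m = exp L >= L^2/2 and [4 <= sqrt L], terms of order [L] are absorbed into [m * d]; this is
   the purpose of [expR 16]. *)
have LmdA : L ^+ 2 / 2 <= m by rewrite /m mL; apply: (term_exp_le 2 (ltW L0)).
have Lmd : 2 * L <= m * d.
  have : L ^+ 2 / 2 * d <= m * d by rewrite ler_pM2r.
  have -> : L ^+ 2 / 2 * d = L * (L * d) / 2 by ring.
  rewrite Ld; nra.
have up : ln D%:R <= m * (L - ln L - 1) + 7 * (m * d).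
  (* Here exp x = m exp(-sqrt L) <= m d, while ln x = ln L + ln(1 - d) loses at most 2 d. *)
  pose x := L - sqrt L.
  have x0 : 0 < x by rewrite /x; nra.
  have fm0 : 0 < (n.*2)`!%:R :> R by rewrite ltr0n fact_gt0.
  have xm0 : 0 < x ^+ n.*2 by rewrite exprn_gt0.
  have : ln D%:R <= ln ((n.*2)`!%:R / x ^+ n.*2 * expR (expR x)).
    rewrite ler_ln ?posrE ?ltr0n //; first exact: upper.
    by rewrite mulr_gt0 ?divr_gt0 ?expR_gt0.
  rewrite lnM ?posrE ?divr_gt0 ?expR_gt0 // ln_div ?posrE // lnXn // expRK -mulr_natl -/m.
  have fm := ln_fact_le R m0; rewrite -/m in fm.
  have lnm : ln m = L by rewrite /m mL expRK.
  rewrite lnm in fm.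
  have ex : expR x <= m * d.
    rewrite /x expRD -mL -/m ler_pM2l // expRN lef_pV2 ?posrE ?expR_gt0 //.
    have := expR_ge1Dx (sqrt L); lra.
  have lx : ln L - 2 * d <= ln x.
    have -> : x = L * (1 - d) by rewrite mulrBr mulr1 Ld.
    have d1 : 0 < 1 - d by lra.
    rewrite lnM ?posrE // lerD2l lerNl -lnV ?posrE //.
    apply: le_trans (ln_le_sub1 _) _; first by rewrite invr_gt0.
    rewrite lerBlDr -(ler_pM2r d1) mulVf ?gt_eqF //; nra.
  have : m * (ln L - 2 * d) <= m * ln x by rewrite ler_pM2l.
  lra.
have lo : m * (L - ln L - 1) - 7 * (m * d) <= ln D%:R.
  pose y := m / L; have y0 : 0 < y by rewrite divr_gt0.
  have yL : y * L = m by rewrite divfK // gt_eqF.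
  have y8 : 8 <= y.
    rewrite /y ler_pdivlMr //; nra.
  have /truncn_itv/andP[] := ltW y0; set k := Num.truncn y => ky yk.
  rewrite -natr1 in yk.
  have k0 : (0 < k)%N by rewrite -(ltr0n R); lra.
  have km : k%:R <= m by apply: (le_trans ky); rewrite -yL ler_peMr ?ltW //; lra.
  have kn : (k <= n.*2)%N by rewrite -(ler_nat R).
  have h : (m - k%:R) * ln k%:R <= ln D%:R.
    rewrite /m -natrB // mulr_natl -lnXn ?ltr0n // -natrX.
    by rewrite ler_ln ?posrE ?ltr0n ?expn_gt0 ?k0 // ler_nat lower.
  have lk0 : 0 <= ln k%:R :> R by apply: ln_ge0; rewrite ler1n.
  have lL0 : 0 <= ln L by apply: ln_ge0; lra.
  (* Rounding [y = m / L] down to [k] lowers the logarithm by at most [2 / y], and (m - y) 2/y = 2 L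
     - 2 is absorbed into [m * d]. *)
  have lk : L - ln L - 2 / y <= ln k%:R.
    have -> : L - ln L = ln y.
      by rewrite /y ln_div ?posrE // /m mL expRK.
    apply: (@le_trans _ _ (ln (y * (1 - y^-1)))); last first.
      rewrite ler_ln ?posrE ?ltr0n // mulrBr mulr1 divff ?gt_eqF //; lra.
    have yi0 : 0 < y^-1 by rewrite invr_gt0.
    have yi : y^-1 <= 8^-1 by rewrite lef_pV2 ?posrE.
    have d1 : 0 < 1 - y^-1 by lra.
    rewrite lnM ?posrE // lerD2l lerNl -lnV ?posrE //.
    apply: le_trans (ln_le_sub1 _) _; first by rewrite invr_gt0.
    rewrite lerBlDr -(ler_pM2r d1) mulVf ?gt_eqF //.
    by move: (y^-1) yi0 yi => u u0 u8; nra.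
  have my : 0 <= m - y by rewrite -yL; nra.
  have : (m - y) * (L - ln L - 2 / y) <= (m - y) * ln k%:R by rewrite ler_wpM2l.
  have : (m - y) * ln k%:R <= (m - k%:R) * ln k%:R by rewrite ler_wpM2r //; lra.
  have -> : (m - y) * (L - ln L - 2 / y) = m * (L - ln L) - y * L + y * ln L - 2 * L + 2.
    by rewrite -yL; field; rewrite gt_eqF.
  rewrite yL; nra.
rewrite ler_norml; apply/andP; split; lra.
Qed.
End GrowthRates.

Lemma card_pts n : #|[set: 'I_n + 'I_n]| = n.*2.
Proof. by rewrite cardsT card_sum !card_ord addnn. Qed.

Lemma card_diagram_gt0 (S : block_cond) n : diagram_class S -> (0 < #|{: diagram S n n}|)%N.
Proof.
by move=> SC; rewrite card_diagram; apply: leq_trans (factorial_le_diagrams n SC); apply: fact_gt0.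
Qed.

(** * The five categories *)

Section CategoryAsymptotics.
Variables (R : realType) (t : R[i]) (S : block_cond).
Hypotheses (SC : diagram_class S) (gen : generic t S).

Lemma summand_asymptotics (g : nat -> R) (M : R) :
  (forall n, M <= n%:R -> 0 < g n /\
    `|ln #|{: diagram S n n}|%:R - n.*2%:R * ln (g n)| <= 7 * (n.*2%:R * rate R n)) ->
  exists b : nat -> nat, summand_numbers t S b /\
    asymptotic_to (fun n => nth_root R n (b n)) g.
Proof.
move=> gD; have [b [bS bD]] := summand_number_bounds SC gen.
exists b; split=> //; apply: (@root_asymptotic _ _ _ _ 7 M _ bD gD) => n.
exact: card_diagram_gt0.
Qed.

(** The class lies between the permutations and the rook diagrams, whose numbers differ by a factor
    exp(O(sqrt n)) only. *)
Lemma factorial_asymptotics :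
  (forall n (B : {set 'I_n + 'I_n}), S B -> rook_block B) ->
  exists b : nat -> nat, summand_numbers t S b /\
    asymptotic_to (fun n => nth_root R n (b n))
      (fun n => 1 / Num.sqrt (expR 1) * Num.sqrt n%:R).
Proof.
move=> rook; apply: (@summand_asymptotics _ 1) => n n1.
have D0 := card_diagram_gt0 n SC.
apply: factorial_growth => //.
  by rewrite ler_ln ?posrE ?ltr0n ?fact_gt0 // ler_nat card_diagram factorial_le_diagrams.
apply: le_trans (ln_pairing_uphalf R n).
rewrite ler_ln ?posrE ?ltr0n ?pairing_bound_gt0 // card_diagram.
apply: le_trans (npart_rook_le R n); rewrite ler_nat; apply: npart_mono; exact: rook.
Qed.

(** The class lies between the perfect and the partial matchings of [2 n] points; allowing
    singletons costs a factor exp(O(sqrt n)) only. *)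
Lemma matching_asymptotics :
  (forall n (B : {set 'I_n + 'I_n}), #|B| = 2%N -> S B) ->
  (forall n (B : {set 'I_n + 'I_n}), S B -> (#|B| <= 2)%N) ->
  exists b : nat -> nat, summand_numbers t S b /\
    asymptotic_to (fun n => nth_root R n (b n))
      (fun n => Num.sqrt 2 / Num.sqrt (expR 1) * Num.sqrt n%:R).
Proof.
move=> S2 le2; apply: (@summand_asymptotics _ 1) => n n1.
have D0 := card_diagram_gt0 n SC.
apply: matching_growth => //.
  rewrite ler_ln ?posrE ?ltr0n ?prodn_gt0 // ler_nat card_diagram.
  rewrite -(npart_perfect_matching (card_pts n)); apply: npart_mono => B /eqP.
  exact: S2.
rewrite -(card_pts n); apply: le_trans (ln_pairing_id R _).
rewrite ler_ln ?posrE ?ltr0n ?pairing_bound_gt0 // card_diagram.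
apply: npart_rook_brauer_le; exact: le2.
Qed.
End CategoryAsymptotics.

Lemma bell_asymptotics (R : realType) (t : R[i]) : generic t any_block ->
  exists b : nat -> nat, summand_numbers t any_block b /\
    asymptotic_to (fun n => nth_root R n (b n))
      (fun n => 2 / expR 1 * (n%:R / ln (2 * n%:R))).
Proof.
move=> gen; apply: (summand_asymptotics any_class gen (M := expR 16)) => n nbig.
have cT : #|{: 'I_n + 'I_n}| = n.*2 by rewrite -cardsT card_pts.
apply: bell_growth => // [|k kn|x x0].
- exact: card_diagram_gt0 any_class.
- by rewrite card_diagram -cT; apply: npart_any_ge; rewrite cT.
- by rewrite card_diagram -cT; apply: npart_any_exp_le.
Qed.

Theorem mainTheorem4 (R : realType) (t : R[i]) :
  [/\ (* the partition category *)
      generic t any_block ->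
      exists b : nat -> nat, summand_numbers t any_block b /\
        asymptotic_to (fun n => nth_root R n (b n))
          (fun n => 2 / expR 1 * (n%:R / ln (2 * n%:R))),
      (* the rook-Brauer category *)
      generic t rook_brauer_block ->
      exists b : nat -> nat, summand_numbers t rook_brauer_block b /\
        asymptotic_to (fun n => nth_root R n (b n))
          (fun n => Num.sqrt 2 / Num.sqrt (expR 1) * Num.sqrt n%:R),
      (* the Brauer category *)
      generic t brauer_block ->
      exists b : nat -> nat, summand_numbers t brauer_block b /\
        asymptotic_to (fun n => nth_root R n (b n))
          (fun n => Num.sqrt 2 / Num.sqrt (expR 1) * Num.sqrt n%:R),
      (* the rook category *)
      generic t rook_block ->
      exists b : nat -> nat, summand_numbers t rook_block b /\
        asymptotic_to (fun n => nth_root R n (b n))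
          (fun n => 1 / Num.sqrt (expR 1) * Num.sqrt n%:R)
    & (* the symmetric category *)
      generic t permutation_block ->
      exists b : nat -> nat, summand_numbers t permutation_block b /\
        asymptotic_to (fun n => nth_root R n (b n))
          (fun n => 1 / Num.sqrt (expR 1) * Num.sqrt n%:R)].
Proof.
split=> gen.
- exact: bell_asymptotics.
- apply: (matching_asymptotics rook_brauer_class gen) => n B.
    by rewrite /rook_brauer_block => ->.
  by case/orP=> /eqP->.
- apply: (matching_asymptotics brauer_class gen) => n B; first by move/eqP.
  by move/eqP->.
- exact: (factorial_asymptotics rook_class gen).
- apply: (factorial_asymptotics permutation_class gen) => n B /andP[/eqP b1 /eqP t1].
  by rewrite /rook_block card_bottoms_tops b1 t1.
Qed.
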